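(* Let $\lambda,\kappa$ be nonzero real numbers with $\lambda\kappa<0$ and $\lambda\in(-\infty,0)\cup(1,\infty)$. Then there exist smooth initial data $(u_0,\rho_0)$ on $[0,1]$ satisfying the periodic boundary conditions, with $\rho_0$ vanishing at finitely many (and at least one) points $x_i\in[0,1]$, at which $\lambda u_0'(x_i)>0$, such that the corresponding solution $(u,\rho)$ of the generalized Hunter–Saxton system has a finite $L^\infty$ blowup time $t_*>0$ and the following hold: (1) if $p\in(1,\infty)$ and $\lambda\in(-\infty,-2/p]\cup(1,\infty)$, then $\lim_{t\nearrow t_*}\|u_x(\cdot,t)\|_p=+\infty$; (2) if $p\in[1,\infty)$ and $\lambda\in(-2/(2p-1),0)$, then $\lim_{t\nearrow t_*}\|u_x(\cdot,t)\|_p<\infty$.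
   Context: For nonzero real parameters $\lambda,\kappa$, the generalized Hunter–Saxton system is $$u_{xt}+uu_{xx}-\lambda u_x^2-\kappa\rho^2=I(t),\qquad \rho_t+u\rho_x=2\lambda\rho u_x,\qquad x\in[0,1],\ t>0,$$ with initial data $u(x,0)=u_0(x)$, $\rho(x,0)=\rho_0(x)$, where $$I(t)=-\kappa\int_0^1\rho^2\,dx-(1+\lambda)\int_0^1u_x^2\,dx,$$ and with periodic boundary conditions $u(0,t)=u(1,t)$, $u_x(0,t)=u_x(1,t)$, $\rho(0,t)=\rho(1,t)$. Initial data ''satisfy the periodic boundary conditions'' if these identities hold at $t=0$. The finite $L^\infty$ blowup time $t_*>0$ is the finite time such that the solution is smooth for $0\le t<t_*$ and $\|u_x(\cdot,t)\|_{L^\infty([0,1])}\to\infty$ as $t\nearrow t_*$. Here $\|\cdot\|_p$ denotes the norm of $L^p([0,1])$ in the variable $x$. *)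

(* Defs.v *)
From Stdlib Require Import Reals List.
From Coquelicot Require Import Coquelicot.
Open Scope R_scope.

(* Functions on [0,1] (resp. [0,1] x [0,T)) are represented by total functions
   on R (resp. R x R) of which only the values near that set matter.  Being
   smooth on such a non-open set means being C^infinity on a neighbourhood of
   each of its points, so that the two-sided derivatives taken at the endpoints
   x = 0, 1 and at t = 0 are the one-sided ones. *)
Definition smooth_on_unit (f : R -> R) : Prop :=
  forall x, 0 <= x <= 1 -> locally x (fun y => forall n, ex_derive_n f n y).

Definition smooth_on_strip (T : R) (f : R -> R -> R) : Prop :=
  forall x t, 0 <= x <= 1 -> 0 <= t < T ->
    locally_2d (fun y s => forall n, ex_diff_n f n y s) x t.

Definition dx (f : R -> R -> R) (x t : R) : R := Derive (fun y => f y t) x.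
Definition dt (f : R -> R -> R) (x t : R) : R := Derive (fun s => f x s) t.

Definition periodic_data (u0 rho0 : R -> R) : Prop :=
  u0 0 = u0 1 /\ Derive u0 0 = Derive u0 1 /\ rho0 0 = rho0 1.

Definition gHS_I (lambda kappa : R) (u rho : R -> R -> R) (t : R) : R :=
  - kappa * RInt (fun x => (rho x t) ^ 2) 0 1
  - (1 + lambda) * RInt (fun x => (dx u x t) ^ 2) 0 1.

Record gHS_solution (lambda kappa : R) (u0 rho0 : R -> R) (T : R)
    (u rho : R -> R -> R) : Prop := {
  gHS_smooth_u : smooth_on_strip T u;
  gHS_smooth_rho : smooth_on_strip T rho;
  gHS_eq_u : forall x t, 0 <= x <= 1 -> 0 < t < T ->
    dt (dx u) x t + u x t * dx (dx u) x t
      - lambda * (dx u x t) ^ 2 - kappa * (rho x t) ^ 2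
    = gHS_I lambda kappa u rho t;
  gHS_eq_rho : forall x t, 0 <= x <= 1 -> 0 < t < T ->
    dt rho x t + u x t * dx rho x t = 2 * lambda * rho x t * dx u x t;
  gHS_init : forall x, 0 <= x <= 1 -> u x 0 = u0 x /\ rho x 0 = rho0 x;
  gHS_periodic : forall t, 0 <= t < T ->
    u 0 t = u 1 t /\ dx u 0 t = dx u 1 t /\ rho 0 t = rho 1 t
}.

(* Real power of a nonnegative base; Stdlib's Rpower 0 p is 1, not 0. *)
Definition powR (a p : R) : R := if Req_EM_T a 0 then 0 else Rpower a p.

(* L^p([0,1]) norms.  They are only applied to functions continuous on [0,1],
   for which the Lebesgue integral is the Riemann integral and the essential
   supremum is the (finite) supremum. *)
Definition Lp_norm (p : R) (f : R -> R) : R :=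
  powR (RInt (fun x => powR (Rabs (f x)) p) 0 1) (/ p).

Definition Linf_norm (f : R -> R) : R :=
  real (Lub_Rbar (fun y => exists x, 0 <= x <= 1 /\ y = Rabs (f x))).

Definition Linf_blowup (u : R -> R -> R) (T : R) : Prop :=
  filterlim (fun t => Linf_norm (fun x => dx u x t))
    (at_left T) (Rbar_locally p_infty).

(* Main.v *)
Require Import Defs.
From Stdlib Require Import Reals List Lra Lia ClassicalEpsilon.
From Coquelicot Require Import Coquelicot.
Open Scope R_scope.

(** The system is solved explicitly along characteristics.  Let jac be the
    Jacobian of the flow map.  The transport equation gives
    rho = rho0 jac^(2 lambda) along each characteristic, and jac^(-lambda)
    solves a linear second-order equation perturbed by a multiple of
    rho0^2 jac^(3 lambda): an Ermakov-Pinney equation.  In a new time e with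
    de/dt = K0(e)^(-2 lambda), where K0 is fixed by requiring that the flow
    preserve the length of a period, its solution is
    jac = Q^(-1/(2 lambda)) / K0, with
<<
      Q(x, e) = (1 - A(x) e)^2 + (B(x) e)^2,
      A = lambda u0',   B^2 = - lambda kappa rho0^2,
      K0(e) = int_0^1 Q(x, e)^(-1/(2 lambda)) dx.
>>
    The sign of lambda kappa makes B real, so Q vanishes only where rho0 does,
    first at e = 1 / max A over the zeros of rho0.  With mu = -1/(2 lambda), the
    derivative u_x on the characteristic of x is (de/dt) (mu Q_e/Q - K0'/K0).

    The data are A = cos(4 pi x) and B = sin(2 pi x)^k: the zeros of rho0 are
    maxima of A, blow-up takes place at e = 1, and near a zero
    Q ~ (1 - e + x^2)^2 + x^(2k) up to constants.  For lambda > 1 the choice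
    k = 1 makes Q^mu integrable up to e = 1; for lambda < 0 the choice k = 2
    fits the thresholds of the statement.  In both cases K0 stays between
    positive constants, so that e = 1 is reached at a finite time tstar
    (blowup_time).

    The p-th power of the L^p norm of u_x is the integral of |u_x|^p jac over
    labels.  Near a zero, on the scale (1 - e)^(1/k), the ratio Q_e/Q is of
    order 1/(1 - e), while far from the zeros it is bounded; the term K0'/K0
    does not depend on x, so it cannot compensate Q_e/Q in both places.  This
    bounds the integral below by (1 - e)^(-p) or by
    (1 - e)^(-p + 2 mu + 1/k), and both exponents are negative in case (1)
    (Lp_mass_blowup).  Conversely |Q_e/Q| is at most 3 Q^(-1/2), and
    Q^(mu - p/2) is dominated by an integrable power of x exactly when
    2 k (mu - p/2) > -1, which for k = 2 is the condition of case (2); the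
    integrals then converge by dominated convergence (Lp_mass_converges).  The
    sup norm dominates every L^p norm, and for large p the latter blows up.

    It remains to pass to an arbitrary solution with these data.  In the frame
    moved so that its velocity and that of the explicit solution have the same
    mean, the squared L^2 distance between the pairs (u_x, rho) satisfies a
    Gronwall inequality: the nonlocal terms are multiplied by a function of
    zero mean, and the difference of the velocities is controlled by that of
    their derivatives.  Hence the two solutions agree up to a translation in x
    (unique_up_to_shift), which changes no norm over a period. *)

(** * Derivatives and continuity in one and two variables *)
Lemma der_const (c x : R) : is_derive (fun _ : R => c) x 0.
Proof. apply (is_derive_const (K := R_AbsRing) (V := R_NormedModule) c x). Qed.

Lemma der_id (x : R) : is_derive (fun y : R => y) x 1.
Proof. apply (is_derive_id (K := R_AbsRing) x). Qed.

Lemma der_plus (f g : R -> R) (x a b : R) :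
  is_derive f x a -> is_derive g x b -> is_derive (fun y => f y + g y) x (a + b).
Proof. apply (is_derive_plus (V := R_NormedModule) f g x a b). Qed.

Lemma der_mult (f g : R -> R) (x a b : R) :
  is_derive f x a -> is_derive g x b ->
  is_derive (fun y => f y * g y) x (a * g x + f x * b).
Proof. intros Hf Hg. apply (is_derive_mult f g x a b Hf Hg Rmult_comm). Qed.

Lemma der_opp (f : R -> R) (x a : R) :
  is_derive f x a -> is_derive (fun y => - f y) x (- a).
Proof. apply (is_derive_opp (V := R_NormedModule) f x a). Qed.

Lemma der_minus (f g : R -> R) (x a b : R) :
  is_derive f x a -> is_derive g x b -> is_derive (fun y => f y - g y) x (a - b).
Proof. apply (is_derive_minus (V := R_NormedModule) f g x a b). Qed.

Lemma der_comp (f g : R -> R) (x a b : R) :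
  is_derive f (g x) a -> is_derive g x b -> is_derive (fun y => f (g y)) x (a * b).
Proof.
  intros Hf Hg. rewrite Rmult_comm.
  apply (is_derive_comp (V := R_NormedModule) f g x a b Hf Hg).
Qed.

Lemma der_eq (f : R -> R) (x a b : R) : is_derive f x a -> a = b -> is_derive f x b.
Proof. now intros H <-. Qed.

Ltac der_by := eapply der_eq.

Lemma der_continuous (f : R -> R) (x a : R) : is_derive f x a -> continuous f x.
Proof. intros H. apply (ex_derive_continuous (V := R_NormedModule)). now exists a. Qed.

Lemma cont_2d_slice_l f x t :
  continuity_2d_pt f x t -> continuous (fun y : R => f y t) x.
Proof.
  intros H. apply filterlim_locally. intros e. destruct (H e) as [d Hd].
  exists d. intros y Hy. apply (Hd y t); [exact Hy|].
  rewrite Rminus_diag, Rabs_R0. apply d.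
Qed.

Lemma cont_2d_slice_r f x t :
  continuity_2d_pt f x t -> continuous (fun s : R => f x s) t.
Proof.
  intros H. apply filterlim_locally. intros e. destruct (H e) as [d Hd].
  exists d. intros y Hy. apply (Hd x y); [|exact Hy].
  rewrite Rminus_diag, Rabs_R0. apply d.
Qed.

Lemma cont_2d_swap f x t :
  continuity_2d_pt f x t -> continuity_2d_pt (fun s y => f y s) t x.
Proof.
  intros H e. destruct (H e) as [d Hd]. exists d. intros u v Hu Hv. now apply Hd.
Qed.

Lemma cont_2d_comp f X Y x t :
  continuity_2d_pt f (X x t) (Y x t) ->
  continuity_2d_pt X x t -> continuity_2d_pt Y x t ->
  continuity_2d_pt (fun y s => f (X y s) (Y y s)) x t.
Proof.
  intros Hf HX HY e. destruct (Hf e) as [d Hd].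
  destruct (HX d) as [d1 H1], (HY d) as [d2 H2].
  assert (Hm : 0 < Rmin d1 d2) by (apply Rmin_pos; [apply d1 | apply d2]).
  exists (mkposreal _ Hm); simpl. intros u v Hu Hv.
  pose proof (Rmin_l d1 d2). pose proof (Rmin_r d1 d2).
  apply Hd; [apply H1 | apply H2]; lra.
Qed.

Lemma cont_1d_2d_fst (f : R -> R) x t :
  continuous f x -> continuity_2d_pt (fun y _ => f y) x t.
Proof.
  intros H e. destruct (proj1 (filterlim_locally f (f x)) H e) as [d Hd].
  exists d. intros u v Hu _. apply (Hd u Hu).
Qed.

Lemma cont_1d_2d_snd (f : R -> R) x t :
  continuous f t -> continuity_2d_pt (fun _ s => f s) x t.
Proof.
  intros H e. destruct (proj1 (filterlim_locally f (f t)) H e) as [d Hd].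
  exists d. intros u v _ Hv. apply (Hd v Hv).
Qed.

(** * Smooth functions on a strip *)
(** The strip is R x P.  The partial derivatives are existentially quantified,
    so that sums, products and compositions can be treated by exhibiting the
    usual formulas; [strip_Cn_ex_diff_n] passes back to [Derive]. *)
Fixpoint strip_Cn (P : R -> Prop) (n : nat) (f : R -> R -> R) : Prop :=
  (forall x t, P t -> continuity_2d_pt f x t) /\
  match n with
  | O => True
  | S m => exists fx ft : R -> R -> R,
      (forall x t, P t -> is_derive (fun y => f y t) x (fx x t) /\
                          is_derive (fun s => f x s) t (ft x t)) /\
      strip_Cn P m fx /\ strip_Cn P m ft
  end.

Lemma strip_Cn_continuity P n f :
  strip_Cn P n f -> forall x t, P t -> continuity_2d_pt f x t.
Proof. destruct n; simpl; tauto. Qed.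

Lemma strip_Cn_pred P n f : strip_Cn P (S n) f -> strip_Cn P n f.
Proof.
  revert f; induction n as [|n IH]; intros f [Hc (fx & ft & Hd & Hx & Ht)].
  - split; [exact Hc | exact I].
  - split; [exact Hc|]. exists fx, ft. auto.
Qed.

Lemma open_locally_2d (P : R -> Prop) x t :
  open P -> P t -> locally_2d (fun _ s => P s) x t.
Proof.
  intros HP Ht. destruct (HP t Ht) as [d Hd]. exists d.
  intros u v _ Hv. apply Hd. exact Hv.
Qed.

Lemma strip_Cn_ext P n f g : open P ->
  (forall x t, P t -> f x t = g x t) -> strip_Cn P n f -> strip_Cn P n g.
Proof.
  intros HP Hfg Hf.
  assert (Hc : forall x t, P t -> continuity_2d_pt g x t).
  { intros x t Ht. apply (continuity_2d_pt_ext_loc f).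
    - destruct (open_locally_2d P x t HP Ht) as [d Hd].
      exists d; intros u v Hu Hv; apply Hfg; exact (Hd u v Hu Hv).
    - exact (strip_Cn_continuity P n f Hf x t Ht). }
  destruct n as [|n]; [split; [exact Hc | exact I]|].
  destruct Hf as [_ (fx & ft & Hd & Hx & Ht)].
  split; [exact Hc|]. exists fx, ft. split; [|auto].
  intros x t Pt. destruct (Hd x t Pt) as [D1 D2]. split.
  - apply (is_derive_ext (fun y => f y t)); [intros; now apply Hfg | exact D1].
  - apply (is_derive_ext_loc (fun s => f x s)); [|exact D2].
    destruct (HP t Pt) as [d Hd']. exists d; intros; apply Hfg; auto.
Qed.

(** [Derive] depends on the values near a point, so the derivatives provided
    by [strip_Cn] must agree with it on a neighbourhood: hence the openness. *)
Lemma strip_Cn_ex_diff_n P n f x t : open P -> P t ->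
  strip_Cn P n f -> ex_diff_n f n x t.
Proof.
  intros HP. revert f x t; induction n as [|n IH]; intros f x t Ht Hf.
  - split; [apply (strip_Cn_continuity P 0 f Hf x t Ht) | exact I].
  - destruct Hf as [Hc (fx & ft & Hd & Hx & Hft)].
    split; [now apply Hc|].
    split; [eexists; apply (Hd x t Ht)|]. split; [eexists; apply (Hd x t Ht)|].
    destruct (open_locally_2d P x t HP Ht) as [d Hd'].
    split.
    + apply (ex_diff_n_ext_loc fx); [|now apply IH].
      exists d; intros u v Hu Hv. symmetry.
      apply is_derive_unique, (Hd u v (Hd' u v Hu Hv)).
    + apply (ex_diff_n_ext_loc ft); [|now apply IH].
      exists d; intros u v Hu Hv. symmetry.
      apply is_derive_unique, (Hd u v (Hd' u v Hu Hv)).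
Qed.

Lemma strip_Cn_const P n c : strip_Cn P n (fun _ _ => c).
Proof.
  revert c; induction n as [|n IH]; intros c; split; auto;
    try (intros; apply continuity_2d_pt_const).
  exists (fun _ _ => 0), (fun _ _ => 0). split; [|auto].
  intros; split; apply der_const.
Qed.

Lemma strip_Cn_fst P n : strip_Cn P n (fun x _ => x).
Proof.
  destruct n as [|n]; split; auto; try (intros; apply continuity_2d_pt_id1).
  exists (fun _ _ => 1), (fun _ _ => 0). split; [|split; apply strip_Cn_const].
  intros x t _; split; [apply der_id | apply der_const].
Qed.

Lemma strip_Cn_snd P n : strip_Cn P n (fun _ t => t).
Proof.
  destruct n as [|n]; split; auto; try (intros; apply continuity_2d_pt_id2).
  exists (fun _ _ => 0), (fun _ _ => 1). split; [|split; apply strip_Cn_const].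
  intros x t _; split; [apply der_const | apply der_id].
Qed.

Lemma strip_Cn_plus P n f g : strip_Cn P n f -> strip_Cn P n g ->
  strip_Cn P n (fun x t => f x t + g x t).
Proof.
  revert f g; induction n as [|n IH]; intros f g Hf Hg; split.
  1,3: intros x t Pt; apply continuity_2d_pt_plus;
       eapply strip_Cn_continuity; eauto.
  - exact I.
  - destruct Hf as [_ (fx & ft & Hd & Hx & Ht)].
    destruct Hg as [_ (gx & gt & Hd' & Hx' & Ht')].
    exists (fun x t => fx x t + gx x t), (fun x t => ft x t + gt x t).
    split; [|split; apply IH; auto].
    intros x t Pt. destruct (Hd x t Pt), (Hd' x t Pt).
    split; apply der_plus; auto.
Qed.

Lemma strip_Cn_mult P n f g : strip_Cn P n f -> strip_Cn P n g ->
  strip_Cn P n (fun x t => f x t * g x t).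
Proof.
  revert f g; induction n as [|n IH]; intros f g Hf Hg; split.
  1,3: intros x t Pt; apply continuity_2d_pt_mult;
       eapply strip_Cn_continuity; eauto.
  - exact I.
  - pose proof (strip_Cn_pred _ _ _ Hf) as Hf'.
    pose proof (strip_Cn_pred _ _ _ Hg) as Hg'.
    destruct Hf as [_ (fx & ft & Hd & Hx & Ht)].
    destruct Hg as [_ (gx & gt & Hd' & Hx' & Ht')].
    exists (fun x t => fx x t * g x t + f x t * gx x t),
           (fun x t => ft x t * g x t + f x t * gt x t).
    split; [|split; apply strip_Cn_plus; apply IH; auto].
    intros x t Pt. destruct (Hd x t Pt) as [D1 D2], (Hd' x t Pt) as [D3 D4].
    split; [exact (der_mult (fun y => f y t) (fun y => g y t) x _ _ D1 D3)
           |exact (der_mult (f x) (g x) t _ _ D2 D4)].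
Qed.

Lemma strip_Cn_opp P n f : strip_Cn P n f -> strip_Cn P n (fun x t => - f x t).
Proof.
  revert f; induction n as [|n IH]; intros f Hf; split.
  1,3: intros x t Pt; apply continuity_2d_pt_opp; eapply strip_Cn_continuity; eauto.
  - exact I.
  - destruct Hf as [_ (fx & ft & Hd & Hx & Ht)].
    exists (fun x t => - fx x t), (fun x t => - ft x t).
    split; [|split; apply IH; auto].
    intros x t Pt. destruct (Hd x t Pt). split; now apply der_opp.
Qed.

(** Continuity of one of the two partial derivatives already gives the total
    differentiability that the chain rule asks for. *)
Lemma strip_C1_differentiable (P : R -> Prop) (f fx ft : R -> R -> R) x t :
  open P -> P t ->
  (forall x t, P t -> is_derive (fun y => f y t) x (fx x t) /\
                      is_derive (fun s => f x s) t (ft x t)) ->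
  continuity_2d_pt fx x t ->
  differentiable_pt_lim f x t (fx x t) (ft x t).
Proof.
  intros HP Pt Hd Hc. apply filterdiff_differentiable_pt_lim.
  apply (is_derive_filterdiff f x t fx (ft x t)).
  - destruct (HP t Pt) as [d Hd']. exists d. intros [u v] [_ Hv].
    apply (Hd u v), Hd', Hv.
  - apply (Hd x t Pt).
  - apply (continuity_2d_pt_filterlim fx x t), Hc.
Qed.

Lemma der_comp_2d f (lx lt : R) (X Y : R -> R) (s X' Y' : R) :
  differentiable_pt_lim f (X s) (Y s) lx lt ->
  is_derive X s X' -> is_derive Y s Y' ->
  is_derive (fun r => f (X r) (Y r)) s (lx * X' + lt * Y').
Proof.
  intros Hf HX HY. apply is_derive_Reals.
  apply derivable_pt_lim_comp_2d; auto; now apply is_derive_Reals.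
Qed.

(** The derivatives of a composite are sums of products of composites of the
    same kind, which closes the induction on the order. *)
Lemma strip_Cn_comp (P Q : R -> Prop) n f X Y : open Q ->
  (forall x t, P t -> Q (Y x t)) ->
  strip_Cn Q n f -> strip_Cn P n X -> strip_Cn P n Y ->
  strip_Cn P n (fun x t => f (X x t) (Y x t)).
Proof.
  intros HQ HPQ. revert f X Y HPQ; induction n as [|n IH]; intros f X Y HPQ Hf HX HY; split.
  1,3: intros x t Pt; apply cont_2d_comp; eapply strip_Cn_continuity; eauto.
  - exact I.
  - pose proof (strip_Cn_pred _ _ _ HX) as HX0.
    pose proof (strip_Cn_pred _ _ _ HY) as HY0.
    destruct Hf as [_ (fx & ft & Hd & Hx & Ht)].
    destruct HX as [_ (Xx & Xt & HXd & HXx & HXt)].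
    destruct HY as [_ (Yx & Yt & HYd & HYx & HYt)].
    exists (fun x t => fx (X x t) (Y x t) * Xx x t + ft (X x t) (Y x t) * Yx x t),
           (fun x t => fx (X x t) (Y x t) * Xt x t + ft (X x t) (Y x t) * Yt x t).
    split.
    + intros x t Pt. destruct (HXd x t Pt), (HYd x t Pt).
      assert (differentiable_pt_lim f (X x t) (Y x t)
                (fx (X x t) (Y x t)) (ft (X x t) (Y x t))).
      { apply (strip_C1_differentiable Q); auto.
        apply (strip_Cn_continuity Q n); auto. }
      split.
      * apply (der_comp_2d f _ _ (fun y => X y t) (fun y => Y y t)); auto.
      * apply (der_comp_2d f _ _ (fun s => X x s) (fun s => Y x s)); auto.
    + split; apply strip_Cn_plus; apply strip_Cn_mult; auto.
Qed.

Definition strip_smooth (P : R -> Prop) (f : R -> R -> R) : Prop :=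
  forall n, strip_Cn P n f.

Lemma smooth_ext P f g : open P ->
  (forall x t, P t -> f x t = g x t) -> strip_smooth P f -> strip_smooth P g.
Proof. intros HP H Hf n. now apply (strip_Cn_ext P n f). Qed.

Lemma smooth_const P c : strip_smooth P (fun _ _ => c).
Proof. intros n; apply strip_Cn_const. Qed.
Lemma smooth_fst P : strip_smooth P (fun x _ => x).
Proof. intros n; apply strip_Cn_fst. Qed.
Lemma smooth_snd P : strip_smooth P (fun _ t => t).
Proof. intros n; apply strip_Cn_snd. Qed.
Lemma smooth_plus P f g : strip_smooth P f -> strip_smooth P g ->
  strip_smooth P (fun x t => f x t + g x t).
Proof. intros Hf Hg n; apply strip_Cn_plus; auto. Qed.
Lemma smooth_mult P f g : strip_smooth P f -> strip_smooth P g ->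
  strip_smooth P (fun x t => f x t * g x t).
Proof. intros Hf Hg n; apply strip_Cn_mult; auto. Qed.
Lemma smooth_opp P f : strip_smooth P f -> strip_smooth P (fun x t => - f x t).
Proof. intros Hf n; apply strip_Cn_opp; auto. Qed.
Lemma smooth_minus P f g : strip_smooth P f -> strip_smooth P g ->
  strip_smooth P (fun x t => f x t - g x t).
Proof. intros Hf Hg. apply smooth_plus; auto using smooth_opp. Qed.
Lemma smooth_pow P f k : strip_smooth P f -> strip_smooth P (fun x t => f x t ^ k).
Proof.
  intros Hf; induction k as [|k IH]; simpl; [apply smooth_const|].
  now apply smooth_mult.
Qed.
Lemma smooth_comp (P Q : R -> Prop) f X Y : open Q ->
  (forall x t, P t -> Q (Y x t)) ->
  strip_smooth Q f -> strip_smooth P X -> strip_smooth P Y ->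
  strip_smooth P (fun x t => f (X x t) (Y x t)).
Proof. intros HQ HPQ Hf HX HY n. now apply (strip_Cn_comp P Q). Qed.

Lemma smooth_partials P f : open P -> strip_smooth P f ->
  (forall x t, P t -> is_derive (fun y => f y t) x (dx f x t) /\
                      is_derive (fun s => f x s) t (dt f x t)) /\
  strip_smooth P (dx f) /\ strip_smooth P (dt f).
Proof.
  intros HP Hf. split; [|split; intros n;
    destruct (Hf (S n)) as [_ (fx & ft & Hd & Hx & Ht)]].
  - intros x t Pt. destruct (Hf 1%nat) as [_ (fx & ft & Hd & _)].
    destruct (Hd x t Pt). split; apply Derive_correct; eexists; eassumption.
  - apply (strip_Cn_ext P n fx); auto. intros x t Pt. symmetry.
    apply is_derive_unique, (Hd x t Pt).
  - apply (strip_Cn_ext P n ft); auto. intros x t Pt. symmetry.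
    apply is_derive_unique, (Hd x t Pt).
Qed.

Lemma smooth_der_x P f (x t : R) : open P -> strip_smooth P f -> P t ->
  is_derive (fun y => f y t) x (dx f x t).
Proof. intros HP Hf Pt. exact (proj1 (proj1 (smooth_partials P f HP Hf) x t Pt)). Qed.

Lemma smooth_der_t P f (x t : R) : open P -> strip_smooth P f -> P t ->
  is_derive (fun s => f x s) t (dt f x t).
Proof. intros HP Hf Pt. exact (proj2 (proj1 (smooth_partials P f HP Hf) x t Pt)). Qed.

Lemma smooth_dx_of P f : open P -> strip_smooth P f -> strip_smooth P (dx f).
Proof. intros HP Hf. exact (proj1 (proj2 (smooth_partials P f HP Hf))). Qed.

Lemma smooth_dt_of P f : open P -> strip_smooth P f -> strip_smooth P (dt f).
Proof. intros HP Hf. exact (proj2 (proj2 (smooth_partials P f HP Hf))). Qed.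

Lemma smooth_continuity P f x t : strip_smooth P f -> P t -> continuity_2d_pt f x t.
Proof. intros Hf. exact (strip_Cn_continuity P 0 f (Hf 0%nat) x t). Qed.

Lemma smooth_differentiable P f x t : open P -> strip_smooth P f -> P t ->
  differentiable_pt_lim f x t (dx f x t) (dt f x t).
Proof.
  intros HP Hf Pt. destruct (smooth_partials P f HP Hf) as (Hd & Hx & Ht).
  apply (strip_C1_differentiable P); auto. now apply (smooth_continuity P).
Qed.

Lemma smooth_on_strip_of P T f : open P -> (forall t, 0 <= t < T -> P t) ->
  strip_smooth P f -> smooth_on_strip T f.
Proof.
  intros HP HT Hf x t Hx Ht.
  destruct (open_locally_2d P x t HP (HT t Ht)) as [d Hd].
  exists d. intros u v Hu Hv n. apply (strip_Cn_ex_diff_n P); auto.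
  exact (Hd u v Hu Hv).
Qed.

(** Real powers, and the pair sin, cos, are families stable under
    differentiation up to constant factors; [s] gives the index of the
    derivative and [c] the factor. *)
Lemma smooth_family (I : Type) (P : R -> Prop) (phi : I -> R -> R) (c : I -> R) (s : I -> I) :
  open P ->
  (forall i t, P t -> is_derive (phi i) t (c i * phi (s i) t)) ->
  forall i, strip_smooth P (fun _ t => phi i t).
Proof.
  intros HP Hd i n. revert i. induction n as [|n IH]; intros i; split.
  1,3: intros x t Pt; apply cont_1d_2d_snd, (der_continuous _ _ _ (Hd i t Pt)).
  - exact Logic.I.
  - exists (fun _ _ => 0), (fun _ t => c i * phi (s i) t). split.
    + intros x t Pt. split; [apply der_const | now apply Hd].
    + split; [apply strip_Cn_const|].
      apply strip_Cn_mult; [apply strip_Cn_const | apply IH].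
Qed.

Lemma open_all : open (fun _ : R => True).
Proof. apply open_true. Qed.

Lemma smooth_Rpower P f (m : R) : (forall x t, P t -> 0 < f x t) ->
  strip_smooth P f -> strip_smooth P (fun x t => Rpower (f x t) m).
Proof.
  intros Hpos Hf.
  apply (smooth_comp P (fun y => 0 < y) (fun _ y => Rpower y m) (fun x _ => x) f); auto.
  - apply open_gt.
  - apply (smooth_family R (fun y => 0 < y) (fun m y => Rpower y m)
             (fun m => m) (fun m => m - 1)); [apply open_gt|].
    intros i t Ht. apply is_derive_Reals. now apply derivable_pt_lim_power.
  - apply smooth_fst.
Qed.

Lemma smooth_inv P f : open P -> (forall x t, P t -> 0 < f x t) ->
  strip_smooth P f -> strip_smooth P (fun x t => / f x t).
Proof.
  intros HP Hpos Hf. apply (smooth_ext P (fun x t => Rpower (f x t) (- (1)))); auto.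
  - intros x t Pt. rewrite Rpower_Ropp, Rpower_1; auto.
  - now apply smooth_Rpower.
Qed.

Lemma smooth_div P f g : open P -> (forall x t, P t -> 0 < g x t) ->
  strip_smooth P f -> strip_smooth P g -> strip_smooth P (fun x t => f x t / g x t).
Proof. intros HP Hpos Hf Hg. apply smooth_mult; auto using smooth_inv. Qed.

Lemma smooth_sin_cos P f : strip_smooth P f ->
  strip_smooth P (fun x t => sin (f x t)) /\ strip_smooth P (fun x t => cos (f x t)).
Proof.
  intros Hf.
  assert (H : forall b : bool, strip_smooth (fun _ => True)
                (fun _ t => if b then sin t else cos t)).
  { apply (smooth_family bool (fun _ => True) (fun (b : bool) t => if b then sin t else cos t)
             (fun b : bool => if b then 1 else -1) negb open_all).
    intros [|] t _; simpl.
    - apply is_derive_Reals. rewrite Rmult_1_l. apply derivable_pt_lim_sin.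
    - apply is_derive_Reals.
      replace (-1 * sin t) with (- sin t) by ring. apply derivable_pt_lim_cos. }
  split.
  - apply (smooth_comp P (fun _ => True) (fun _ y => sin y) (fun x _ => x) f); auto.
    + apply open_all.
    + apply (H true).
    + apply smooth_fst.
  - apply (smooth_comp P (fun _ => True) (fun _ y => cos y) (fun x _ => x) f); auto.
    + apply open_all.
    + apply (H false).
    + apply smooth_fst.
Qed.

(** * Integrals, with and without a parameter *)
Lemma ri_cont (f : R -> R) a b : a <= b ->
  (forall x, a <= x <= b -> continuous f x) -> ex_RInt f a b.
Proof.
  intros Hab H. apply (ex_RInt_continuous (V := R_CompleteNormedModule)).
  rewrite Rmin_left, Rmax_right; auto.
Qed.

Lemma ri_cont_all (f : R -> R) a b : (forall x, continuous f x) -> ex_RInt f a b.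
Proof. intros H. apply (ex_RInt_continuous (V := R_CompleteNormedModule)). auto. Qed.

Lemma ri_ext (f g : R -> R) a b : a <= b ->
  (forall x, a < x < b -> f x = g x) -> RInt f a b = RInt g a b.
Proof. intros Hab H. apply RInt_ext. now rewrite Rmin_left, Rmax_right. Qed.

Lemma ri_ext_all (f g : R -> R) a b :
  (forall x, f x = g x) -> @eq R (RInt f a b) (RInt g a b).
Proof. intros H. apply RInt_ext. auto. Qed.

Lemma ri_plus (f g : R -> R) a b : ex_RInt f a b -> ex_RInt g a b ->
  RInt (fun x => f x + g x) a b = RInt f a b + RInt g a b.
Proof. apply (RInt_plus (V := R_CompleteNormedModule)). Qed.

Lemma ri_minus (f g : R -> R) a b : ex_RInt f a b -> ex_RInt g a b ->
  RInt (fun x => f x - g x) a b = RInt f a b - RInt g a b.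
Proof. apply (RInt_minus (V := R_CompleteNormedModule)). Qed.

Lemma ri_scal (c : R) (f : R -> R) a b : ex_RInt f a b ->
  RInt (fun x => c * f x) a b = c * RInt f a b.
Proof. apply (RInt_scal (V := R_CompleteNormedModule)). Qed.

Lemma ri_const (c a b : R) : RInt (fun _ => c) a b = c * (b - a).
Proof. rewrite RInt_const. unfold scal; simpl; unfold mult; simpl. ring. Qed.

Lemma ri_chasles (f : R -> R) a b c : ex_RInt f a b -> ex_RInt f b c ->
  RInt f a b + RInt f b c = RInt f a c.
Proof. apply (RInt_Chasles (V := R_CompleteNormedModule)). Qed.

Lemma ri_sub (f : R -> R) a b c d : a <= b -> b <= c -> c <= d ->
  ex_RInt f a d -> (forall x, a <= x <= d -> 0 <= f x) ->
  RInt f b c <= RInt f a d.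
Proof.
  intros Hab Hbc Hcd Hf Hpos.
  assert (H1 : ex_RInt f a c) by (apply (ex_RInt_Chasles_1 (V := R_CompleteNormedModule) f a c d); [lra | exact Hf]).
  assert (H2 : ex_RInt f c d) by (apply (ex_RInt_Chasles_2 (V := R_CompleteNormedModule) f a c d); [lra | exact Hf]).
  assert (H3 : ex_RInt f a b) by (apply (ex_RInt_Chasles_1 (V := R_CompleteNormedModule) f a b c); [lra | exact H1]).
  assert (H4 : ex_RInt f b c) by (apply (ex_RInt_Chasles_2 (V := R_CompleteNormedModule) f a b c); [lra | exact H1]).
  rewrite <- (ri_chasles f a c d), <- (ri_chasles f a b c); auto.
  assert (0 <= RInt f a b) by (apply RInt_ge_0; auto; intros; apply Hpos; lra).
  assert (0 <= RInt f c d) by (apply RInt_ge_0; auto; intros; apply Hpos; lra).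
  lra.
Qed.

Lemma ri_derive (f df : R -> R) a b : a <= b ->
  (forall x, a <= x <= b -> is_derive f x (df x)) ->
  (forall x, a <= x <= b -> continuous df x) ->
  RInt df a b = f b - f a.
Proof.
  intros Hab Hd Hc. apply is_RInt_unique.
  apply (is_RInt_derive (V := R_CompleteNormedModule)); rewrite Rmin_left, Rmax_right; auto.
Qed.

Lemma ri_primitive (f : R -> R) (a x : R) :
  (forall y, continuous f y) -> is_derive (fun y => RInt f a y) x (f x).
Proof.
  intros Hc. apply (is_derive_RInt (V := R_NormedModule) f (fun y => RInt f a y) a x); auto.
  exists (mkposreal 1 Rlt_0_1). intros y _.
  apply (RInt_correct (V := R_CompleteNormedModule)). now apply ri_cont_all.
Qed.

(** Compactness of [a, b] gives one width of neighbourhood for all x. *)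
Lemma tube (P : R -> R -> Prop) a b t0 :
  (forall x, a <= x <= b -> locally_2d P x t0) ->
  locally t0 (fun s => forall x, a <= x <= b -> P x s).
Proof.
  intros H.
  assert (C : forall x, {d : posreal | a <= x <= b ->
     forall u v, Rabs (u - x) < d -> Rabs (v - t0) < d -> P u v}).
  { intros x. apply constructive_indefinite_description.
    destruct (excluded_middle_informative (a <= x <= b)) as [Hx|Hx].
    - destruct (H x Hx) as [d Hd]. exists d. auto.
    - exists (mkposreal 1 Rlt_0_1). tauto. }
  destruct (compactness_value_1d a b (fun x => proj1_sig (C x))) as [d Hd].
  exists d. intros s Hs x Hx. apply NNPP. intros N. apply (Hd x Hx).
  intros (t & Ht & Hxt & Hdt). apply N.
  destruct (C t) as [dt0 HC]; simpl in *. apply HC; auto.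
  apply Rlt_le_trans with d; auto.
Qed.

(** The gauge given to the compactness lemma is at most 1 / (|f| + 1) at its
    centre, so the uniform lower bound e for the gauges is also a uniform
    upper bound 1 / e for |f|. *)
Lemma bounded_on_rectangle (f : R -> R -> R) a b c d :
  (forall x t, a <= x <= b -> c <= t <= d -> continuity_2d_pt f x t) ->
  exists M, 0 <= M /\ forall x t, a <= x <= b -> c <= t <= d -> Rabs (f x t) <= M.
Proof.
  intros H.
  assert (C : forall x t, {e : posreal | (a <= x <= b -> c <= t <= d ->
     forall u v, Rabs (u - x) < e -> Rabs (v - t) < e -> Rabs (f u v) < Rabs (f x t) + 1)
     /\ e * (Rabs (f x t) + 1) <= 1}).
  { intros x t. apply constructive_indefinite_description.
    assert (Hp : 0 < Rabs (f x t) + 1) by (pose proof (Rabs_pos (f x t)); lra).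
    assert (Hq : 0 < / (Rabs (f x t) + 1)) by now apply Rinv_0_lt_compat.
    destruct (excluded_middle_informative (a <= x <= b /\ c <= t <= d)) as [[Hx Ht]|Hx].
    - destruct (H x t Hx Ht (mkposreal 1 Rlt_0_1)) as [e He].
      assert (Hm : 0 < Rmin e (/ (Rabs (f x t) + 1))) by (apply Rmin_pos; [apply e | auto]).
      exists (mkposreal _ Hm); simpl. split.
      + intros _ _ u v Hu Hv.
        pose proof (Rmin_l e (/ (Rabs (f x t) + 1))).
        assert (K := He u v ltac:(lra) ltac:(lra)). simpl in K.
        pose proof (Rabs_triang (f u v - f x t) (f x t)).
        replace (f u v - f x t + f x t) with (f u v) in H1 by ring. lra.
      + apply Rle_trans with (/ (Rabs (f x t) + 1) * (Rabs (f x t) + 1)).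
        * apply Rmult_le_compat_r; [lra | apply Rmin_r].
        * rewrite Rinv_l; lra.
    - exists (mkposreal _ Hq); simpl. split; [tauto|]. rewrite Rinv_l; lra. }
  destruct (compactness_value_2d a b c d (fun x t => proj1_sig (C x t))) as [e He].
  exists (/ e). split; [left; apply Rinv_0_lt_compat, e|].
  intros x t Hx Ht. apply Rnot_lt_le. intros N. apply (He x t Hx Ht).
  intros (u & v & Hu & Hv & H1 & H2 & H3).
  destruct (C u v) as [e' [HC1 HC2]]; simpl in *.
  pose proof (HC1 Hu Hv x t H1 H2).
  assert (Rabs (f u v) + 1 <= / e).
  { apply Rmult_le_reg_l with e; [apply e|]. rewrite Rinv_r.
    - apply Rle_trans with (e' * (Rabs (f u v) + 1)); auto.
      apply Rmult_le_compat_r; auto. pose proof (Rabs_pos (f u v)); lra.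
    - pose proof (cond_pos e); lra. }
  lra.
Qed.

Lemma ri_param_continuous (f : R -> R -> R) a b t0 : a <= b ->
  (forall x, a <= x <= b -> continuity_2d_pt f x t0) ->
  locally t0 (fun t => ex_RInt (fun x => f x t) a b) ->
  continuous (fun t => RInt (fun x => f x t) a b) t0.
Proof.
  intros Hab Hc [d0 Hex]. apply filterlim_locally. intros eps.
  assert (He : 0 < eps / (b - a + 1)).
  { apply Rdiv_lt_0_compat; [apply eps | lra]. }
  destruct (uniform_continuity_2d_1d f a b t0 Hc (mkposreal _ He)) as [d Hd].
  assert (Hm : 0 < Rmin d d0) by (apply Rmin_pos; [apply d | apply d0]).
  exists (mkposreal _ Hm). intros t Ht.
  pose proof (Rmin_l d d0) as L1. pose proof (Rmin_r d d0) as L2.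
  assert (Ht' : Rabs (t - t0) < Rmin d d0) by exact Ht.
  assert (E0 : ex_RInt (fun x => f x t0) a b).
  { apply Hex. apply ball_center. }
  assert (E1 : ex_RInt (fun x => f x t) a b).
  { apply Hex. unfold ball; simpl; unfold AbsRing_ball; simpl.
    unfold abs, minus, plus, opp; simpl. apply Rlt_le_trans with (1 := Ht'). lra. }
  unfold ball; simpl; unfold AbsRing_ball; simpl; unfold abs, minus, plus, opp; simpl.
  change (Rabs (RInt (fun x => f x t) a b - RInt (fun x => f x t0) a b) < eps).
  rewrite <- ri_minus; auto.
  apply Rle_lt_trans with ((b - a) * (eps / (b - a + 1))).
  - apply abs_RInt_le_const; auto.
    + apply (ex_RInt_minus (V := R_NormedModule)); auto.
    + intros x Hx. left. simpl in Hd.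
      apply Rabs_def2 in Ht'; destruct Ht'. apply Hd; try lra.
      rewrite Rminus_diag, Rabs_R0. apply d.
  - apply Rlt_le_trans with ((b - a + 1) * (eps / (b - a + 1))).
    + apply Rmult_lt_compat_r; lra.
    + right. field. lra.
Qed.

(** The derivative in t is asked for in a full neighbourhood of each point,
    also for y slightly outside [a, b]: its joint continuity is two-sided at
    the endpoints. *)
Lemma ri_param_derive (f ft : R -> R -> R) a b t0 : a <= b ->
  (forall x, a <= x <= b ->
     locally_2d (fun y s => is_derive (fun r => f y r) s (ft y s)) x t0) ->
  (forall x, a <= x <= b -> continuity_2d_pt ft x t0) ->
  locally t0 (fun t => ex_RInt (fun x => f x t) a b) ->
  is_derive (fun t => RInt (fun x => f x t) a b) t0 (RInt (fun x => ft x t0) a b).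
Proof.
  intros Hab Hd Hc Hex.
  assert (E : RInt (fun x => Derive (fun s => f x s) t0) a b = RInt (fun x => ft x t0) a b).
  { apply ri_ext; auto. intros x Hx. apply is_derive_unique.
    exact (locally_2d_singleton _ _ _ (Hd x ltac:(lra))). }
  rewrite <- E.
  apply (is_derive_RInt_param (fun t x => f x t)).
  - rewrite Rmin_left, Rmax_right by auto.
    destruct (tube _ a b t0 Hd) as [d H]. exists d. intros s Hs x Hx.
    eexists. apply (H s Hs x Hx).
  - rewrite Rmin_left, Rmax_right by auto. intros x Hx.
    apply continuity_2d_pt_ext_loc with (fun s y => ft y s).
    + destruct (Hd x Hx) as [d H]. exists d. intros s y Hs Hy. symmetry.
      apply is_derive_unique, H; auto.
    + now apply cont_2d_swap, Hc.
  - exact Hex.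
Qed.

(** The increment is split into a change of t under the integral sign, small
    by uniform continuity, and a change of the endpoint of integration. *)
Lemma cont_2d_primitive (P : R -> Prop) f x t : open P -> P t ->
  (forall x t, P t -> continuity_2d_pt f x t) ->
  continuity_2d_pt (fun x t => RInt (fun y => f y t) 0 x) x t.
Proof.
  intros HP Pt Hc eps.
  assert (Hs : forall s, P s -> forall y, continuous (fun y : R => f y s) y).
  { intros s Ps y. apply cont_2d_slice_l, Hc, Ps. }
  set (M := Rabs x + 1).
  assert (HM : 0 < M) by (unfold M; pose proof (Rabs_pos x); lra).
  assert (He : 0 < eps / 2 / M).
  { apply Rdiv_lt_0_compat; auto. pose proof (cond_pos eps); lra. }
  destruct (uniform_continuity_2d_1d f (- M) M t (fun y _ => Hc y t Pt) (mkposreal _ He))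
    as [d Hd].
  destruct (HP t Pt) as [d0 Hd0].
  assert (He2 : 0 < eps / 2) by (pose proof (cond_pos eps); lra).
  destruct (proj1 (filterlim_locally _ _)
     (der_continuous _ _ _ (ri_primitive (fun y => f y t) 0 x (Hs t Pt))) (mkposreal _ He2))
    as [d1 Hd1].
  assert (Hm : 0 < Rmin (Rmin d d0) (Rmin d1 1)).
  { repeat apply Rmin_pos; try apply cond_pos. lra. }
  exists (mkposreal _ Hm). simpl. intros u v Hu Hv.
  pose proof (Rmin_l (Rmin d d0) (Rmin d1 1)) as L1.
  pose proof (Rmin_r (Rmin d d0) (Rmin d1 1)) as L2.
  pose proof (Rmin_l d d0) as L3. pose proof (Rmin_r d d0) as L4.
  pose proof (Rmin_l d1 1) as L5. pose proof (Rmin_r d1 1) as L6.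
  assert (Pv : P v) by (apply Hd0; unfold ball; simpl; apply Rlt_le_trans with (1 := Hv); lra).
  assert (Hd1' := Hd1 u (Rlt_le_trans _ _ (pos d1) Hu ltac:(lra))).
  unfold ball in Hd1'; simpl in Hd1'; unfold AbsRing_ball, abs, minus, plus, opp in Hd1'; simpl in Hd1'.
  assert (Huv : Rabs (RInt (fun y => f y v) 0 u - RInt (fun y => f y t) 0 u) <= eps / 2).
  { rewrite <- ri_minus by (apply ri_cont_all; auto).
    assert (B : forall y, - M <= y <= M -> Rabs (f y v - f y t) <= eps / 2 / M).
    { intros y Hy. left. apply Rabs_def2 in Hv; destruct Hv. apply Hd; try lra.
      - rewrite Rminus_diag, Rabs_R0. apply d. }
    assert (Hu' : - M < u < M).
    { apply Rabs_def2 in Hu; destruct Hu. unfold M.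
      pose proof (Rle_abs x) as X1. pose proof (Rle_abs (- x)) as X2. rewrite Rabs_Ropp in X2. lra. }
    assert (C : ex_RInt (fun y => f y v - f y t) 0 u).
    { apply (ex_RInt_minus (V := R_NormedModule)); apply ri_cont_all; auto. }
    replace (eps / 2) with (M * (eps / 2 / M)) by (field; lra).
    destruct (Rle_lt_dec 0 u) as [H0|H0].
    - apply Rle_trans with ((u - 0) * (eps / 2 / M)).
      + apply abs_RInt_le_const; auto. intros; apply B; lra.
      + apply Rmult_le_compat_r; lra.
    - rewrite <- opp_RInt_swap by (apply ex_RInt_swap, C).
      unfold opp; simpl. rewrite Rabs_Ropp.
      apply Rle_trans with ((0 - u) * (eps / 2 / M)).
      + apply abs_RInt_le_const; [lra | apply ex_RInt_swap, C |]. intros; apply B; lra.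
      + apply Rmult_le_compat_r; lra. }
  replace (RInt (fun y => f y v) 0 u - RInt (fun y => f y t) 0 x) with
    ((RInt (fun y => f y v) 0 u - RInt (fun y => f y t) 0 u) +
     (RInt (fun y => f y t) 0 u - RInt (fun y => f y t) 0 x)) by ring.
  apply Rle_lt_trans with (1 := Rabs_triang _ _).
  change (Rabs (RInt (fun y : R => f y t) 0 u - RInt (fun y : R => f y t) 0 x) < eps / 2) in Hd1'.
  lra.
Qed.

Lemma primitive_derive_t (P : R -> Prop) f ft x t : open P -> P t ->
  (forall x t, P t -> continuity_2d_pt f x t) ->
  (forall x t, P t -> is_derive (fun s => f x s) t (ft x t)) ->
  (forall x t, P t -> continuity_2d_pt ft x t) ->
  is_derive (fun t => RInt (fun y => f y t) 0 x) t (RInt (fun y => ft y t) 0 x).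
Proof.
  intros HP Pt Hc Hd Hct.
  assert (K : forall a b, a <= b ->
     is_derive (fun t => RInt (fun y => f y t) a b) t (RInt (fun y => ft y t) a b)).
  { intros a b Hab. apply ri_param_derive; auto.
    - intros y _. destruct (open_locally_2d P y t HP Pt) as [d H]. exists d.
      intros u v Hu Hv. apply Hd. exact (H u v Hu Hv).
    - destruct (HP t Pt) as [d H]. exists d. intros s Hs. apply ri_cont_all.
      intros y. apply cont_2d_slice_l, Hc, H, Hs. }
  destruct (Rle_lt_dec 0 x) as [H0|H0]; [now apply K|].
  apply is_derive_ext_loc with (fun t => - RInt (fun y => f y t) x 0).
  - destruct (HP t Pt) as [d H]. exists d. intros s Hs.
    apply (opp_RInt_swap (V := R_CompleteNormedModule)). apply ri_cont_all.
    intros y. apply cont_2d_slice_l, Hc, H, Hs.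
  - rewrite <- (opp_RInt_swap (V := R_CompleteNormedModule)).
    + apply der_opp, K. lra.
    + apply ri_cont_all. intros y. apply cont_2d_slice_l, Hct, Pt.
Qed.

Lemma smooth_primitive P f : open P -> strip_smooth P f ->
  strip_smooth P (fun x t => RInt (fun y => f y t) 0 x).
Proof.
  intros HP Hf n. revert f Hf. induction n as [|n IH]; intros f Hf; split.
  1,3: intros x t Pt; apply (cont_2d_primitive P); auto;
       intros; now apply (smooth_continuity P).
  - exact I.
  - destruct (smooth_partials P f HP Hf) as (Hd & Hx & Ht).
    exists f, (fun x t => RInt (fun y => dt f y t) 0 x). split.
    + intros x t Pt. split.
      * apply (ri_primitive (fun y => f y t)). intros y.
        now apply cont_2d_slice_l, (smooth_continuity P).
      * apply (primitive_derive_t P f (dt f)); auto.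
        -- intros; now apply (smooth_continuity P).
        -- intros; now apply Hd.
        -- intros; now apply (smooth_continuity P).
    + split; [apply Hf | now apply IH].
Qed.

(** * Implicit differentiation *)
Lemma der_eps (f : R -> R) (x l : R) :
  is_derive f x l <->
  forall eps : posreal, locally x (fun y => Rabs (f y - f x - l * (y - x)) <= eps * Rabs (y - x)).
Proof.
  split.
  - intros [_ H] eps.
    destruct (H x (fun P HP => HP) eps) as [d Hd].
    exists d. intros y Hy. specialize (Hd y Hy).
    unfold norm, minus, plus, opp, scal in Hd; simpl in Hd.
    unfold abs, mult in Hd; simpl in Hd.
    replace (f y - f x - l * (y - x)) with (f y + - f x + - ((y + - x) * l)) by ring.
    exact Hd.
  - intros H. split; [apply is_linear_scal_l|].
    intros z Hz eps. apply (is_filter_lim_locally_unique (K := R_AbsRing) (V := R_NormedModule)) in Hz. subst z.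
    destruct (H eps) as [d Hd].
    exists d. intros y Hy. specialize (Hd y Hy).
    unfold norm, minus, plus, opp, scal; simpl.
    unfold abs, mult; simpl.
    replace (f y - f x - l * (y - x)) with (f y + - f x + - ((y + - x) * l)) in Hd by ring.
    exact Hd.
Qed.

(** The linearization of g at (a s0, e s0) determines the increment of a up to
    an error that the factor ga absorbs.  With e constant this differentiates
    an inverse function; in general it differentiates, in either of its
    variables, the inverse of a map that depends on a parameter. *)
Lemma implicit_derive (g : R -> R -> R) (a e r : R -> R) (s0 ga ge e' r' : R) :
  differentiable_pt_lim g (a s0) (e s0) ga ge -> ga <> 0 ->
  continuous a s0 -> is_derive e s0 e' -> is_derive r s0 r' ->
  locally s0 (fun s => g (a s) (e s) = r s) ->
  is_derive a s0 ((r' - ge * e') / ga).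
Proof.
  intros Hg Hga Ha He Hr Hloc. set (l := (r' - ge * e') / ga).
  apply der_eps. intros eps.
  set (K := Rabs l + Rabs e' + 2 + Rabs ge).
  assert (HK : 0 < K).
  { unfold K. pose proof (Rabs_pos l); pose proof (Rabs_pos e'); pose proof (Rabs_pos ge). lra. }
  assert (Hg0 : 0 < Rabs ga) by now apply Rabs_pos_lt.
  set (e1 := Rmin 1 (Rmin (Rabs ga / 2) (eps * (Rabs ga / (2 * K))))).
  assert (Hgk : 0 < Rabs ga / (2 * K)) by (apply Rdiv_lt_0_compat; lra).
  assert (He1 : 0 < e1).
  { unfold e1. repeat apply Rmin_pos; try lra. apply Rmult_lt_0_compat; [apply eps | exact Hgk]. }
  assert (B1 : e1 <= 1) by apply Rmin_l.
  assert (B2 : e1 <= Rabs ga / 2) by (eapply Rle_trans; [apply Rmin_r | apply Rmin_l]).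
  assert (B3 : e1 <= eps * (Rabs ga / (2 * K))) by (eapply Rle_trans; [apply Rmin_r | apply Rmin_r]).
  destruct (Hg (mkposreal _ He1)) as [d Hd].
  pose proof (proj1 (filterlim_locally _ _) Ha d) as Ha'.
  pose proof (proj1 (filterlim_locally _ _) (der_continuous _ _ _ He) d) as Hec.
  pose proof (proj1 (der_eps _ _ _) He (mkposreal _ He1)) as He'.
  pose proof (proj1 (der_eps _ _ _) Hr (mkposreal _ He1)) as Hr'.
  assert (Hs0 := locally_singleton _ _ Hloc). simpl in Hs0.
  generalize (filter_and _ _ Hloc (filter_and _ _ Ha' (filter_and _ _ Hec (filter_and _ _ He' Hr')))).
  apply filter_imp. intros s (E1 & E2 & E3 & E4 & E5).
  specialize (Hd (a s) (e s) E2 E3). simpl in Hd, E4, E5.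
  rewrite E1, Hs0 in Hd.
  set (A := a s - a s0) in *. set (E := e s - e s0) in *. set (Rr := r s - r s0) in *.
  set (w := s - s0) in *.
  assert (Hmax : Rmax (Rabs A) (Rabs E) <= Rabs A + Rabs E).
  { pose proof (Rabs_pos A); pose proof (Rabs_pos E). apply Rmax_lub; lra. }
  assert (D : Rabs (ga * (A - l * w)) <=
     e1 * (Rabs A + Rabs E) + e1 * Rabs w + Rabs ge * (e1 * Rabs w)).
  { replace (ga * (A - l * w)) with
      (- (Rr - (ga * A + ge * E)) + (Rr - r' * w) + - (ge * (E - e' * w)))
      by (unfold l; field; auto).
    eapply Rle_trans; [apply Rabs_triang|]. apply Rplus_le_compat.
    - eapply Rle_trans; [apply Rabs_triang|]. apply Rplus_le_compat; [|exact E5].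
      rewrite Rabs_Ropp. eapply Rle_trans; [exact Hd|]. apply Rmult_le_compat_l; lra.
    - rewrite Rabs_Ropp, Rabs_mult. apply Rmult_le_compat_l; [apply Rabs_pos | exact E4]. }
  rewrite Rabs_mult in D.
  assert (HA : Rabs A <= Rabs (A - l * w) + Rabs l * Rabs w).
  { rewrite <- Rabs_mult. replace A with ((A - l * w) + l * w) at 1 by ring. apply Rabs_triang. }
  assert (HE : Rabs E <= (e1 + Rabs e') * Rabs w).
  { replace E with ((E - e' * w) + e' * w) by ring.
    eapply Rle_trans; [apply Rabs_triang|]. rewrite Rabs_mult. lra. }
  set (Z := Rabs (A - l * w)) in *.
  assert (HZ : 0 <= Z) by apply Rabs_pos.
  assert (Hw : 0 <= Rabs w) by apply Rabs_pos.
  assert (D2 : Rabs ga * Z <= e1 * Z + e1 * (K * Rabs w)).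
  { assert (e1 * (Rabs A + Rabs E) <= e1 * (Z + Rabs l * Rabs w + (1 + Rabs e') * Rabs w)).
    { apply Rmult_le_compat_l; [lra|].
      assert ((e1 + Rabs e') * Rabs w <= (1 + Rabs e') * Rabs w) by (apply Rmult_le_compat_r; lra).
      lra. }
    unfold K. lra. }
  assert (D3 : e1 * Z <= Rabs ga / 2 * Z) by (apply Rmult_le_compat_r; lra).
  assert (D4 : e1 * (K * Rabs w) <= eps * (Rabs ga / (2 * K)) * (K * Rabs w)).
  { apply Rmult_le_compat_r; auto. apply Rmult_le_pos; lra. }
  replace (eps * (Rabs ga / (2 * K)) * (K * Rabs w)) with (Rabs ga / 2 * (eps * Rabs w)) in D4
    by (field; lra).
  apply Rmult_le_reg_l with (Rabs ga / 2); lra.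
Qed.

(** * Powers, periodic integrands and monotone functions *)
Lemma der_Rpower (y a : R) : 0 < y -> is_derive (fun y => Rpower y a) y (a * Rpower y (a - 1)).
Proof. intros Hy. apply is_derive_Reals. now apply derivable_pt_lim_power. Qed.

Lemma Rpower_minus_1 y a : 0 < y -> Rpower y (a - 1) = Rpower y a / y.
Proof.
  intros Hy. unfold Rminus. rewrite Rpower_plus, Rpower_Ropp, Rpower_1; auto.
Qed.

Lemma der_inv (f : R -> R) (x a : R) : f x <> 0 -> is_derive f x a ->
  is_derive (fun y => / f y) x (- a / f x ^ 2).
Proof. intros H0 H. now apply is_derive_inv. Qed.

Lemma der_sq (f : R -> R) (x a : R) :
  is_derive f x a -> is_derive (fun y => f y ^ 2) x (2 * f x * a).
Proof.
  intros H. apply (der_eq _ _ (f x * a + a * f x)).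
  - apply is_derive_ext with (fun y => f y * f y); [intros; simpl; ring|].
    rewrite Rplus_comm. now apply der_mult.
  - ring.
Qed.

Lemma primitive_per (f : R -> R) x : (forall y, continuous f y) ->
  (forall y, f (y + 1) = f y) -> RInt f 0 (x + 1) = RInt f 0 x + RInt f 0 1.
Proof.
  intros Hc Hp. rewrite <- (ri_chasles f 0 1 (x + 1)) by now apply ri_cont_all.
  rewrite Rplus_comm. f_equal.
  assert (E : RInt (fun y => scal 1 (f (1 * y + 1))) 0 x = RInt f (1 * 0 + 1) (1 * x + 1)).
  { apply (RInt_comp_lin (V := R_CompleteNormedModule) f 1 1 0 x). now apply ri_cont_all. }
  replace (1 * 0 + 1) with 1 in E by ring. replace (1 * x + 1) with (x + 1) in E by ring.
  rewrite <- E. apply RInt_ext. intros y _.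
  unfold scal; simpl; unfold mult; simpl. now rewrite !Rmult_1_l, Hp.
Qed.

Lemma periodic_ri (f : R -> R) s : (forall x, continuous f x) ->
  (forall x, f (x + 1) = f x) -> RInt (fun x => f (x - s)) 0 1 = RInt f 0 1 :> R.
Proof.
  intros Hc Hp.
  assert (E : RInt (fun y => scal 1 (f (1 * y + - s))) 0 1 = RInt f (1 * 0 + - s) (1 * 1 + - s)).
  { apply (RInt_comp_lin (V := R_CompleteNormedModule) f 1 (- s) 0 1). now apply ri_cont_all. }
  replace (1 * 0 + - s) with (- s) in E by ring.
  replace (1 * 1 + - s) with (- s + 1) in E by ring.
  transitivity (RInt f (- s) (- s + 1)).
  - rewrite <- E. apply RInt_ext. intros y _.
    unfold scal; simpl; unfold mult; simpl. rewrite !Rmult_1_l. reflexivity.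
  - pose proof (primitive_per f (- s) Hc Hp) as H.
    rewrite <- (ri_chasles f 0 (- s) (- s + 1)) in H by now apply ri_cont_all. lra.
Qed.

Lemma ri_primitive_on (f : R -> R) a b c x : a < c < b -> a < x < b ->
  (forall y, a < y < b -> continuous f y) -> is_derive (fun y => RInt f c y) x (f x).
Proof.
  intros Hc Hx Hf. apply (is_derive_RInt (V := R_NormedModule) f (fun y => RInt f c y) c x); auto.
  assert (Hm : 0 < Rmin (x - a) (b - x)) by (apply Rmin_pos; lra).
  exists (mkposreal _ Hm). intros y Hy.
  assert (Hy' : Rabs (y - x) < Rmin (x - a) (b - x)) by exact Hy.
  pose proof (Rmin_l (x - a) (b - x)). pose proof (Rmin_r (x - a) (b - x)).
  apply Rabs_def2 in Hy'. destruct Hy'.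
  apply (RInt_correct (V := R_CompleteNormedModule)).
  apply (ex_RInt_continuous (V := R_CompleteNormedModule)). intros z Hz. apply Hf.
  split.
  - apply Rlt_le_trans with (Rmin c y); [apply Rmin_glb_lt; lra | apply Hz].
  - apply Rle_lt_trans with (Rmax c y); [apply Hz | apply Rmax_lub_lt; lra].
Qed.

Lemma der_pos_incr (f df : R -> R) a b :
  (forall x, a < x < b -> is_derive f x (df x)) ->
  (forall x, a < x < b -> 0 < df x) ->
  forall x y, a < x -> x < y -> y < b -> f x < f y.
Proof.
  intros Hd Hp x y Hx Hxy Hy.
  destruct (MVT_gen f x y df) as [c [Hc E]].
  - rewrite Rmin_left, Rmax_right by lra. intros; apply Hd; lra.
  - rewrite Rmin_left, Rmax_right by lra. intros z Hz.
    apply continuity_pt_filterlim, (der_continuous _ _ (df z)), Hd. lra.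
  - rewrite Rmin_left, Rmax_right in Hc by lra.
    assert (0 < df c * (y - x)) by (apply Rmult_lt_0_compat; [apply Hp|]; lra). lra.
Qed.

Lemma ivt_on (f : R -> R) a b y : a <= b -> (forall x, a <= x <= b -> continuous f x) ->
  f a <= y <= f b -> exists x, a <= x <= b /\ f x = y.
Proof.
  intros Hab Hc Hy.
  destruct (Req_dec (f a) y) as [E|Na]; [exists a; split; [lra | exact E]|].
  destruct (Req_dec (f b) y) as [E|Nb]; [exists b; split; [lra | exact E]|].
  assert (Hlt : a < b) by (destruct Hab as [H | <-]; lra).
  destruct (Ranalysis5.IVT_interv (fun x => f x - y) a b) as [x [Hx E]]; try lra.
  - intros x Hx. apply continuity_pt_minus.
    + now apply continuity_pt_filterlim, Hc.
    + apply continuity_pt_const. now intros ? ?.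
  - exists x. split; [exact Hx | lra].
Qed.

(** * Real powers and integrals with a singularity *)
Lemma powR_0 p : powR 0 p = 0.
Proof. unfold powR. destruct (Req_EM_T 0 0); [reflexivity | lra]. Qed.

Lemma powR_pos a p : 0 < a -> powR a p = Rpower a p.
Proof. intros Ha. unfold powR. destruct (Req_EM_T a 0); [lra | reflexivity]. Qed.

Lemma powR_ge_0 a p : 0 <= powR a p.
Proof. unfold powR. destruct (Req_EM_T a 0); [lra | left; apply exp_pos]. Qed.

Lemma powR_le a b p : 0 <= p -> 0 <= a <= b -> powR a p <= powR b p.
Proof.
  intros Hp [[Ha|<-] Hab].
  - rewrite !powR_pos by lra. now apply Rle_Rpower_l.
  - rewrite powR_0. apply powR_ge_0.
Qed.

Lemma Rpower_pos a p : 0 < Rpower a p.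
Proof. apply exp_pos. Qed.

Lemma powR_inv a p : 0 <= a -> p <> 0 -> powR (powR a p) (/ p) = a.
Proof.
  intros [Ha|<-] Hp.
  - rewrite (powR_pos a) by auto. rewrite powR_pos by apply Rpower_pos.
    rewrite Rpower_mult, Rinv_r, Rpower_1; auto.
  - now rewrite !powR_0.
Qed.

Lemma powR_continuous p x : 0 < p -> continuous (fun y => powR (Rabs y) p) x.
Proof.
  intros Hp. destruct (Req_dec x 0) as [->|Hx].
  - apply filterlim_locally. intros eps.
    assert (Hd : 0 < Rpower eps (/ p)) by apply Rpower_pos.
    exists (mkposreal _ Hd). intros y Hy. change (Rabs (y - 0) < Rpower eps (/ p)) in Hy.
    rewrite Rminus_0_r in Hy.
    change (Rabs (powR (Rabs y) p - powR (Rabs 0) p) < eps).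
    rewrite Rabs_R0, powR_0, Rminus_0_r, (Rabs_right (powR _ _)) by (apply Rle_ge, powR_ge_0).
    destruct (Req_dec y 0) as [->|Hy0]; [rewrite Rabs_R0, powR_0; apply eps|].
    rewrite powR_pos by now apply Rabs_pos_lt.
    replace (pos eps) with (Rpower (Rpower eps (/ p)) p).
    + apply Rlt_Rpower_l; auto. split; [now apply Rabs_pos_lt | exact Hy].
    + rewrite Rpower_mult, Rinv_l, Rpower_1; auto; [apply eps | lra].
  - assert (Hx' : 0 < Rabs x) by now apply Rabs_pos_lt.
    apply (continuous_ext_loc _ (fun y => Rpower (Rabs y) p)).
    + exists (mkposreal _ Hx'). intros y Hy. change (Rabs (y - x) < Rabs x) in Hy.
      symmetry. apply powR_pos. apply Rabs_pos_lt. intros ->.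
      rewrite Rminus_0_l, Rabs_Ropp in Hy. lra.
    + apply (continuous_comp Rabs (fun y => Rpower y p)); [apply continuous_Rabs|].
      apply (der_continuous _ _ _ (der_Rpower (Rabs x) p Hx')).
Qed.

Lemma Rpower_ge_min a lo hi p : 0 < lo -> lo <= a <= hi ->
  Rmin (Rpower lo p) (Rpower hi p) <= Rpower a p.
Proof.
  intros Hlo Ha. destruct (Rle_lt_dec 0 p) as [Hp|Hp].
  - eapply Rle_trans; [apply Rmin_l|]. apply Rle_Rpower_l; lra.
  - eapply Rle_trans; [apply Rmin_r|].
    replace p with (- - p) by ring. rewrite !(Rpower_Ropp _ (- p)).
    apply Rinv_le_contravar; [apply Rpower_pos|]. apply Rle_Rpower_l; lra.
Qed.

Lemma Rpower_anti a b p : 0 < a <= b -> 0 <= p -> Rpower b (- p) <= Rpower a (- p).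
Proof.
  intros Hab Hp. rewrite !Rpower_Ropp.
  apply Rinv_le_contravar; [apply Rpower_pos|]. apply Rle_Rpower_l; lra.
Qed.

(** On [s, a] the dominating power has an explicit primitive; the piece over
    [0, s] vanishes with s because f is bounded. *)
Lemma integrable_tail (f : R -> R) a C r : 0 < a -> 0 < r < 1 -> 0 <= C ->
  (forall x, 0 <= x <= a -> continuous f x) ->
  (forall x, 0 < x <= a -> Rabs (f x) <= C * Rpower x (- r)) ->
  Rabs (RInt f 0 a) <= C / (1 - r) * Rpower a (1 - r).
Proof.
  intros Ha Hr HC Hc Hb.
  assert (HI : forall u v, 0 <= u -> u <= v -> v <= a -> ex_RInt f u v).
  { intros u v Hu Huv Hv. apply ri_cont; auto. intros; apply Hc; lra. }
  assert (Hab : forall x, 0 <= x <= a -> continuous (fun x => Rabs (f x)) x).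
  { intros x Hx. apply (continuous_comp f Rabs); [now apply Hc | apply continuous_Rabs]. }
  assert (K : forall s, 0 < s <= a ->
     RInt (fun x => Rabs (f x)) s a <= C / (1 - r) * Rpower a (1 - r)).
  { intros s Hs.
    assert (D : forall x, 0 < x ->
       is_derive (fun x => C / (1 - r) * Rpower x (1 - r)) x (C * Rpower x (- r))).
    { intros x Hx. der_by.
      - apply der_mult; [apply der_const | now apply der_Rpower].
      - cbv beta. replace (1 - r - 1) with (- r) by ring. field. lra. }
    assert (Cc : forall x, 0 < x -> continuous (fun x => C * Rpower x (- r)) x).
    { intros x Hx. apply (der_continuous _ _ _ (der_mult _ _ _ _ _ (der_const C x) (der_Rpower x (- r) Hx))). }
    apply Rle_trans with (RInt (fun x => C * Rpower x (- r)) s a).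
    - apply RInt_le; [lra | | |].
      + apply ri_cont; [lra|]. intros; apply Hab; lra.
      + apply ri_cont; [lra|]. intros; apply Cc; lra.
      + intros; apply Hb; lra.
    - rewrite (ri_derive (fun x => C / (1 - r) * Rpower x (1 - r))); [| lra | |].
      + assert (0 <= C / (1 - r) * Rpower s (1 - r)).
        { apply Rmult_le_pos; [|left; apply Rpower_pos]. apply Rdiv_le_0_compat; lra. }
        lra.
      + intros; apply D; lra.
      + intros; apply Cc; lra. }
  destruct (bounded_on_rectangle (fun x _ => f x) 0 a 0 0) as (M & HM & BM).
  { intros x t Hx _. apply cont_1d_2d_fst, Hc, Hx. }
  apply Rnot_lt_le. intros N.
  set (gap := Rabs (RInt f 0 a) - C / (1 - r) * Rpower a (1 - r)) in *.
  assert (Hg : 0 < gap) by (unfold gap; lra).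
  assert (Hs0 : 0 < gap / (2 * (M + 1))) by (apply Rdiv_lt_0_compat; lra).
  set (s := Rmin a (gap / (2 * (M + 1)))).
  assert (Hs : 0 < s <= a) by (split; [apply Rmin_pos; auto | apply Rmin_l]).
  assert (Hs2 : s * M <= gap / 2).
  { apply Rle_trans with (gap / (2 * (M + 1)) * (M + 1)).
    - apply Rmult_le_compat; try lra. apply Rmin_r.
    - right. field. lra. }
  assert (E : RInt f 0 a = RInt f 0 s + RInt f s a :> R).
  { symmetry. apply ri_chasles; apply HI; lra. }
  assert (B1 : Rabs (RInt f 0 s) <= s * M).
  { replace s with (s - 0) at 2 by ring. apply abs_RInt_le_const; [lra | apply HI; lra |].
    intros x Hx. apply (BM x 0); lra. }
  assert (B2 : Rabs (RInt f s a) <= C / (1 - r) * Rpower a (1 - r)).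
  { eapply Rle_trans; [apply abs_RInt_le; [lra | apply HI; lra]|]. apply K; lra. }
  pose proof (Rabs_triang (RInt f 0 s) (RInt f s a)). rewrite <- E in H. unfold gap in *. lra.
Qed.

Lemma at_left_intro (P : R -> Prop) x d : 0 < d ->
  (forall e, x - d < e < x -> P e) -> at_left x P.
Proof.
  intros Hd H. exists (mkposreal d Hd). intros y Hy Hyx. apply H.
  change (Rabs (y - x) < d) in Hy. apply Rabs_def2 in Hy. lra.
Qed.

Lemma Rpower_small q eps : 0 < q -> 0 < eps -> exists d, 0 < d /\
  forall x, 0 < x <= d -> Rpower x q < eps.
Proof.
  intros Hq He. exists (Rpower (eps / 2) (/ q)). split; [apply Rpower_pos|].
  intros x Hx. apply Rle_lt_trans with (Rpower (Rpower (eps / 2) (/ q)) q).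
  - apply Rle_Rpower_l; lra.
  - rewrite Rpower_mult, Rinv_l, Rpower_1; lra.
Qed.

(** Dominated convergence for a singularity at x = 0 that appears only at
    e = 1: the integrals over [0, s] are uniformly small by
    [integrable_tail], and on [s, a] the convergence is uniform.  The Cauchy
    criterion yields the limit without referring to the improper integral. *)
Lemma dominated_limit (f : R -> R -> R) a r C d0 : 0 < a -> 0 < r < 1 -> 0 <= C -> 0 < d0 ->
  (forall x, 0 < x <= a -> continuity_2d_pt f x 1) ->
  (forall e x, 1 - d0 < e < 1 -> 0 <= x <= a -> continuous (fun x => f x e) x) ->
  (forall e x, 1 - d0 < e < 1 -> 0 < x <= a -> Rabs (f x e) <= C * Rpower x (- r)) ->
  exists l : R, filterlim (fun e => RInt (fun x => f x e) 0 a) (at_left 1) (locally l).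
Proof.
  intros Ha Hr HC Hd0 Hc2 Hc1 Hb.
  apply (filterlim_locally_cauchy (U := R_CompleteSpace) (F := at_left 1)
           (fun e => RInt (fun x => f x e) 0 a)).
  intros eps. pose proof (cond_pos eps) as Heps.
  assert (Hq : 0 < eps / 4 / (C / (1 - r) + 1)).
  { apply Rdiv_lt_0_compat; [lra|]. assert (0 <= C / (1 - r)) by (apply Rdiv_le_0_compat; lra). lra. }
  destruct (Rpower_small (1 - r) _ ltac:(lra) Hq) as (s0 & Hs0 & Hsmall).
  set (s := Rmin s0 a).
  assert (Hs : 0 < s <= a) by (split; [apply Rmin_pos; auto | apply Rmin_r]).
  assert (Htail : forall e, 1 - d0 < e < 1 -> Rabs (RInt (fun x => f x e) 0 s) <= eps / 4).
  { intros e He. eapply Rle_trans; [apply (integrable_tail (fun x => f x e) s C r); try lra|].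
    - intros; apply Hc1; lra.
    - intros; apply Hb; lra.
    - assert (H := Hsmall s ltac:(split; [lra | apply Rmin_l])).
      assert (0 <= C / (1 - r)) by (apply Rdiv_le_0_compat; lra).
      apply Rle_trans with ((C / (1 - r) + 1) * (eps / 4 / (C / (1 - r) + 1))).
      + apply Rmult_le_compat; try lra. left; apply Rpower_pos.
      + right. field. split; lra. }
  assert (Hq2 : 0 < eps / 4 / (a + 1)) by (apply Rdiv_lt_0_compat; lra).
  destruct (uniform_continuity_2d_1d f s a 1 ltac:(intros; apply Hc2; lra) (mkposreal _ Hq2))
    as [d Hd]. simpl in Hd. pose proof (cond_pos d) as Hdp.
  assert (Hm : 0 < Rmin d d0) by (apply Rmin_pos; auto).
  pose proof (Rmin_l d d0). pose proof (Rmin_r d d0).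
  exists (fun e => 1 - Rmin d d0 < e < 1). split; [now apply (at_left_intro _ 1 (Rmin d d0))|].
  intros u v Hu Hv.
  change (Rabs (RInt (fun x => f x v) 0 a - RInt (fun x => f x u) 0 a) < eps).
  assert (HI : forall e p q, 1 - d0 < e < 1 -> 0 <= p -> p <= q -> q <= a ->
     ex_RInt (fun x => f x e) p q).
  { intros e p q He Hp Hpq Hqa. apply ri_cont; auto. intros; apply Hc1; lra. }
  rewrite <- (ri_chasles (fun x => f x v) 0 s a) by (apply HI; lra).
  rewrite <- (ri_chasles (fun x => f x u) 0 s a) by (apply HI; lra).
  pose proof (Htail u ltac:(lra)). pose proof (Htail v ltac:(lra)).
  assert (Hmid : Rabs (RInt (fun x => f x v) s a - RInt (fun x => f x u) s a) <= eps / 4).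
  { rewrite <- ri_minus by (apply HI; lra).
    eapply Rle_trans; [apply abs_RInt_le_const; [lra | |]|].
    - apply (ex_RInt_minus (V := R_NormedModule)); apply HI; lra.
    - intros x Hx. left. apply Hd; try lra. rewrite Rminus_diag, Rabs_R0. lra.
    - apply Rle_trans with ((a + 1) * (eps / 4 / (a + 1))).
      + apply Rmult_le_compat_r; lra.
      + right. field. lra. }
  replace (RInt (fun x => f x v) 0 s + RInt (fun x => f x v) s a -
     (RInt (fun x => f x u) 0 s + RInt (fun x => f x u) s a)) with
    (RInt (fun x => f x v) 0 s + - RInt (fun x => f x u) 0 s +
     (RInt (fun x => f x v) s a - RInt (fun x => f x u) s a)) by ring.
  eapply Rle_lt_trans; [apply Rabs_triang|].
  pose proof (Rabs_triang (RInt (fun x => f x v) 0 s) (- RInt (fun x => f x u) 0 s)) as H3.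
  rewrite Rabs_Ropp in H3. lra.
Qed.

Lemma quarter_period (f : R -> R) : (forall x, continuous f x) ->
  (forall x, f (x + 1 / 2) = f x) -> (forall x, f (- x) = f x) ->
  RInt f 0 1 = 4 * RInt f 0 (1 / 4) :> R.
Proof.
  intros Hc Hp He.
  assert (HI : forall a b, ex_RInt f a b) by (intros; now apply ri_cont_all).
  rewrite <- (ri_chasles f 0 (1/2) 1), <- (ri_chasles f 0 (1/4) (1/2)) by auto.
  assert (E1 : RInt (fun y => scal 1 (f (1 * y + 1/2))) 0 (1/2) = RInt f (1 * 0 + 1/2) (1 * (1/2) + 1/2)).
  { now apply (RInt_comp_lin (V := R_CompleteNormedModule) f 1 (1/2) 0 (1/2)). }
  assert (E2 : RInt (fun y => scal (-1) (f (-1 * y + 1/2))) 0 (1/4) = RInt f (-1 * 0 + 1/2) (-1 * (1/4) + 1/2)).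
  { now apply (RInt_comp_lin (V := R_CompleteNormedModule) f (-1) (1/2) 0 (1/4)). }
  replace (1 * 0 + 1/2) with (1/2) in E1 by lra. replace (1 * (1/2) + 1/2) with 1 in E1 by lra.
  replace (-1 * 0 + 1/2) with (1/2) in E2 by lra. replace (-1 * (1/4) + 1/2) with (1/4) in E2 by lra.
  assert (F1 : RInt f (1/2) 1 = RInt f 0 (1/2) :> R).
  { rewrite <- E1. apply RInt_ext. intros x _.
    unfold scal; simpl; unfold mult; simpl. now rewrite !Rmult_1_l, Hp. }
  assert (F2 : RInt f (1/4) (1/2) = RInt f 0 (1/4) :> R).
  { rewrite <- (opp_RInt_swap (V := R_CompleteNormedModule)) by auto. rewrite <- E2.
    rewrite (RInt_ext (V := R_CompleteNormedModule) _ (fun y => -1 * f y)).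
    - rewrite ri_scal by auto. unfold opp; simpl. ring.
    - intros x _. unfold scal; simpl; unfold mult; simpl.
      replace (-1 * x + 1/2) with (- x + 1/2) by ring. now rewrite Hp, He. }
  rewrite F1, <- (ri_chasles f 0 (1/4) (1/2)), F2 by auto. ring.
Qed.

(** * Comparison of the sup norm with the L^p norms *)
(** The bound M makes the supremum finite, so that it equals its real part. *)
Lemma Linf_ge (f : R -> R) M x : (forall y, 0 <= y <= 1 -> Rabs (f y) <= M) ->
  0 <= x <= 1 -> Rabs (f x) <= Linf_norm f.
Proof.
  intros HM Hx. unfold Linf_norm.
  destruct (Lub_Rbar_correct (fun y => exists x, 0 <= x <= 1 /\ y = Rabs (f x))) as [Hub Hlub].
  set (L := Lub_Rbar _) in *.
  assert (H1 : Rbar_le (Rabs (f x)) L) by (apply Hub; eauto).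
  assert (H2 : Rbar_le L M).
  { apply Hlub. intros y (z & Hz & ->). simpl. auto. }
  destruct L; simpl in *; auto; contradiction.
Qed.

Lemma Lp_le_Linf p (f : R -> R) : 0 < p -> (forall x, 0 <= x <= 1 -> continuous f x) ->
  Lp_norm p f <= Linf_norm f.
Proof.
  intros Hp Hc.
  destruct (bounded_on_rectangle (fun x _ => f x) 0 1 0 0) as (M & HM & BM).
  { intros x t Hx _. apply cont_1d_2d_fst, Hc, Hx. }
  assert (HL : forall x, 0 <= x <= 1 -> Rabs (f x) <= Linf_norm f).
  { intros x Hx. apply (Linf_ge f M); auto. intros y Hy. apply (BM y 0); lra. }
  set (L := Linf_norm f) in *.
  assert (HL0 : 0 <= L) by (eapply Rle_trans; [apply Rabs_pos | apply (HL 0); lra]).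
  unfold Lp_norm. rewrite <- (powR_inv L p) at 1 by lra.
  assert (HI : ex_RInt (fun x => powR (Rabs (f x)) p) 0 1).
  { apply ri_cont; [lra|]. intros x Hx.
    apply (continuous_comp f (fun y => powR (Rabs y) p)); [now apply Hc | now apply powR_continuous]. }
  apply powR_le; [left; now apply Rinv_0_lt_compat|]. split.
  - apply RInt_ge_0; [lra | auto |]. intros; apply powR_ge_0.
  - replace (powR L p) with (RInt (fun _ => powR L p) 0 1 : R) by (rewrite ri_const; ring).
    apply RInt_le; [lra | auto | apply ex_RInt_const |].
    intros x Hx. apply powR_le; [lra|]. split; [apply Rabs_pos | apply HL; lra].
Qed.

(** * Uniqueness up to a moving frame *)
Lemma gronwall_zero (E E' : R -> R) K t1 : 0 <= t1 ->
  (forall t, 0 <= t <= t1 -> continuous E t) ->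
  (forall t, 0 < t < t1 -> is_derive E t (E' t) /\ E' t <= K * E t) ->
  E 0 = 0 -> E t1 <= 0.
Proof.
  intros Ht1 Hc Hd H0. destruct (Req_dec t1 0) as [->|Hn]; [lra|].
  set (g := fun t => E t * exp (- K * t)).
  assert (De : forall t, is_derive (fun t => exp (- K * t)) t (- K * exp (- K * t))).
  { intros t. auto_derive; auto. ring. }
  set (dg := fun t => E' t * exp (- K * t) + E t * (- K * exp (- K * t))).
  assert (Hdg : forall t, 0 < t < t1 -> is_derive g t (dg t)).
  { intros t Ht. apply (der_mult E (fun t => exp (- K * t))); [apply Hd, Ht | apply De]. }
  assert (Hle : forall t, 0 < t < t1 -> dg t <= 0).
  { intros t Ht. destruct (Hd t Ht) as [_ Hr]. unfold dg.
    replace (E' t * exp (- K * t) + E t * (- K * exp (- K * t))) with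
      (- ((K * E t - E' t) * exp (- K * t))) by ring.
    pose proof (exp_pos (- K * t)).
    assert (0 <= (K * E t - E' t) * exp (- K * t)) by (apply Rmult_le_pos; lra). lra. }
  (* the mean value point may be an endpoint, where the derivative is given the value 0 *)
  destruct (MVT_gen g 0 t1 (fun t => if Rlt_dec 0 t then if Rlt_dec t t1 then dg t else 0 else 0))
    as [s [Hs Es]].
  - rewrite Rmin_left, Rmax_right by lra. intros t Ht.
    destruct (Rlt_dec 0 t); [|lra]. destruct (Rlt_dec t t1); [|lra]. now apply Hdg.
  - rewrite Rmin_left, Rmax_right by lra. intros t Ht.
    apply continuity_pt_filterlim.
    apply (continuous_mult (K := R_AbsRing) E (fun t => exp (- K * t))); [now apply Hc|].
    apply (der_continuous _ _ _ (De t)).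
  - rewrite Rmin_left, Rmax_right in Hs by lra.
    assert (Hg : g t1 <= 0).
    { assert (E0 : g 0 = 0) by (unfold g; rewrite H0; ring).
      assert (N : forall y, y <= 0 -> y * (t1 - 0) <= 0).
      { intros y Hy. assert (0 <= - y * (t1 - 0)) by (apply Rmult_le_pos; lra). lra. }
      destruct (Rlt_dec 0 s); [destruct (Rlt_dec s t1)|].
      - pose proof (N _ (Hle s ltac:(lra))). lra.
      - pose proof (N 0 ltac:(lra)). lra.
      - pose proof (N 0 ltac:(lra)). lra. }
    unfold g in Hg. apply Rnot_lt_le. intros Hp.
    pose proof (Rmult_lt_0_compat _ _ Hp (exp_pos (- K * t1))). lra.
Qed.

(** A Poincare inequality: any two values of v differ by at most the integral
    of |w|, hence each value differs from the mean 0 by at most that much, and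
    the Cauchy-Schwarz inequality on [0, 1] concludes. *)
Lemma mean_zero_bound (v w : R -> R) :
  (forall x, 0 <= x <= 1 -> is_derive v x (w x)) ->
  (forall x, 0 <= x <= 1 -> continuous w x) ->
  @eq R (RInt v 0 1) 0 -> forall x, 0 <= x <= 1 -> v x ^ 2 <= RInt (fun y => w y ^ 2) 0 1.
Proof.
  intros Hd Hw H0.
  assert (Hv : forall x, 0 <= x <= 1 -> continuous v x).
  { intros x Hx. apply (der_continuous _ _ _ (Hd x Hx)). }
  assert (Ha : forall x, 0 <= x <= 1 -> continuous (fun x => Rabs (w x)) x).
  { intros x Hx. apply (continuous_comp w Rabs); [now apply Hw | apply continuous_Rabs]. }
  assert (Hq : forall x, 0 <= x <= 1 -> continuous (fun x => w x ^ 2) x).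
  { intros x Hx. apply (continuous_comp w (fun y => y ^ 2)); [now apply Hw|].
    apply (der_continuous _ _ (2 * w x)). auto_derive; auto. ring. }
  assert (Ea : ex_RInt (fun x => Rabs (w x)) 0 1) by (apply ri_cont; auto; lra).
  assert (Eq : ex_RInt (fun x => w x ^ 2) 0 1) by (apply ri_cont; auto; lra).
  assert (Ev : ex_RInt v 0 1) by (apply ri_cont; auto; lra).
  set (a := RInt (fun x => Rabs (w x)) 0 1 : R).
  assert (Hosc : forall x y, 0 <= x -> x <= y -> y <= 1 -> Rabs (v y - v x) <= a).
  { intros x y Hx Hxy Hy. rewrite <- (ri_derive v w x y); [| lra | |].
    - eapply Rle_trans; [apply abs_RInt_le; [lra|] |].
      + apply ri_cont; [lra|]. intros; apply Hw; lra.
      + apply ri_sub; auto. intros; apply Rabs_pos.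
    - intros; apply Hd; lra.
    - intros; apply Hw; lra. }
  assert (Hosc' : forall x y, 0 <= x <= 1 -> 0 <= y <= 1 -> Rabs (v y - v x) <= a).
  { intros x y Hx Hy. destruct (Rle_lt_dec x y); [apply Hosc; lra|].
    rewrite Rabs_minus_sym. apply Hosc; lra. }
  assert (Ha2 : a ^ 2 <= RInt (fun y => w y ^ 2) 0 1).
  (* Cauchy-Schwarz, from the integral of (|w| - a)^2 *)
  { assert (K : 0 <= RInt (fun y => w y ^ 2 - (2 * a * Rabs (w y) - a ^ 2)) 0 1).
    { apply RInt_ge_0; [lra | |].
      - apply (ex_RInt_minus (V := R_NormedModule)); auto.
        apply (ex_RInt_minus (V := R_NormedModule)); [|apply ex_RInt_const].
        apply (ex_RInt_scal (V := R_NormedModule)); auto.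
      - intros y _. replace (w y ^ 2) with (Rabs (w y) ^ 2) by apply pow2_abs.
        pose proof (pow2_ge_0 (Rabs (w y) - a)). lra. }
    rewrite ri_minus, ri_minus, ri_scal, ri_const in K; auto.
    - fold a in K. lra.
    - apply (ex_RInt_scal (V := R_NormedModule)); auto.
    - apply ex_RInt_const.
    - apply (ex_RInt_minus (V := R_NormedModule)); [|apply ex_RInt_const].
      apply (ex_RInt_scal (V := R_NormedModule)); auto. }
  intros x Hx. eapply Rle_trans; [|exact Ha2].
  assert (B1 : v x - a <= 0).
  { rewrite <- H0. replace (v x - a) with (RInt (fun _ => v x - a) 0 1 : R) by (rewrite ri_const; ring).
    apply RInt_le; auto; [lra | apply ex_RInt_const |].
    intros y Hy. pose proof (Hosc' y x ltac:(lra) Hx). pose proof (Rle_abs (v x - v y)). lra. }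
  assert (B2 : 0 <= v x + a).
  { rewrite <- H0. replace (v x + a) with (RInt (fun _ => v x + a) 0 1 : R) by (rewrite ri_const; ring).
    apply RInt_le; auto; [lra | apply ex_RInt_const |].
    intros y Hy. pose proof (Hosc' x y Hx ltac:(lra)). pose proof (Rle_abs (v y - v x)). lra. }
  apply pow_maj_Rabs. apply Rabs_le. lra.
Qed.

Definition smooth_near (f : R -> R -> R) (x t : R) : Prop :=
  locally_2d (fun y s => forall n, ex_diff_n f n y s) x t.

Lemma smooth_near_loc f x t : smooth_near f x t -> locally_2d (smooth_near f) x t.
Proof.
  intros [d Hd].
  assert (Hh : 0 < d / 2) by (pose proof (cond_pos d); lra).
  exists (mkposreal _ Hh). simpl. intros u v Hu Hv. exists (mkposreal _ Hh). simpl.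
  intros u' v' Hu' Hv'. apply Hd.
  - replace (u' - x) with ((u' - u) + (u - x)) by ring.
    eapply Rle_lt_trans; [apply Rabs_triang|]. lra.
  - replace (v' - t) with ((v' - v) + (v - t)) by ring.
    eapply Rle_lt_trans; [apply Rabs_triang|]. lra.
Qed.

Lemma smooth_near_cont f x t : smooth_near f x t -> continuity_2d_pt f x t.
Proof. intros H. apply locally_2d_singleton in H. apply (H 0%nat). Qed.

Lemma smooth_near_dx f x t : smooth_near f x t -> smooth_near (dx f) x t.
Proof.
  intros [d Hd]. exists d. intros u v Hu Hv n.
  destruct (Hd u v Hu Hv (S n)) as (_ & _ & _ & H & _). exact H.
Qed.

Lemma smooth_near_dt f x t : smooth_near f x t -> smooth_near (dt f) x t.
Proof.
  intros [d Hd]. exists d. intros u v Hu Hv n.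
  destruct (Hd u v Hu Hv (S n)) as (_ & _ & _ & _ & H). exact H.
Qed.

Lemma smooth_near_der_x f x t : smooth_near f x t -> is_derive (fun y => f y t) x (dx f x t).
Proof.
  intros H. apply locally_2d_singleton in H.
  destruct (H 1%nat) as (_ & H1 & _). now apply Derive_correct.
Qed.

Lemma smooth_near_der_t f x t : smooth_near f x t -> is_derive (fun s => f x s) t (dt f x t).
Proof.
  intros H. apply locally_2d_singleton in H.
  destruct (H 1%nat) as (_ & _ & H1 & _). now apply Derive_correct.
Qed.

(** The solution (u, rho) is compared with a reference solution (V, S) that is
    smooth and 1-periodic on all of R, so that its translates make sense; for
    (u, rho) itself only the boundary identities of the periodic problem are
    available. *)
Section Uniqueness.
Variables (lam kap T : R) (u0 rho0 : R -> R) (u rho V S : R -> R -> R) (J : R -> Prop).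
Hypothesis T_pos : 0 < T.
Hypothesis open_J : open J.
Hypothesis J_T : forall t, 0 <= t < T -> J t.
Hypothesis V_smooth : strip_smooth J V.
Hypothesis S_smooth : strip_smooth J S.
Hypothesis V_per : forall x t, J t -> V (x + 1) t = V x t.
Hypothesis S_per : forall x t, J t -> S (x + 1) t = S x t.
Hypothesis V_law : forall x t, 0 < t < T ->
  dt (dx V) x t + V x t * dx (dx V) x t - lam * dx V x t ^ 2 - kap * S x t ^ 2
  = gHS_I lam kap V S t.
Hypothesis S_law : forall x t, 0 < t < T ->
  dt S x t + V x t * dx S x t = 2 * lam * S x t * dx V x t.
Hypothesis VS_init : forall x, V x 0 = u0 x /\ S x 0 = rho0 x.
Hypothesis sol : gHS_solution lam kap u0 rho0 T u rho.

(** Being open, this condition also holds at small negative times, so that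
    t = 0 becomes an interior point. *)
Definition regular (t : R) : Prop :=
  J t /\ forall x, 0 <= x <= 1 -> smooth_near u x t /\ smooth_near rho x t.

Lemma regular_T t : 0 <= t < T -> regular t.
Proof.
  intros Ht. split; [now apply J_T|]. intros x Hx. split.
  - now apply (gHS_smooth_u _ _ _ _ _ _ _ sol).
  - now apply (gHS_smooth_rho _ _ _ _ _ _ _ sol).
Qed.

Lemma open_regular : open regular.
Proof.
  intros t [Jt Ht]. apply filter_and; [now apply open_J|].
  apply (tube (fun x t => smooth_near u x t /\ smooth_near rho x t)). intros x Hx.
  destruct (Ht x Hx). apply locally_2d_and; now apply smooth_near_loc.
Qed.

Lemma regular_before : exists d, 0 < d /\ forall t, - d < t < T -> regular t.
Proof.
  destruct (open_regular 0 (regular_T 0 ltac:(lra))) as [d Hd]. exists d. split; [apply d|].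
  intros t Ht. destruct (Rle_lt_dec 0 t); [apply regular_T; lra|].
  apply Hd. change (Rabs (t - 0) < d). rewrite Rminus_0_r. apply Rabs_def1; lra.
Qed.

(** The speed of the moving frame makes [du], the difference of the velocities,
    a function of zero mean, to which [mean_zero_bound] applies. *)
Definition drift_rate (t : R) : R := RInt (fun x => u x t) 0 1 - RInt (fun x => V x t) 0 1.
Definition drift (t : R) : R := RInt drift_rate 0 t.

Lemma V_cont_x t x : J t -> continuous (fun x => V x t) x.
Proof. intros Jt. apply cont_2d_slice_l, (smooth_continuity J); auto. Qed.

Lemma u_cont_x t x : regular t -> 0 <= x <= 1 -> continuous (fun x => u x t) x.
Proof. intros [_ Ht] Hx. apply cont_2d_slice_l, smooth_near_cont. now apply Ht. Qed.

Lemma drift_rate_cont t : regular t -> continuous drift_rate t.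
Proof.
  intros Ht. apply (continuous_minus (V := R_NormedModule)).
  - apply (ri_param_continuous u 0 1 t); [lra| |].
    + intros x Hx. apply smooth_near_cont. now apply Ht.
    + destruct (open_regular t Ht) as [d Hd]. exists d. intros s Hs.
      apply ri_cont; [lra|]. intros x Hx. apply u_cont_x; auto.
  - apply (ri_param_continuous V 0 1 t); [lra| |].
    + intros x Hx. apply (smooth_continuity J); auto. apply Ht.
    + destruct (open_regular t Ht) as [d Hd]. exists d. intros s Hs.
      apply ri_cont_all. intros x. apply V_cont_x. now apply Hd.
Qed.

Lemma der_drift t : 0 <= t < T -> is_derive drift t (drift_rate t).
Proof.
  intros Ht. destruct regular_before as (d & Hd & HR).
  apply (ri_primitive_on drift_rate (- d) T 0 t); try lra. intros; now apply drift_rate_cont, HR.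
Qed.

Definition drift_regular (t : R) : Prop := regular t /\ is_derive drift t (drift_rate t).

Lemma drift_regular_T t : 0 <= t < T -> drift_regular t.
Proof. intros Ht. split; [now apply regular_T | now apply der_drift]. Qed.

Lemma drift_regular_near t : 0 <= t < T -> locally t drift_regular.
Proof.
  intros Ht. destruct regular_before as (d & Hd & HR).
  assert (O : open (fun s => - d < s < T)).
  { apply open_and; [apply open_gt | apply open_lt]. }
  destruct (O t ltac:(lra)) as [r Hr]. exists r. intros s Hs. specialize (Hr s Hs).
  split; [now apply HR|].
  apply (ri_primitive_on drift_rate (- d) T 0 s); try lra. intros; now apply drift_rate_cont, HR.
Qed.

Definition drifted (g : R -> R -> R) (x t : R) : R := g (x - drift t) t.

Lemma drifted_cont g x t : strip_smooth J g -> drift_regular t -> continuity_2d_pt (drifted g) x t.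
Proof.
  intros Hg [[Jt _] Hc]. unfold drifted.
  apply (cont_2d_comp g (fun x t => x - drift t) (fun _ t => t)).
  - now apply (smooth_continuity J).
  - apply continuity_2d_pt_minus; [apply continuity_2d_pt_id1|].
    apply cont_1d_2d_snd, (der_continuous _ _ _ Hc).
  - apply continuity_2d_pt_id2.
Qed.

Lemma drifted_der_x g x t : strip_smooth J g -> J t ->
  is_derive (fun x => drifted g x t) x (drifted (dx g) x t).
Proof.
  intros Hg Jt. unfold drifted. der_by.
  - apply (der_comp (fun y => g y t) (fun x => x - drift t)).
    + apply (proj1 (smooth_partials J g open_J Hg) (x - drift t) t Jt).
    + apply der_minus; [apply der_id | apply der_const].
  - cbv beta. ring.
Qed.

Lemma drifted_der_t g x t : strip_smooth J g -> drift_regular t ->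
  is_derive (fun t => drifted g x t) t (drifted (dt g) x t - drift_rate t * drifted (dx g) x t).
Proof.
  intros Hg [[Jt _] Hc]. unfold drifted. der_by.
  - apply (der_comp_2d g (dx g (x - drift t) t) (dt g (x - drift t) t) (fun t => x - drift t) (fun t => t)).
    + now apply (smooth_differentiable J).
    + apply der_minus; [apply der_const | exact Hc].
    + apply der_id.
  - cbv beta. ring.
Qed.

Definition du x t := u x t - drifted V x t - drift_rate t.
Definition dux x t := dx u x t - drifted (dx V) x t.
Definition drho x t := rho x t - drifted S x t.
Definition edens x t := dux x t ^ 2 + drho x t ^ 2.
Definition energy t : R := RInt (fun x => edens x t) 0 1.
Definition dux_t x t := dt (dx u) x t - (drifted (dt (dx V)) x t - drift_rate t * drifted (dx (dx V)) x t).
Definition drho_t x t := dt rho x t - (drifted (dt S) x t - drift_rate t * drifted (dx S) x t).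
Definition dux_x x t := dx (dx u) x t - drifted (dx (dx V)) x t.
Definition drho_x x t := dx rho x t - drifted (dx S) x t.

Lemma dxV_smooth : strip_smooth J (dx V).
Proof. now apply smooth_partials. Qed.
Lemma dxdxV_smooth : strip_smooth J (dx (dx V)).
Proof. now apply smooth_partials; [|apply dxV_smooth]. Qed.
Lemma dtdxV_smooth : strip_smooth J (dt (dx V)).
Proof. now apply smooth_partials; [|apply dxV_smooth]. Qed.
Lemma dxS_smooth : strip_smooth J (dx S).
Proof. now apply smooth_partials. Qed.
Lemma dtS_smooth : strip_smooth J (dt S).
Proof. now apply smooth_partials. Qed.
Hint Resolve dxV_smooth dxdxV_smooth dtdxV_smooth dxS_smooth dtS_smooth smooth_near_dx smooth_near_dt : reg.

Lemma regular_u x t : regular t -> 0 <= x <= 1 -> smooth_near u x t.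
Proof. intros [_ H] Hx. now apply H. Qed.
Lemma regular_rho x t : regular t -> 0 <= x <= 1 -> smooth_near rho x t.
Proof. intros [_ H] Hx. now apply H. Qed.

Lemma dux_der_t x t : drift_regular t -> smooth_near u x t -> is_derive (fun t => dux x t) t (dux_t x t).
Proof.
  intros Ht Hx. apply der_minus.
  - now apply smooth_near_der_t, smooth_near_dx.
  - apply drifted_der_t; auto with reg.
Qed.
Lemma drho_der_t x t : drift_regular t -> smooth_near rho x t -> is_derive (fun t => drho x t) t (drho_t x t).
Proof.
  intros Ht Hx. apply der_minus.
  - now apply smooth_near_der_t.
  - apply drifted_der_t; auto with reg.
Qed.
Lemma du_der_x x t : drift_regular t -> 0 <= x <= 1 -> is_derive (fun x => du x t) x (dux x t).
Proof.
  intros Ht Hx. der_by.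
  - apply der_minus; [|apply der_const]. apply der_minus.
    + apply smooth_near_der_x, regular_u; auto. apply Ht.
    + apply drifted_der_x; auto. apply Ht.
  - unfold dux. ring.
Qed.
Lemma dux_der_x x t : drift_regular t -> 0 <= x <= 1 -> is_derive (fun x => dux x t) x (dux_x x t).
Proof.
  intros Ht Hx. apply der_minus.
  - apply smooth_near_der_x, smooth_near_dx, regular_u; auto. apply Ht.
  - apply drifted_der_x; auto with reg. apply Ht.
Qed.
Lemma drho_der_x x t : drift_regular t -> 0 <= x <= 1 -> is_derive (fun x => drho x t) x (drho_x x t).
Proof.
  intros Ht Hx. apply der_minus.
  - apply smooth_near_der_x, regular_rho; auto. apply Ht.
  - apply drifted_der_x; auto with reg. apply Ht.
Qed.

Lemma edens_der_t x t : drift_regular t -> smooth_near u x t -> smooth_near rho x t ->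
  is_derive (fun t => edens x t) t (2 * dux x t * dux_t x t + 2 * drho x t * drho_t x t).
Proof.
  intros Ht Hu Hr.
  exact (der_plus _ _ _ _ _ (der_sq (fun t => dux x t) t _ (dux_der_t x t Ht Hu))
                            (der_sq (fun t => drho x t) t _ (drho_der_t x t Ht Hr))).
Qed.

Lemma edens_der_x x t : drift_regular t -> 0 <= x <= 1 ->
  is_derive (fun x => edens x t) x (2 * dux x t * dux_x x t + 2 * drho x t * drho_x x t).
Proof.
  intros Ht Hx.
  exact (der_plus _ _ _ _ _ (der_sq (fun x => dux x t) x _ (dux_der_x x t Ht Hx))
                            (der_sq (fun x => drho x t) x _ (drho_der_x x t Ht Hx))).
Qed.

Definition regular_cont (f : R -> R -> R) := forall x t, drift_regular t -> 0 <= x <= 1 -> continuity_2d_pt f x t.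

Lemma rcont_plus f g : regular_cont f -> regular_cont g -> regular_cont (fun x t => f x t + g x t).
Proof. intros Hf Hg x t Ht Hx. apply continuity_2d_pt_plus; auto. Qed.
Lemma rcont_minus f g : regular_cont f -> regular_cont g -> regular_cont (fun x t => f x t - g x t).
Proof. intros Hf Hg x t Ht Hx. apply continuity_2d_pt_minus; auto. Qed.
Lemma rcont_mult f g : regular_cont f -> regular_cont g -> regular_cont (fun x t => f x t * g x t).
Proof. intros Hf Hg x t Ht Hx. apply continuity_2d_pt_mult; auto. Qed.
Lemma rcont_opp f : regular_cont f -> regular_cont (fun x t => - f x t).
Proof. intros Hf x t Ht Hx. apply continuity_2d_pt_opp; auto. Qed.
Lemma rcont_const k : regular_cont (fun _ _ => k).
Proof. intros x t Ht Hx. apply continuity_2d_pt_const. Qed.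
Lemma rcont_pow f n : regular_cont f -> regular_cont (fun x t => f x t ^ n).
Proof.
  intros Hf. induction n; simpl; [apply rcont_const | now apply rcont_mult].
Qed.
Lemma rcont_u : regular_cont u.
Proof. intros x t [Ht _] Hx. now apply smooth_near_cont, regular_u. Qed.
Lemma rcont_dxu : regular_cont (dx u).
Proof. intros x t [Ht _] Hx. now apply smooth_near_cont, smooth_near_dx, regular_u. Qed.
Lemma rcont_dxdxu : regular_cont (dx (dx u)).
Proof. intros x t [Ht _] Hx. now apply smooth_near_cont, smooth_near_dx, smooth_near_dx, regular_u. Qed.
Lemma rcont_dtdxu : regular_cont (dt (dx u)).
Proof. intros x t [Ht _] Hx. now apply smooth_near_cont, smooth_near_dt, smooth_near_dx, regular_u. Qed.
Lemma rcont_rho : regular_cont rho.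
Proof. intros x t [Ht _] Hx. now apply smooth_near_cont, regular_rho. Qed.
Lemma rcont_dxrho : regular_cont (dx rho).
Proof. intros x t [Ht _] Hx. now apply smooth_near_cont, smooth_near_dx, regular_rho. Qed.
Lemma rcont_dtrho : regular_cont (dt rho).
Proof. intros x t [Ht _] Hx. now apply smooth_near_cont, smooth_near_dt, regular_rho. Qed.
Lemma rcont_drifted g : strip_smooth J g -> regular_cont (drifted g).
Proof. intros Hg x t Ht _. now apply drifted_cont. Qed.
Lemma rcont_drift_rate : regular_cont (fun _ t => drift_rate t).
Proof. intros x t Ht _. apply cont_1d_2d_snd, drift_rate_cont, Ht. Qed.
Hint Resolve rcont_opp rcont_plus rcont_minus rcont_mult rcont_const rcont_pow rcont_u rcont_dxu rcont_dxdxu rcont_dtdxu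
  rcont_rho rcont_dxrho rcont_dtrho rcont_drifted rcont_drift_rate : reg.
Lemma rcont_dux : regular_cont dux.
Proof. unfold dux. auto with reg. Qed.
Lemma rcont_drho : regular_cont drho.
Proof. unfold drho. auto with reg. Qed.
Lemma rcont_du : regular_cont du.
Proof. unfold du. auto with reg. Qed.
Lemma rcont_dux_t : regular_cont dux_t.
Proof. unfold dux_t. auto with reg. Qed.
Lemma rcont_drho_t : regular_cont drho_t.
Proof. unfold drho_t. auto with reg. Qed.
Lemma rcont_dux_x : regular_cont dux_x.
Proof. unfold dux_x. auto with reg. Qed.
Lemma rcont_drho_x : regular_cont drho_x.
Proof. unfold drho_x. auto with reg. Qed.
Hint Resolve rcont_dux rcont_drho rcont_du rcont_dux_t rcont_drho_t rcont_dux_x rcont_drho_x : reg.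
Lemma rcont_edens : regular_cont edens.
Proof. unfold edens. auto with reg. Qed.
Hint Resolve rcont_edens : reg.

Lemma rcont_x f t x : regular_cont f -> drift_regular t -> 0 <= x <= 1 -> continuous (fun x => f x t) x.
Proof. intros Hf Ht Hx. now apply cont_2d_slice_l, Hf. Qed.
Lemma rcont_ri f t : regular_cont f -> drift_regular t -> ex_RInt (fun x => f x t) 0 1.
Proof. intros Hf Ht. apply ri_cont; [lra|]. intros; now apply rcont_x. Qed.

Lemma rcont_ri_near f t : regular_cont f -> 0 <= t < T -> locally t (fun t => ex_RInt (fun x => f x t) 0 1).
Proof.
  intros Hf Ht. generalize (drift_regular_near t Ht). apply filter_imp. intros s Hs. now apply rcont_ri.
Qed.

Lemma energy_cont t : 0 <= t < T -> continuous energy t.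
Proof.
  intros Ht. apply (ri_param_continuous edens 0 1 t); [lra| |].
  - intros x Hx. apply rcont_edens; auto. now apply drift_regular_T.
  - apply rcont_ri_near; auto with reg.
Qed.

Lemma energy_der t : 0 < t < T ->
  is_derive energy t (RInt (fun x => 2 * dux x t * dux_t x t + 2 * drho x t * drho_t x t) 0 1).
Proof.
  intros Ht. assert (Ht' : 0 <= t < T) by lra.
  apply (ri_param_derive edens (fun x t => 2 * dux x t * dux_t x t + 2 * drho x t * drho_t x t) 0 1 t); [lra| | |].
  - intros x Hx. destruct (regular_T t Ht') as [_ Hs]. destruct (Hs x Hx) as [Hu Hr].
    assert (L : locally_2d (fun _ s => drift_regular s) x t).
    { destruct (drift_regular_near t Ht') as [d H]. exists d. intros y s _ Hys. now apply H. }
    generalize (locally_2d_and _ _ _ _ L (locally_2d_and _ _ _ _ (smooth_near_loc _ _ _ Hu) (smooth_near_loc _ _ _ Hr))).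
    intros [d H]. exists d. intros y s Hy Hys. destruct (H y s Hy Hys) as (H1 & H2 & H3).
    now apply edens_der_t.
  - intros x Hx. assert (K : regular_cont (fun x t => 2 * dux x t * dux_t x t + 2 * drho x t * drho_t x t)) by auto 10 with reg.
    apply K; auto. now apply drift_regular_T.
  - apply rcont_ri_near; auto with reg.
Qed.

Lemma drifted_per g x t : (forall x, g (x + 1) t = g x t) -> drifted g (x + 1) t = drifted g x t.
Proof. intros H. unfold drifted. rewrite <- (H (x - drift t)). f_equal. ring. Qed.

Lemma dxV_per x t : J t -> dx V (x + 1) t = dx V x t.
Proof.
  intros Jt. symmetry. apply is_derive_unique.
  apply is_derive_ext with (fun y => V (y + 1) t); [intros; now apply V_per|]. der_by.
  - apply (der_comp (fun y => V y t) (fun y => y + 1)).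
    + apply (proj1 (smooth_partials J V open_J V_smooth) (x + 1) t Jt).
    + apply der_plus; [apply der_id | apply der_const].
  - ring.
Qed.

Lemma du_mean t : 0 <= t < T -> @eq R (RInt (fun x => du x t) 0 1) 0.
Proof.
  intros Ht. assert (HR := drift_regular_T t Ht). assert (Jt := J_T t Ht). unfold du.
  rewrite !ri_minus, ri_const.
  - unfold drifted. rewrite (periodic_ri (fun x => V x t)).
    + unfold drift_rate. ring.
    + intros; now apply V_cont_x.
    + intros; now apply V_per.
  - apply (rcont_ri u); auto with reg.
  - apply (rcont_ri (drifted V)); auto with reg.
  - apply (rcont_ri (fun x t => u x t - drifted V x t)); auto with reg.
  - apply ex_RInt_const.
Qed.

Lemma du_periodic t : 0 <= t < T -> du 1 t = du 0 t.
Proof.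
  intros Ht. unfold du. rewrite <- (Rplus_0_l 1), drifted_per.
  - rewrite (Rplus_0_l 1). destruct (gHS_periodic _ _ _ _ _ _ _ sol t Ht) as (-> & _). ring.
  - intros; now apply V_per, J_T.
Qed.

Lemma edens_periodic t : 0 <= t < T -> edens 1 t = edens 0 t.
Proof.
  intros Ht. unfold edens, dux, drho. rewrite <- (Rplus_0_l 1), !drifted_per.
  - rewrite (Rplus_0_l 1). destruct (gHS_periodic _ _ _ _ _ _ _ sol t Ht) as (_ & -> & ->). ring.
  - intros; now apply S_per, J_T.
  - intros; now apply dxV_per, J_T.
Qed.

Lemma du_bound x t : 0 <= t < T -> 0 <= x <= 1 -> du x t ^ 2 <= energy t.
Proof.
  intros Ht Hx. assert (HR := drift_regular_T t Ht).
  apply Rle_trans with (RInt (fun y => dux y t ^ 2) 0 1).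
  - apply (mean_zero_bound (fun x => du x t)); auto.
    + intros; now apply du_der_x.
    + intros; apply rcont_x; auto with reg.
    + now apply du_mean.
  - apply RInt_le; [lra | | |].
    + apply (rcont_ri (fun x t => dux x t ^ 2)); auto with reg.
    + apply rcont_ri; auto with reg.
    + intros y _. unfold edens. pose proof (pow2_ge_0 (drho y t)). lra.
Qed.

(** What remains of the time derivative of [edens] after the removal of two
    terms of zero integral: an exact x-derivative and a multiple of [dux]. *)
Definition energy_rate x t :=
  dx u x t * edens x t
  + 2 * dux x t * (- du x t * drifted (dx (dx V)) x t + lam * (dx u x t + drifted (dx V) x t) * dux x t
                 + kap * (rho x t + drifted S x t) * drho x t)
  + 2 * drho x t * (- du x t * drifted (dx S) x t + 2 * lam * dx u x t * drho x t
                 + 2 * lam * drifted S x t * dux x t).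

Lemma rcont_energy_rate : regular_cont energy_rate.
Proof. unfold energy_rate. auto 20 with reg. Qed.

(** The transport terms of both equations add up to the x-derivative of
    u edens, up to the term u_x edens kept in [energy_rate]; the two nonlocal
    terms depend on t alone and are multiplied by [dux]. *)
Lemma energy_identity x t : 0 < t < T -> 0 <= x <= 1 ->
  2 * dux x t * dux_t x t + 2 * drho x t * drho_t x t =
  2 * (gHS_I lam kap u rho t - gHS_I lam kap V S t) * dux x t
  - (dx u x t * edens x t + u x t * (2 * dux x t * dux_x x t + 2 * drho x t * drho_x x t)) + energy_rate x t.
Proof.
  intros Ht Hx.
  pose proof (gHS_eq_u _ _ _ _ _ _ _ sol x t Hx Ht) as E1.
  pose proof (gHS_eq_rho _ _ _ _ _ _ _ sol x t Hx Ht) as E2.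
  pose proof (V_law (x - drift t) t Ht) as E3. pose proof (S_law (x - drift t) t Ht) as E4.
  rewrite <- E1, <- E3. unfold energy_rate, edens, dux_t, drho_t, dux, drho, dux_x, drho_x, du, drifted.
  replace (dt rho x t) with (2 * lam * rho x t * dx u x t - u x t * dx rho x t) by lra.
  replace (dt S (x - drift t) t) with
    (2 * lam * S (x - drift t) t * dx V (x - drift t) t - V (x - drift t) t * dx S (x - drift t) t) by lra.
  ring.
Qed.

Lemma energy_der_eq t : 0 < t < T -> is_derive energy t (RInt (fun x => energy_rate x t) 0 1).
Proof.
  intros Ht. assert (Ht' : 0 <= t < T) by lra. assert (HR := drift_regular_T t Ht').
  assert (HD := rcont_energy_rate).
  eapply der_eq; [now apply energy_der|].
  set (dI := gHS_I lam kap u rho t - gHS_I lam kap V S t).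
  assert (C1 : regular_cont (fun x t => dx u x t * edens x t + u x t * (2 * dux x t * dux_x x t + 2 * drho x t * drho_x x t)))
    by auto 10 with reg.
  rewrite (ri_ext _ (fun x => 2 * dI * dux x t -
    (dx u x t * edens x t + u x t * (2 * dux x t * dux_x x t + 2 * drho x t * drho_x x t)) + energy_rate x t)); [|lra|].
  2:{ intros x Hx. apply energy_identity; auto; lra. }
  rewrite ri_plus, ri_minus, ri_scal.
  - rewrite (ri_derive (fun x => du x t) (fun x => dux x t)); [|lra| |].
    + rewrite (ri_derive (fun x => u x t * edens x t)); [|lra| |].
      * rewrite du_periodic, edens_periodic by auto.
        destruct (gHS_periodic _ _ _ _ _ _ _ sol t Ht') as (-> & _). ring.
      * intros x Hx. apply (der_mult (fun x => u x t) (fun x => edens x t)).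
        -- now apply smooth_near_der_x, regular_u; [apply HR|].
        -- now apply edens_der_x.
      * intros x Hx. apply (rcont_x _ t x C1); auto.
    + intros; now apply du_der_x.
    + intros; apply rcont_x; auto with reg.
  - apply rcont_ri; auto with reg.
  - apply (rcont_ri (fun x t => 2 * dI * dux x t)); auto with reg.
  - apply (rcont_ri _ t C1); auto.
  - apply (rcont_ri (fun x t => 2 * dI * dux x t -
     (dx u x t * edens x t + u x t * (2 * dux x t * dux_x x t + 2 * drho x t * drho_x x t)))); auto 10 with reg.
  - now apply rcont_ri.
Qed.

Lemma young M a x y : Rabs a <= M -> 2 * a * x * y <= M * (x ^ 2 + y ^ 2).
Proof.
  intros Ha. pose proof (Rabs_pos a).
  assert (H1 : 2 * a * x * y <= Rabs a * (2 * Rabs x * Rabs y)).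
  { eapply Rle_trans; [apply Rle_abs|]. rewrite !Rabs_mult, (Rabs_right 2) by lra. right; ring. }
  assert (H2 : 2 * Rabs x * Rabs y <= x ^ 2 + y ^ 2).
  { rewrite <- (pow2_abs x), <- (pow2_abs y). pose proof (pow2_ge_0 (Rabs x - Rabs y)). lra. }
  pose proof (pow2_ge_0 x). pose proof (pow2_ge_0 y).
  eapply Rle_trans; [exact H1|]. eapply Rle_trans; [apply Rmult_le_compat_l; [auto | exact H2]|].
  apply Rmult_le_compat_r; lra.
Qed.

Lemma energy_rate_bound M x t :
  Rabs (dx u x t) <= M -> Rabs (drifted (dx (dx V)) x t) <= M ->
  Rabs (lam * (dx u x t + drifted (dx V) x t)) <= M -> Rabs (kap * (rho x t + drifted S x t)) <= M ->
  Rabs (drifted (dx S) x t) <= M -> Rabs (2 * lam * dx u x t) <= M -> Rabs (2 * lam * drifted S x t) <= M ->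
  energy_rate x t <= M * (6 * edens x t + 2 * du x t ^ 2).
Proof.
  intros H1 H2 H3 H4 H5 H6 H7. unfold energy_rate, edens.
  set (W := dux x t). set (s := drho x t). set (z := du x t).
  pose proof (young M _ W W H1). pose proof (young M _ s s H1).
  rewrite <- Rabs_Ropp in H2, H5.
  pose proof (young M _ z W H2). pose proof (young M _ W W H3).
  pose proof (young M _ W s H4). pose proof (young M _ z s H5).
  pose proof (young M _ s s H6). pose proof (young M _ s W H7). lra.
Qed.

Lemma rcont_bounded f t1 : regular_cont f -> t1 < T ->
  exists M, 0 <= M /\ forall x t, 0 <= x <= 1 -> 0 <= t <= t1 -> Rabs (f x t) <= M.
Proof.
  intros Hf Ht. apply bounded_on_rectangle. intros x t Hx Ht'. apply Hf; auto. apply drift_regular_T. lra.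
Qed.

Lemma edens_init x : 0 < x < 1 -> edens x 0 = 0.
Proof.
  intros Hx.
  assert (Hc : drift 0 = 0) by apply (RInt_point (V := R_CompleteNormedModule)).
  unfold edens, dux, drho, drifted. rewrite Hc, Rminus_0_r.
  destruct (gHS_init _ _ _ _ _ _ _ sol x ltac:(lra)) as [_ ->].
  destruct (VS_init x) as [_ ->].
  replace (dx u x 0) with (dx V x 0); [ring|].
  apply Derive_ext_loc.
  assert (Hm : 0 < Rmin x (1 - x)) by (apply Rmin_pos; lra).
  exists (mkposreal _ Hm). intros y Hy. change (Rabs (y - x) < Rmin x (1 - x)) in Hy.
  pose proof (Rmin_l x (1 - x)). pose proof (Rmin_r x (1 - x)). apply Rabs_def2 in Hy.
  destruct (VS_init y) as [-> _].
  now destruct (gHS_init _ _ _ _ _ _ _ sol y ltac:(lra)) as [-> _].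
Qed.

(** Each factor multiplying a quadratic term of [energy_rate] is bounded on
    [0, 1] x [0, t1], and [du] is controlled by the energy, so the energy E
    satisfies E' <= 8 M E and E(0) = 0. *)
Lemma energy_zero t1 : 0 <= t1 < T -> energy t1 <= 0.
Proof.
  intros Ht1.
  destruct (rcont_bounded (dx u) t1) as (M1 & P1 & B1); auto with reg; try lra.
  destruct (rcont_bounded (drifted (dx (dx V))) t1) as (M2 & P2 & B2); auto with reg; try lra.
  destruct (rcont_bounded (fun x t => lam * (dx u x t + drifted (dx V) x t)) t1) as (M3 & P3 & B3);
    auto with reg; try lra.
  destruct (rcont_bounded (fun x t => kap * (rho x t + drifted S x t)) t1) as (M4 & P4 & B4);
    auto with reg; try lra.
  destruct (rcont_bounded (drifted (dx S)) t1) as (M5 & P5 & B5); auto with reg; try lra.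
  destruct (rcont_bounded (fun x t => 2 * lam * dx u x t) t1) as (M6 & P6 & B6);
    auto with reg; try lra.
  destruct (rcont_bounded (fun x t => 2 * lam * drifted S x t) t1) as (M7 & P7 & B7);
    auto with reg; try lra.
  set (M := M1 + M2 + M3 + M4 + M5 + M6 + M7).
  apply (gronwall_zero energy (fun t => RInt (fun x => energy_rate x t) 0 1) (8 * M)); [lra | | |].
  - intros; apply energy_cont; lra.
  - intros t Ht. assert (Ht' : 0 < t < T) by lra. split; [now apply energy_der_eq|].
    assert (HR := drift_regular_T t ltac:(lra)).
    assert (HD := rcont_energy_rate).
    replace (8 * M * energy t) with (RInt (fun x => 6 * M * edens x t + 2 * M * energy t) 0 1 : R).
    + apply RInt_le; [lra | now apply rcont_ri | |].
      * apply (ex_RInt_plus (V := R_NormedModule)); [|apply ex_RInt_const].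
        apply (rcont_ri (fun x t => 6 * M * edens x t)); auto with reg.
      * intros x Hx. assert (Hx' : 0 <= x <= 1) by lra. assert (Ht2 : 0 <= t <= t1) by lra.
        assert (M0 : 0 <= M) by (unfold M; lra).
        eapply Rle_trans; [apply (energy_rate_bound M)|].
        -- eapply Rle_trans; [now apply B1|]. unfold M; lra.
        -- eapply Rle_trans; [now apply B2|]. unfold M; lra.
        -- eapply Rle_trans; [now apply B3|]. unfold M; lra.
        -- eapply Rle_trans; [now apply B4|]. unfold M; lra.
        -- eapply Rle_trans; [now apply B5|]. unfold M; lra.
        -- eapply Rle_trans; [now apply B6|]. unfold M; lra.
        -- eapply Rle_trans; [now apply B7|]. unfold M; lra.
        -- pose proof (du_bound x t ltac:(lra) Hx').
           assert (M * du x t ^ 2 <= M * energy t) by now apply Rmult_le_compat_l. lra.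
    + rewrite ri_plus, ri_scal, ri_const.
      * unfold energy. ring.
      * apply rcont_ri; auto with reg.
      * apply (rcont_ri (fun x t => 6 * M * edens x t)); auto with reg.
      * apply ex_RInt_const.
  - unfold energy. rewrite (ri_ext _ (fun _ => 0)); [|lra | intros; now apply edens_init].
    rewrite ri_const. ring.
Qed.

Lemma unique_up_to_shift x t : 0 <= t < T -> 0 < x < 1 -> dx u x t = dx V (x - drift t) t.
Proof.
  intros Ht Hx. assert (HR := drift_regular_T t Ht).
  assert (Hv : forall y, 0 <= y <= 1 -> du y t = 0).
  { intros y Hy. pose proof (du_bound y t Ht Hy). pose proof (energy_zero t Ht).
    pose proof (pow2_ge_0 (du y t)). apply (Rsqr_0_uniq). unfold Rsqr. lra. }
  assert (Hw : dux x t = 0).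
  { assert (D := du_der_x x t HR ltac:(lra)). apply is_derive_unique in D. rewrite <- D.
    rewrite (Derive_ext_loc _ (fun _ => 0)); [apply Derive_const|].
    assert (Hm : 0 < Rmin x (1 - x)) by (apply Rmin_pos; lra).
    exists (mkposreal _ Hm). intros y Hy. change (Rabs (y - x) < Rmin x (1 - x)) in Hy.
    pose proof (Rmin_l x (1 - x)). pose proof (Rmin_r x (1 - x)). apply Rabs_def2 in Hy.
    apply Hv. lra. }
  unfold dux, drifted in Hw. lra.
Qed.

End Uniqueness.

(** * The explicit solution along characteristics *)
Section Flow.
Variables (lam kap c ts : R) (A B : R -> R).

Definition unitI (e : R) : Prop := -1 < e < 1.
Definition mu : R := -1 / (2 * lam).
(** The new time is e, and x is a label, that is the initial position of a
    particle.  With A = lam u0' and B^2 = - lam kap rho0^2, the function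
    sqrt Q / rate^(1/2) of e is the solution jac^(-lam) of the Ermakov-Pinney
    equation. *)
Definition Q (x e : R) : R := (1 - A x * e) ^ 2 + (B x * e) ^ 2.
Definition Qe (x e : R) : R := -2 * A x * (1 - A x * e) + 2 * (B x) ^ 2 * e.
Definition Qmu (x e : R) : R := Rpower (Q x e) mu.
Definition Qmu_e (x e : R) : R := mu * (Qe x e / Q x e) * Qmu x e.
Definition cumQ (x e : R) : R := RInt (fun y => Qmu y e) 0 x.
Definition cumQ_e (x e : R) : R := RInt (fun y => Qmu_e y e) 0 x.
(** Dividing by K0 makes the flow map a period onto a period. *)
Definition K0 (e : R) : R := cumQ 1 e.
Definition K1 (e : R) : R := cumQ_e 1 e.
Definition dlogK0 (e : R) : R := K1 e / K0 e.
(** The derivative of the new time e with respect to t. *)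
Definition rate (e : R) : R := Rpower (K0 e) (-2 * lam).
(** Position at the new time e of the particle with label x; [jac] and
    [flow_e] are its partial derivatives. *)
Definition flow (x e : R) : R := cumQ x e / K0 e.
Definition jac (x e : R) : R := Qmu x e / K0 e.
Definition flow_e (x e : R) : R := cumQ_e x e / K0 e - flow x e * dlogK0 e.
(** The value of u_x at the particle with label x. *)
Definition strain (x e : R) : R := rate e * (mu * (Qe x e / Q x e) - dlogK0 e).
(** The time t as a function of the new time e; [eta] is its inverse, and the
    final time [ts] is its limit at e = 1. *)
Definition clock (e : R) : R := RInt (fun s => / rate s) 0 e.
Definition eta (t : R) : R := epsilon (inhabits 0) (fun e => -1/2 < e < 1 /\ clock e = t).
(** The label of the particle that is at x at time t. *)
Definition label (x t : R) : R := epsilon (inhabits 0) (fun y => flow y (eta t) = x).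
(** Some negative times are included, so that t = 0 is an interior point. *)
Definition timeJ (t : R) : Prop := clock (-1/2) < t < ts.
Definition eulerian (g : R -> R -> R) (x t : R) : R := g (label x t) (eta t).
Definition vel (x e : R) : R := rate e * flow_e x e.
(** On a characteristic rho = rho0 jac^(2 lam) with rho0 = c B, and this power
    of the Jacobian is rate / Q. *)
Definition dens (x e : R) : R := c * B x * rate e / Q x e.
Definition refU : R -> R -> R := eulerian vel.
Definition refRho : R -> R -> R := eulerian dens.

Hypothesis lam_neq0 : lam <> 0.
Hypothesis c_eq : - lam * kap * c ^ 2 = 1.
Hypothesis A_smooth : strip_smooth (fun _ => True) (fun x _ => A x).
Hypothesis B_smooth : strip_smooth (fun _ => True) (fun x _ => B x).
Hypothesis A_per : forall x, A (x + 1) = A x.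
Hypothesis B_per : forall x, B (x + 1) = B x.
Hypothesis A_mean : @eq R (RInt A 0 1) 0.
Hypothesis Q_pos : forall x e, unitI e -> 0 < Q x e.
Hypothesis clock_lt : forall e, 0 <= e < 1 -> clock e < ts.
Hypothesis clock_sup : forall t, t < ts -> exists e, 0 <= e < 1 /\ t < clock e.

Lemma open_unitI : open unitI.
Proof. apply open_and; [apply open_gt | apply open_lt]. Qed.

Lemma open_timeJ : open timeJ.
Proof. apply open_and; [apply open_gt | apply open_lt]. Qed.

Lemma smooth_of_all (Pr : R -> Prop) f : strip_smooth (fun _ => True) f -> strip_smooth Pr f.
Proof.
  intros Hf. apply (smooth_comp Pr (fun _ => True) f (fun x _ => x) (fun _ t => t)); auto.
  - apply open_all.
  - apply smooth_fst.
  - apply smooth_snd.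
Qed.

Hint Resolve open_unitI open_timeJ smooth_const smooth_fst smooth_snd smooth_plus smooth_minus
  smooth_mult smooth_opp smooth_pow : smooth.

Lemma smooth_A : strip_smooth unitI (fun x _ => A x).
Proof. now apply smooth_of_all. Qed.
Lemma smooth_B : strip_smooth unitI (fun x _ => B x).
Proof. now apply smooth_of_all. Qed.
Hint Resolve smooth_A smooth_B : smooth.

Lemma smooth_Q : strip_smooth unitI Q.
Proof. unfold Q. auto 10 with smooth. Qed.
Lemma smooth_Qe : strip_smooth unitI Qe.
Proof. unfold Qe. auto 10 with smooth. Qed.
Hint Resolve smooth_Q smooth_Qe : smooth.
Lemma smooth_Qmu : strip_smooth unitI Qmu.
Proof. apply (smooth_Rpower unitI Q mu); auto with smooth. Qed.
Hint Resolve smooth_Qmu : smooth.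
Lemma smooth_Qe_div_Q : strip_smooth unitI (fun x e => Qe x e / Q x e).
Proof. apply smooth_div; auto with smooth. Qed.
Hint Resolve smooth_Qe_div_Q : smooth.
Lemma smooth_Qmu_e : strip_smooth unitI Qmu_e.
Proof. unfold Qmu_e. auto with smooth. Qed.
Hint Resolve smooth_Qmu_e : smooth.
Lemma smooth_cumQ : strip_smooth unitI cumQ.
Proof. apply smooth_primitive; auto with smooth. Qed.
Lemma smooth_cumQ_e : strip_smooth unitI cumQ_e.
Proof. apply smooth_primitive; auto with smooth. Qed.
Hint Resolve smooth_cumQ smooth_cumQ_e : smooth.
Lemma smooth_at_1 f : strip_smooth unitI f -> strip_smooth unitI (fun _ e => f 1 e).
Proof.
  intros Hf. apply (smooth_comp unitI unitI f (fun _ _ => 1) (fun _ e => e)); auto with smooth.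
Qed.
Lemma smooth_K0 : strip_smooth unitI (fun _ e => K0 e).
Proof. apply smooth_at_1, smooth_cumQ. Qed.
Lemma smooth_K1 : strip_smooth unitI (fun _ e => K1 e).
Proof. apply smooth_at_1, smooth_cumQ_e. Qed.
Hint Resolve smooth_K0 smooth_K1 : smooth.

Lemma Qmu_cont e x : unitI e -> continuous (fun y => Qmu y e) x.
Proof. intros He. apply cont_2d_slice_l, (smooth_continuity unitI); auto with smooth. Qed.
Lemma Qmu_e_cont e x : unitI e -> continuous (fun y => Qmu_e y e) x.
Proof. intros He. apply cont_2d_slice_l, (smooth_continuity unitI); auto with smooth. Qed.

Lemma Qmu_pos x e : 0 < Qmu x e.
Proof. apply exp_pos. Qed.

Lemma K0_pos e : unitI e -> 0 < K0 e.
Proof.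
  intros He. apply RInt_gt_0; [lra | intros; apply Qmu_pos |].
  intros; now apply Qmu_cont.
Qed.
Hint Resolve K0_pos : smooth.

Lemma rate_pos e : 0 < rate e.
Proof. apply exp_pos. Qed.

Lemma smooth_rate : strip_smooth unitI (fun _ e => rate e).
Proof. apply (smooth_Rpower unitI (fun _ e => K0 e)); auto with smooth. Qed.
Lemma smooth_dlogK0 : strip_smooth unitI (fun _ e => dlogK0 e).
Proof. apply smooth_div; auto with smooth. Qed.
Hint Resolve smooth_rate smooth_dlogK0 : smooth.
Lemma smooth_flow : strip_smooth unitI flow.
Proof. apply smooth_div; auto with smooth. Qed.
Lemma smooth_jac : strip_smooth unitI jac.
Proof. apply smooth_div; auto with smooth. Qed.
Hint Resolve smooth_flow smooth_jac : smooth.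
Lemma smooth_flow_e : strip_smooth unitI flow_e.
Proof. apply smooth_minus; [apply smooth_div|]; auto with smooth. Qed.
Hint Resolve smooth_flow_e : smooth.
Lemma smooth_vel : strip_smooth unitI vel.
Proof. unfold vel; auto with smooth. Qed.
Lemma smooth_dens : strip_smooth unitI dens.
Proof. unfold dens; apply smooth_div; auto with smooth. Qed.
Lemma smooth_strain : strip_smooth unitI strain.
Proof. unfold strain; auto 10 with smooth. Qed.
Hint Resolve smooth_vel smooth_dens smooth_strain : smooth.

Lemma der_Q (x e : R) : is_derive (fun e => Q x e) e (Qe x e).
Proof. unfold Q, Qe. auto_derive; auto. simpl. ring. Qed.

Lemma der_Qe (x e : R) : is_derive (fun e => Qe x e) e (2 * A x ^ 2 + 2 * B x ^ 2).
Proof. unfold Qe. auto_derive; auto. simpl. ring. Qed.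

Lemma der_Qmu (x e : R) : unitI e -> is_derive (fun e => Qmu x e) e (Qmu_e x e).
Proof.
  intros He. unfold Qmu. der_by.
  - apply (der_comp (fun y => Rpower y mu) (fun e => Q x e) e).
    + apply der_Rpower, Q_pos, He.
    + apply der_Q.
  - unfold Qmu_e, Qmu. rewrite Rpower_minus_1 by now apply Q_pos.
    field. apply Rgt_not_eq, Q_pos, He.
Qed.

Lemma der_cumQ_x (x e : R) : unitI e -> is_derive (fun x => cumQ x e) x (Qmu x e).
Proof. intros He. apply (ri_primitive (fun y => Qmu y e)). intros; now apply Qmu_cont. Qed.
Lemma der_cumQ_e_x (x e : R) : unitI e -> is_derive (fun x => cumQ_e x e) x (Qmu_e x e).
Proof. intros He. apply (ri_primitive (fun y => Qmu_e y e)). intros; now apply Qmu_e_cont. Qed.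
Lemma der_cumQ_e (x e : R) : unitI e -> is_derive (fun e => cumQ x e) e (cumQ_e x e).
Proof.
  intros He. apply (primitive_derive_t unitI Qmu Qmu_e); auto with smooth.
  - intros; apply (smooth_continuity unitI); auto with smooth.
  - intros; now apply der_Qmu.
  - intros; apply (smooth_continuity unitI); auto with smooth.
Qed.
Lemma der_K0 (e : R) : unitI e -> is_derive K0 e (K1 e).
Proof. apply der_cumQ_e. Qed.

Lemma der_rate (e : R) : unitI e -> is_derive rate e (-2 * lam * rate e * dlogK0 e).
Proof.
  intros He. unfold rate. der_by.
  - apply (der_comp (fun y => Rpower y (-2 * lam)) K0 e).
    + apply der_Rpower, K0_pos, He.
    + now apply der_K0.
  - rewrite Rpower_minus_1 by now apply K0_pos.
    unfold dlogK0. field. apply Rgt_not_eq, K0_pos, He.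
Qed.

Lemma der_flow_x (x e : R) : unitI e -> is_derive (fun x => flow x e) x (jac x e).
Proof.
  intros He. unfold flow, jac, Rdiv. der_by.
  - apply der_mult; [now apply der_cumQ_x | apply der_const].
  - cbv beta; ring.
Qed.

Lemma der_flow_e (x e : R) : unitI e -> is_derive (fun e => flow x e) e (flow_e x e).
Proof.
  intros He. pose proof (K0_pos e He). unfold flow, Rdiv. der_by.
  - apply der_mult; [now apply der_cumQ_e | apply der_inv; [lra | now apply der_K0]].
  - cbv beta; unfold flow_e, flow, dlogK0. field. lra.
Qed.

Lemma der_flow_e_x (x e : R) : unitI e ->
  is_derive (fun x => flow_e x e) x (jac x e * (mu * (Qe x e / Q x e) - dlogK0 e)).
Proof.
  intros He. unfold flow_e. der_by.
  - apply der_minus.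
    + unfold Rdiv. apply der_mult; [now apply der_cumQ_e_x | apply der_const].
    + apply der_mult; [now apply der_flow_x | apply der_const].
  - cbv beta. pose proof (K0_pos e He). pose proof (Q_pos x e He).
    unfold jac, Qmu_e. field. lra.
Qed.

Lemma der_vel_x (x e : R) : unitI e -> is_derive (fun x => vel x e) x (jac x e * strain x e).
Proof.
  intros He. unfold vel. der_by.
  - apply der_mult; [apply der_const | now apply der_flow_e_x].
  - cbv beta; unfold strain. ring.
Qed.

Lemma jac_pos x e : unitI e -> 0 < jac x e.
Proof. intros He. apply Rdiv_lt_0_compat; [apply Qmu_pos | now apply K0_pos]. Qed.

Lemma Qmu_per x e : Qmu (x + 1) e = Qmu x e.
Proof. unfold Qmu, Q. now rewrite A_per, B_per. Qed.
Lemma Qmu_e_per x e : Qmu_e (x + 1) e = Qmu_e x e.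
Proof. unfold Qmu_e, Qe, Q. now rewrite Qmu_per, A_per, B_per. Qed.

Lemma flow_per x e : unitI e -> flow (x + 1) e = flow x e + 1.
Proof.
  intros He. pose proof (K0_pos e He). unfold flow, cumQ.
  rewrite primitive_per; [|intros; now apply Qmu_cont | intros; apply Qmu_per].
  unfold K0, cumQ in *. field. lra.
Qed.

Lemma flow_e_per x e : unitI e -> flow_e (x + 1) e = flow_e x e.
Proof.
  intros He. pose proof (K0_pos e He). unfold flow_e. rewrite flow_per by auto. unfold cumQ_e.
  rewrite primitive_per; [|intros; now apply Qmu_e_cont | intros; apply Qmu_e_per].
  unfold dlogK0, K1, cumQ_e. field. lra.
Qed.

Lemma strain_per x e : strain (x + 1) e = strain x e.
Proof. unfold strain, Qe, Q. now rewrite A_per, B_per. Qed.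
Lemma vel_per x e : unitI e -> vel (x + 1) e = vel x e.
Proof. intros He. unfold vel. now rewrite flow_e_per. Qed.
Lemma dens_per x e : dens (x + 1) e = dens x e.
Proof. unfold dens, Q. now rewrite A_per, B_per. Qed.

Lemma der_clock (e : R) : unitI e -> is_derive clock e (/ rate e).
Proof.
  unfold unitI. intros He. apply (ri_primitive_on (fun s => / rate s) (-1) 1 0 e); try lra.
  intros y Hy. pose proof (rate_pos y).
  apply (der_continuous _ _ _ (der_inv rate y _ (Rgt_not_eq _ _ H) (der_rate y Hy))).
Qed.

Lemma clock_incr e1 e2 : -1 < e1 -> e1 < e2 -> e2 < 1 -> clock e1 < clock e2.
Proof.
  apply (der_pos_incr clock (fun e => / rate e)).
  - intros; now apply der_clock.
  - intros. apply Rinv_0_lt_compat, rate_pos.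
Qed.

Lemma clock_0 : clock 0 = 0.
Proof. apply (RInt_point (V := R_CompleteNormedModule)). Qed.

Lemma ts_pos : 0 < ts.
Proof. rewrite <- clock_0. apply clock_lt. lra. Qed.

Lemma timeJ_nonneg t : 0 <= t < ts -> timeJ t.
Proof.
  intros Ht. split; [|apply Ht]. apply Rlt_le_trans with 0; [|apply Ht].
  rewrite <- clock_0. apply clock_incr; lra.
Qed.

Lemma clock_in_timeJ e : -1/2 < e < 1 -> timeJ (clock e).
Proof.
  intros He. split; [apply clock_incr; lra|].
  destruct (Rle_lt_dec 0 e); [apply clock_lt; lra|].
  apply Rlt_trans with (clock 0); [apply clock_incr; lra | rewrite clock_0; apply ts_pos].
Qed.

Lemma eta_spec t : timeJ t -> -1/2 < eta t < 1 /\ clock (eta t) = t.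
Proof.
  intros [H1 H2]. apply (epsilon_spec (inhabits 0) (fun e => -1/2 < e < 1 /\ clock e = t)).
  destruct (clock_sup t H2) as [e [He Hte]].
  destruct (ivt_on clock (-1/2) e t) as [e0 [He0 E]]; try lra.
  - intros y Hy. apply (der_continuous _ _ (/ rate y)), der_clock. unfold unitI; lra.
  - exists e0. split; auto. split; [|lra].
    destruct (Req_dec e0 (-1/2)); [subst e0; lra | lra].
Qed.

Lemma eta_unit t : timeJ t -> unitI (eta t).
Proof. intros Ht. destruct (eta_spec t Ht). unfold unitI; lra. Qed.
Hint Resolve eta_unit : smooth.

Lemma eta_incr t1 t2 : timeJ t1 -> timeJ t2 -> t1 < t2 -> eta t1 < eta t2.
Proof.
  intros J1 J2 H. destruct (eta_spec t1 J1) as [B1 E1], (eta_spec t2 J2) as [B2 E2].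
  apply Rnot_le_lt. intros [L|L].
  - assert (clock (eta t2) < clock (eta t1)) by (apply clock_incr; lra). lra.
  - rewrite L in E2. lra.
Qed.

Lemma eta_clock e : -1/2 < e < 1 -> eta (clock e) = e.
Proof.
  intros He. destruct (eta_spec (clock e) (clock_in_timeJ e He)) as [B0 E].
  destruct (Rtotal_order (eta (clock e)) e) as [L|[L|L]]; auto.
  - assert (clock (eta (clock e)) < clock e) by (apply clock_incr; lra). lra.
  - assert (clock e < clock (eta (clock e))) by (apply clock_incr; lra). lra.
Qed.

Lemma eta_0 : eta 0 = 0.
Proof. rewrite <- clock_0 at 1. apply eta_clock. lra. Qed.

(** A monotone map with a monotone inverse: t is kept between the clock values
    of two new times close to eta t. *)
Lemma eta_cont t : timeJ t -> continuous eta t.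
Proof.
  intros Jt. apply filterlim_locally. intros eps.
  destruct (eta_spec t Jt) as [B0 E].
  set (a := Rmax (-1/2) (eta t - eps)). set (b := Rmin 1 (eta t + eps)).
  pose proof (cond_pos eps) as Heps.
  set (a' := (a + eta t) / 2). set (b' := (b + eta t) / 2).
  assert (Ha : -1/2 <= a < eta t /\ eta t - eps <= a).
  { unfold a; split; [split; [apply Rmax_l | apply Rmax_lub_lt; lra] | apply Rmax_r]. }
  assert (Hb : eta t < b <= 1 /\ b <= eta t + eps).
  { unfold b; split; [split; [apply Rmin_glb_lt; lra | apply Rmin_l] | apply Rmin_r]. }
  assert (Ha' : clock a' < t) by (apply Rlt_le_trans with (clock (eta t)); [apply clock_incr; unfold a' | ]; lra).
  assert (Hb' : t < clock b') by (apply Rle_lt_trans with (clock (eta t)); [ | apply clock_incr; unfold b']; lra).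
  assert (Hm : 0 < Rmin (t - clock a') (clock b' - t)) by (apply Rmin_pos; lra).
  exists (mkposreal _ Hm). intros s Hs.
  assert (Hs' : Rabs (s - t) < Rmin (t - clock a') (clock b' - t)) by exact Hs.
  pose proof (Rmin_l (t - clock a') (clock b' - t)). pose proof (Rmin_r (t - clock a') (clock b' - t)).
  apply Rabs_def2 in Hs'. destruct Hs'.
  assert (Ja : timeJ (clock a')) by (apply clock_in_timeJ; unfold a'; lra).
  assert (Jb : timeJ (clock b')) by (apply clock_in_timeJ; unfold b'; lra).
  assert (Js : timeJ s) by (unfold timeJ in *; lra).
  assert (L1 : eta (clock a') < eta s) by (apply eta_incr; auto; lra).
  assert (L2 : eta s < eta (clock b')) by (apply eta_incr; auto; lra).
  rewrite eta_clock in L1 by (unfold a'; lra). rewrite eta_clock in L2 by (unfold b'; lra).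
  change (Rabs (eta s - eta t) < eps). apply Rabs_def1; unfold a', b' in *; lra.
Qed.

Lemma der_eta (t : R) : timeJ t -> is_derive eta t (rate (eta t)).
Proof.
  intros Jt. pose proof (rate_pos (eta t)) as Hh.
  der_by.
  - apply (implicit_derive (fun a _ => clock a) eta (fun _ => 0) (fun t => t) t (/ rate (eta t)) 0 0 1).
    + apply differentiable_pt_lim_proj1_0, is_derive_Reals, der_clock, eta_unit, Jt.
    + apply Rinv_neq_0_compat. lra.
    + now apply eta_cont.
    + apply der_const.
    + apply der_id.
    + destruct (open_timeJ t Jt) as [d H]. exists d. intros s Hs. apply eta_spec, H, Hs.
  - cbv beta; field. lra.
Qed.

(** The derivative of [eta] is a smooth function of [eta], so every order of
    smoothness yields the next one. *)
Lemma smooth_eta : strip_smooth timeJ (fun _ t => eta t).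
Proof.
  intros n. induction n as [|n IH].
  - split; [|exact I]. intros x t Jt. now apply cont_1d_2d_snd, eta_cont.
  - split.
    + intros x t Jt. now apply cont_1d_2d_snd, eta_cont.
    + exists (fun _ _ => 0), (fun _ t => rate (eta t)). split.
      * intros x t Jt. split; [apply der_const | now apply der_eta].
      * split; [apply strip_Cn_const|].
        apply (strip_Cn_comp timeJ unitI n (fun _ e => rate e) (fun _ _ => 0) (fun _ t => eta t));
          auto with smooth.
        apply strip_Cn_const.
Qed.

Lemma flow_incr x y e : unitI e -> x < y -> flow x e < flow y e.
Proof.
  intros He Hxy.
  apply (der_pos_incr (fun x => flow x e) (fun x => jac x e) (x - 1) (y + 1)); try lra.
  - intros; now apply der_flow_x.
  - intros; now apply jac_pos.
Qed.

Lemma flow_0 e : flow 0 e = 0.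
Proof.
  unfold flow, cumQ. rewrite (RInt_point (V := R_CompleteNormedModule)).
  unfold zero; simpl. unfold Rdiv; ring.
Qed.

Lemma flow_INR n e : unitI e -> flow (INR n) e = INR n /\ flow (- INR n) e = - INR n.
Proof.
  intros He. induction n as [|n [IH1 IH2]].
  - simpl. rewrite Ropp_0. split; apply flow_0.
  - rewrite S_INR. split.
    + rewrite flow_per by auto. lra.
    + pose proof (flow_per (- (INR n + 1)) e He) as H.
      replace (- (INR n + 1) + 1) with (- INR n) in H by ring. lra.
Qed.

Lemma label_spec x t : timeJ t -> flow (label x t) (eta t) = x.
Proof.
  intros Jt. apply (epsilon_spec (inhabits 0) (fun y => flow y (eta t) = x)).
  assert (He := eta_unit t Jt).
  destruct (INR_unbounded (Rabs x)) as [n Hn].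
  destruct (flow_INR n (eta t) He) as [E1 E2].
  pose proof (Rle_abs x). pose proof (Rle_abs (- x)) as H0. rewrite Rabs_Ropp in H0.
  destruct (ivt_on (fun y => flow y (eta t)) (- INR n) (INR n) x) as [y [_ E]].
  - lra.
  - intros y _. now apply (der_continuous _ _ _ (der_flow_x y (eta t) He)).
  - rewrite E1, E2. lra.
  - now exists y.
Qed.

Lemma label_unique x t y : timeJ t -> flow y (eta t) = x -> label x t = y.
Proof.
  intros Jt E. pose proof (label_spec x t Jt) as H. pose proof (eta_unit t Jt) as He.
  destruct (Rtotal_order (label x t) y) as [L|[L|L]]; auto;
    apply (flow_incr _ _ (eta t) He) in L; lra.
Qed.

Lemma label_per x t : timeJ t -> label (x + 1) t = label x t + 1.
Proof.
  intros Jt. apply label_unique; auto. rewrite flow_per by auto with smooth.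
  now rewrite label_spec.
Qed.

(** The point x lies strictly between the positions of the particles labelled
    y - eps and y + eps, where y is its label; the positions move continuously,
    so this persists nearby, and the flow is increasing in the label. *)
Lemma label_cont x t : timeJ t -> continuity_2d_pt label x t.
Proof.
  intros Jt eps. pose proof (eta_unit t Jt) as He. pose proof (cond_pos eps) as Heps.
  set (y := label x t).
  assert (H1 : flow (y - eps) (eta t) < x).
  { rewrite <- (label_spec x t Jt). apply flow_incr; auto. fold y. lra. }
  assert (H2 : x < flow (y + eps) (eta t)).
  { rewrite <- (label_spec x t Jt) at 1. apply flow_incr; auto. fold y. lra. }
  assert (C : forall z, continuous (fun s => flow z (eta s)) t).
  { intros z. apply (continuous_comp eta (fun e => flow z e)); [now apply eta_cont|].
    apply (der_continuous _ _ _ (der_flow_e z (eta t) He)). }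
  set (d1 := (x - flow (y - eps) (eta t)) / 2). set (d2 := (flow (y + eps) (eta t) - x) / 2).
  assert (P1 : 0 < d1) by (unfold d1; lra). assert (P2 : 0 < d2) by (unfold d2; lra).
  destruct (proj1 (filterlim_locally _ _) (C (y - eps)) (mkposreal _ P1)) as [r1 R1].
  destruct (proj1 (filterlim_locally _ _) (C (y + eps)) (mkposreal _ P2)) as [r2 R2].
  destruct (open_timeJ t Jt) as [r3 R3].
  assert (Hm : 0 < Rmin (Rmin d1 d2) (Rmin (Rmin r1 r2) r3)).
  { repeat apply Rmin_pos; auto; apply cond_pos. }
  exists (mkposreal _ Hm). simpl. intros u v Hu Hv.
  assert (L : Rmin (Rmin d1 d2) (Rmin (Rmin r1 r2) r3) <= d1 /\
              Rmin (Rmin d1 d2) (Rmin (Rmin r1 r2) r3) <= d2 /\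
              Rmin (Rmin d1 d2) (Rmin (Rmin r1 r2) r3) <= r1 /\
              Rmin (Rmin d1 d2) (Rmin (Rmin r1 r2) r3) <= r2 /\
              Rmin (Rmin d1 d2) (Rmin (Rmin r1 r2) r3) <= r3).
  { unfold Rmin. repeat destruct Rle_dec; lra. }
  destruct L as (L1 & L2 & L3 & L4 & L5).
  assert (Q1 := R1 v (Rlt_le_trans _ _ (pos r1) Hv L3)).
  assert (Q2 := R2 v (Rlt_le_trans _ _ (pos r2) Hv L4)).
  assert (Jv := R3 v (Rlt_le_trans _ _ (pos r3) Hv L5)).
  change (Rabs (flow (y - eps) (eta v) - flow (y - eps) (eta t)) < d1) in Q1.
  change (Rabs (flow (y + eps) (eta v) - flow (y + eps) (eta t)) < d2) in Q2.
  apply Rabs_def2 in Q1; destruct Q1. apply Rabs_def2 in Q2; destruct Q2.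
  apply Rabs_def2 in Hu; destruct Hu.
  pose proof (label_spec u v Jv) as E. pose proof (eta_unit v Jv) as Hev.
  unfold d1, d2 in *.
  apply Rabs_def1.
  - apply Rnot_le_lt. intros N.
    assert (flow (y + eps) (eta v) <= flow (label u v) (eta v)).
    { destruct (Req_dec (y + eps) (label u v)) as [K|K]; [rewrite K; lra|].
      left. apply flow_incr; auto. lra. }
    lra.
  - apply Rnot_le_lt. intros N.
    assert (flow (label u v) (eta v) <= flow (y - eps) (eta v)).
    { destruct (Req_dec (label u v) (y - eps)) as [K|K]; [rewrite K; lra|].
      left. apply flow_incr; auto. lra. }
    lra.
Qed.

Lemma flow_differentiable x e : unitI e ->
  differentiable_pt_lim flow x e (jac x e) (flow_e x e).
Proof.
  intros He. apply (strip_C1_differentiable unitI flow jac flow_e); auto with smooth.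
  - intros; split; [now apply der_flow_x | now apply der_flow_e].
  - apply (smooth_continuity unitI); auto with smooth.
Qed.

Lemma der_label_x (x t : R) : timeJ t -> is_derive (fun x => label x t) x (/ jac (label x t) (eta t)).
Proof.
  intros Jt. pose proof (jac_pos (label x t) (eta t) (eta_unit t Jt)) as Hp.
  der_by.
  - apply (implicit_derive flow (fun x => label x t) (fun _ => eta t) (fun x => x) x
       (jac (label x t) (eta t)) (flow_e (label x t) (eta t)) 0 1).
    + apply flow_differentiable; auto with smooth.
    + lra.
    + now apply (cont_2d_slice_l label), label_cont.
    + apply der_const.
    + apply der_id.
    + apply filter_forall. intros; now apply label_spec.
  - cbv beta; field. lra.
Qed.

Lemma der_label_t (x t : R) : timeJ t -> is_derive (fun t => label x t) t
  (- (rate (eta t) * flow_e (label x t) (eta t) / jac (label x t) (eta t))).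
Proof.
  intros Jt. pose proof (jac_pos (label x t) (eta t) (eta_unit t Jt)) as Hp.
  der_by.
  - apply (implicit_derive flow (fun t => label x t) eta (fun _ => x) t
       (jac (label x t) (eta t)) (flow_e (label x t) (eta t)) (rate (eta t)) 0).
    + apply flow_differentiable; auto with smooth.
    + lra.
    + now apply (cont_2d_slice_r label), label_cont.
    + now apply der_eta.
    + apply der_const.
    + destruct (open_timeJ t Jt) as [d H]. exists d. intros s Hs. apply label_spec, H, Hs.
  - cbv beta; field. lra.
Qed.

(** As for [eta]: the partial derivatives of [label] are smooth functions of
    ([label], [eta]). *)
Lemma smooth_label : strip_smooth timeJ label.
Proof.
  assert (S1 : strip_smooth unitI (fun x e => / jac x e)).
  { apply smooth_inv; auto with smooth. intros; now apply jac_pos. }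
  assert (S2 : strip_smooth unitI (fun x e => - (rate e * flow_e x e / jac x e))).
  { apply smooth_opp, smooth_div; auto with smooth. intros; now apply jac_pos. }
  intros n. induction n as [|n IH]; split.
  1,3: intros; now apply label_cont.
  - exact I.
  - exists (fun x t => / jac (label x t) (eta t)),
      (fun x t => - (rate (eta t) * flow_e (label x t) (eta t) / jac (label x t) (eta t))).
    split; [|split].
    + intros x t Jt. split; [now apply der_label_x | now apply der_label_t].
    + apply (strip_Cn_comp timeJ unitI n (fun x e => / jac x e) label (fun _ t => eta t));
        auto with smooth. apply smooth_eta.
    + apply (strip_Cn_comp timeJ unitI n (fun x e => - (rate e * flow_e x e / jac x e)) label (fun _ t => eta t));
        auto with smooth. apply smooth_eta.
Qed.

Lemma smooth_eulerian g : strip_smooth unitI g -> strip_smooth timeJ (eulerian g).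
Proof.
  intros Hg. apply (smooth_comp timeJ unitI g label (fun _ t => eta t)); auto with smooth.
  - apply smooth_label.
  - apply smooth_eta.
Qed.

Lemma der_eulerian_x g (gx x t : R) : timeJ t ->
  is_derive (fun y => g y (eta t)) (label x t) (jac (label x t) (eta t) * gx) ->
  is_derive (fun x => eulerian g x t) x gx.
Proof.
  intros Jt Hd. pose proof (jac_pos (label x t) (eta t) (eta_unit t Jt)) as Hp.
  der_by.
  - apply (der_comp (fun y => g y (eta t)) (fun x => label x t) x); [exact Hd | now apply der_label_x].
  - cbv beta; field. lra.
Qed.

(** The velocity is that of the particles, so the material derivative in
    Eulerian variables is the derivative in time at a fixed label. *)
Lemma eulerian_transport g x t : strip_smooth unitI g -> timeJ t ->
  dt (eulerian g) x t + refU x t * dx (eulerian g) x t = rate (eta t) * dt g (label x t) (eta t).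
Proof.
  intros Hg Jt. pose proof (jac_pos (label x t) (eta t) (eta_unit t Jt)) as Hp.
  pose proof (smooth_differentiable unitI g (label x t) (eta t) open_unitI Hg (eta_unit t Jt)) as Hd.
  destruct (smooth_partials unitI g open_unitI Hg) as (Hd1 & _).
  assert (E1 : dx (eulerian g) x t = dx g (label x t) (eta t) / jac (label x t) (eta t)).
  { apply is_derive_unique, der_eulerian_x; auto. der_by.
    - exact (proj1 (Hd1 (label x t) (eta t) (eta_unit t Jt))).
    - generalize dependent (jac (label x t) (eta t)). intros a Ha. apply Rlt_not_eq, not_eq_sym in Ha. clear - Ha. field. exact Ha. }
  assert (E2 : dt (eulerian g) x t =
     dx g (label x t) (eta t) * (- (rate (eta t) * flow_e (label x t) (eta t) / jac (label x t) (eta t)))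
     + dt g (label x t) (eta t) * rate (eta t)).
  { apply is_derive_unique. apply (der_comp_2d g _ _ (fun t => label x t) eta t).
    - exact Hd.
    - now apply der_label_t.
    - now apply der_eta. }
  rewrite E1, E2. unfold refU, eulerian, vel. clear E1 E2 Hd Hd1.
  revert Hp. generalize (jac (label x t) (eta t)) (dx g (label x t) (eta t)) (dt g (label x t) (eta t))
    (flow_e (label x t) (eta t)) (rate (eta t)).
  intros a b d f k Ha. apply Rlt_not_eq, not_eq_sym in Ha. clear - Ha. field. exact Ha.
Qed.

Lemma smooth_refU : strip_smooth timeJ refU.
Proof. apply smooth_eulerian, smooth_vel. Qed.
Lemma smooth_refRho : strip_smooth timeJ refRho.
Proof. apply smooth_eulerian, smooth_dens. Qed.
Hint Resolve smooth_refU smooth_refRho : smooth.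

Lemma dx_refU x t : timeJ t -> dx refU x t = eulerian strain x t.
Proof.
  intros Jt. apply is_derive_unique, der_eulerian_x; auto.
  apply der_vel_x; auto with smooth.
Qed.

Lemma eulerian_per g x t : timeJ t -> (forall x e, unitI e -> g (x + 1) e = g x e) ->
  eulerian g (x + 1) t = eulerian g x t.
Proof. intros Jt Hg. unfold eulerian. rewrite label_per by auto. apply Hg; auto with smooth. Qed.

Lemma refU_per x t : timeJ t -> refU (x + 1) t = refU x t.
Proof. intros Jt. apply eulerian_per; auto. intros; now apply vel_per. Qed.
Lemma dx_refU_per x t : timeJ t -> dx refU (x + 1) t = dx refU x t.
Proof. intros Jt. rewrite !dx_refU by auto. apply eulerian_per; auto. intros; apply strain_per. Qed.
Lemma refRho_per x t : timeJ t -> refRho (x + 1) t = refRho x t.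
Proof. intros Jt. apply eulerian_per; auto. intros; apply dens_per. Qed.

Definition ddlogK0 (e : R) : R := Derive dlogK0 e.

Lemma der_dlogK0 (e : R) : unitI e -> is_derive dlogK0 e (ddlogK0 e).
Proof. intros He. exact (smooth_der_t unitI (fun _ e => dlogK0 e) 0 e open_unitI smooth_dlogK0 He). Qed.

Definition forcing (e : R) : R := rate e ^ 2 * (lam * dlogK0 e ^ 2 - ddlogK0 e).

(** As a polynomial in e, Q has discriminant - 4 B^2, so
    Qe^2 - 2 Q Qee = - 4 B^2.  This is the only part of the left-hand side
    that depends on x, and c is such that kap rho^2 cancels it. *)
Lemma strain_riccati x e : unitI e ->
  rate e * dt strain x e - lam * strain x e ^ 2 - kap * dens x e ^ 2 = forcing e.
Proof.
  intros He. pose proof (Q_pos x e He) as HQ.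
  assert (E : dt strain x e = -2 * lam * rate e * dlogK0 e * (mu * (Qe x e / Q x e) - dlogK0 e)
     + rate e * (mu * ((2 * A x ^ 2 + 2 * B x ^ 2) / Q x e - Qe x e ^ 2 / Q x e ^ 2) - ddlogK0 e)).
  { apply is_derive_unique. unfold strain. der_by.
    - apply der_mult; [now apply der_rate|].
      apply der_minus; [|now apply der_dlogK0].
      apply der_mult; [apply der_const|].
      unfold Rdiv. apply der_mult; [apply der_Qe|].
      apply der_inv; [lra | apply der_Q].
    - cbv beta. field. lra. }
  assert (D : Qe x e ^ 2 - 2 * Q x e * (2 * A x ^ 2 + 2 * B x ^ 2) = - 4 * B x ^ 2).
  { unfold Qe, Q. ring. }
  assert (D' : Qe x e ^ 2 = 2 * Q x e * (2 * A x ^ 2 + 2 * B x ^ 2) - 4 * B x ^ 2) by lra.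
  assert (C : kap * c ^ 2 = - / lam).
  { apply Rmult_eq_reg_l with (- lam); [|lra].
    replace (- lam * - / lam) with 1 by (field; auto). rewrite <- c_eq. ring. }
  rewrite E. unfold dens, strain, forcing.
  replace (kap * (c * B x * rate e / Q x e) ^ 2) with
    (kap * c ^ 2 * (B x ^ 2 * rate e ^ 2 / Q x e ^ 2)) by (field; lra).
  rewrite C.
  replace (rate e *
    (-2 * lam * rate e * dlogK0 e * (mu * (Qe x e / Q x e) - dlogK0 e) +
     rate e * (mu * ((2 * A x ^ 2 + 2 * B x ^ 2) / Q x e - Qe x e ^ 2 / Q x e ^ 2) - ddlogK0 e)) -
    lam * (rate e * (mu * (Qe x e / Q x e) - dlogK0 e)) ^ 2 -
    - / lam * (B x ^ 2 * rate e ^ 2 / Q x e ^ 2)) with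
    (rate e ^ 2 * (lam * dlogK0 e ^ 2 - ddlogK0 e + mu * (2 * A x ^ 2 + 2 * B x ^ 2) / Q x e
      - mu * (1 + lam * mu) * Qe x e ^ 2 / Q x e ^ 2 + B x ^ 2 / (lam * Q x e ^ 2)))
    by (field; split; lra).
  rewrite D'. unfold mu. field. split; lra.
Qed.

Lemma dens_law x e : unitI e -> rate e * dt dens x e = 2 * lam * dens x e * strain x e.
Proof.
  intros He. pose proof (Q_pos x e He) as HQ.
  assert (E : dt dens x e = c * B x * (-2 * lam * rate e * dlogK0 e) / Q x e
      - c * B x * rate e * Qe x e / Q x e ^ 2).
  { apply is_derive_unique. unfold dens, Rdiv. der_by.
    - apply der_mult; [|apply der_inv; [lra | apply der_Q]].
      apply der_mult; [apply der_const | now apply der_rate].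
    - cbv beta. field. lra. }
  rewrite E. unfold strain, dens, mu. field. split; lra.
Qed.

Lemma dx_refU_smooth : strip_smooth timeJ (dx refU).
Proof. apply smooth_dx_of; auto with smooth. Qed.
Hint Resolve dx_refU_smooth : smooth.

Lemma ddx_refU x t : timeJ t -> dx (dx refU) x t = dx (eulerian strain) x t.
Proof. intros Jt. apply Derive_ext. intros y. now apply dx_refU. Qed.
Lemma dtdx_refU x t : timeJ t -> dt (dx refU) x t = dt (eulerian strain) x t.
Proof.
  intros Jt. apply Derive_ext_loc. destruct (open_timeJ t Jt) as [d H].
  exists d. intros s Hs. apply dx_refU, H, Hs.
Qed.

Lemma refU_law x t : timeJ t ->
  dt (dx refU) x t + refU x t * dx (dx refU) x t - lam * dx refU x t ^ 2 - kap * refRho x t ^ 2 = forcing (eta t).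
Proof.
  intros Jt. rewrite ddx_refU, dtdx_refU, eulerian_transport, dx_refU by auto with smooth.
  unfold refRho, eulerian. apply strain_riccati; auto with smooth.
Qed.

Lemma refRho_law x t : timeJ t -> dt refRho x t + refU x t * dx refRho x t = 2 * lam * refRho x t * dx refU x t.
Proof.
  intros Jt. rewrite dx_refU by auto. unfold refRho. rewrite eulerian_transport by auto with smooth.
  unfold eulerian. apply dens_law; auto with smooth.
Qed.

Lemma refU_0 t : timeJ t -> refU 0 t = 0.
Proof.
  intros Jt. unfold refU, eulerian. rewrite (label_unique 0 t 0) by (auto; apply flow_0).
  unfold vel, flow_e, cumQ_e. rewrite flow_0, (RInt_point (V := R_CompleteNormedModule)).
  unfold zero; simpl. unfold Rdiv; ring.
Qed.
Lemma refU_1 t : timeJ t -> refU 1 t = 0.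
Proof. intros Jt. rewrite <- (Rplus_0_l 1), refU_per by auto. now apply refU_0. Qed.

Lemma cont_x g t : strip_smooth timeJ g -> timeJ t -> forall x, continuous (fun x => g x t) x.
Proof. intros Hg Jt x. apply cont_2d_slice_l, (smooth_continuity timeJ); auto. Qed.

(** By periodicity u_x has zero mean at all times. *)
Lemma dtdx_refU_mean t : timeJ t -> RInt (fun x => dt (dx refU) x t) 0 1 = 0 :> R.
Proof.
  intros Jt.
  assert (H : is_derive (fun t => RInt (fun x => dx refU x t) 0 1) t
                (RInt (fun x => dt (dx refU) x t) 0 1)).
  { apply (primitive_derive_t timeJ (dx refU)); auto with smooth.
    - intros; apply (smooth_continuity timeJ); auto with smooth.
    - intros; apply (smooth_der_t timeJ (dx refU)); auto with smooth.
    - intros; apply (smooth_continuity timeJ); auto. apply smooth_dt_of; auto with smooth. }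
  apply is_derive_unique in H. rewrite <- H. apply is_derive_unique.
  apply is_derive_ext_loc with (fun _ => 0); [|apply der_const].
  destruct (open_timeJ t Jt) as [d Hd]. exists d. intros s Hs. assert (Js := Hd s Hs).
  rewrite (ri_derive (fun x => refU x s) (fun x => dx refU x s) 0 1); [| lra | |].
  - rewrite refU_0, refU_1 by auto. symmetry. apply Rminus_0_r.
  - intros; apply (smooth_der_x timeJ refU); auto with smooth.
  - intros; apply (cont_x (dx refU)); auto with smooth.
Qed.

(** The function of t left over in [refU_law] is found by integrating that law
    over a period: u_xt has zero mean and u u_xx integrates to minus the
    integral of u_x^2. *)
Lemma forcing_eq_I t : timeJ t -> forcing (eta t) = gHS_I lam kap refU refRho t.
Proof.
  intros Jt.
  assert (S1 : strip_smooth timeJ (dt (dx refU))) by (apply smooth_dt_of; auto with smooth).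
  assert (S2 : strip_smooth timeJ (dx (dx refU))) by (apply smooth_dx_of; auto with smooth).
  assert (H1 : RInt (fun x => dx refU x t * dx refU x t + refU x t * dx (dx refU) x t) 0 1 = 0 :> R).
  { rewrite (ri_derive (fun x => refU x t * dx refU x t)); [| lra | |].
    - rewrite refU_0, refU_1 by auto. ring.
    - intros x _. apply (der_mult (fun x => refU x t) (fun x => dx refU x t)).
      + apply (smooth_der_x timeJ refU); auto with smooth.
      + apply (smooth_der_x timeJ (dx refU)); auto with smooth.
    - intros x _. apply (cont_x (fun x t => dx refU x t * dx refU x t + refU x t * dx (dx refU) x t));
        auto with smooth. }
  assert (H2 : RInt (fun _ => forcing (eta t)) 0 1 = forcing (eta t) :> R) by (rewrite ri_const; ring).
  rewrite <- H2.
  rewrite (ri_ext _ (fun x => dt (dx refU) x t +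
     ((dx refU x t * dx refU x t + refU x t * dx (dx refU) x t)
      - ((1 + lam) * dx refU x t ^ 2 + kap * refRho x t ^ 2)))); [| lra |].
  2:{ intros x _. rewrite <- (refU_law x t Jt). ring. }
  assert (C : forall g, strip_smooth timeJ g -> ex_RInt (fun x => g x t) 0 1).
  { intros g Hg. apply ri_cont_all. now apply cont_x. }
  rewrite ri_plus, ri_minus, H1, dtdx_refU_mean by
    (auto; apply (C (fun x t => dx refU x t * dx refU x t + refU x t * dx (dx refU) x t)) ||
      apply (C (fun x t => (1 + lam) * dx refU x t ^ 2 + kap * refRho x t ^ 2)) ||
      apply (C (fun x t => dx refU x t * dx refU x t + refU x t * dx (dx refU) x t
        - ((1 + lam) * dx refU x t ^ 2 + kap * refRho x t ^ 2))); auto 10 with smooth).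
  rewrite (ri_plus (fun x => (1 + lam) * dx refU x t ^ 2) (fun x => kap * refRho x t ^ 2)),
    (ri_scal (1 + lam) (fun x => dx refU x t ^ 2)), (ri_scal kap (fun x => refRho x t ^ 2)).
  - unfold gHS_I. ring.
  - apply (C (fun x t => refRho x t ^ 2)); auto with smooth.
  - apply (C (fun x t => dx refU x t ^ 2)); auto with smooth.
  - apply (C (fun x t => (1 + lam) * dx refU x t ^ 2)); auto with smooth.
  - apply (C (fun x t => kap * refRho x t ^ 2)); auto with smooth.
Qed.

Lemma Q_0 x : Q x 0 = 1.
Proof. unfold Q. ring. Qed.
Lemma Qmu_0 x : Qmu x 0 = 1.
Proof. unfold Qmu. rewrite Q_0. unfold Rpower. now rewrite ln_1, Rmult_0_r, exp_0. Qed.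
Lemma cumQ_0 x : cumQ x 0 = x.
Proof.
  unfold cumQ. rewrite (RInt_ext (V := R_CompleteNormedModule) _ (fun _ => 1)).
  - rewrite ri_const. ring.
  - intros; apply Qmu_0.
Qed.
Lemma K0_0 : K0 0 = 1.
Proof. apply cumQ_0. Qed.
Lemma A_cont x : continuous A x.
Proof. apply (cont_2d_slice_l (fun x _ => A x) x 0), (smooth_continuity (fun _ => True)); auto. Qed.
Lemma cumQ_e_0 x : cumQ_e x 0 = RInt A 0 x / lam.
Proof.
  unfold cumQ_e. rewrite (ri_ext_all _ (fun y => / lam * A y)).
  - rewrite ri_scal by (apply ri_cont_all, A_cont). unfold Rdiv. ring.
  - intros y. unfold Qmu_e. rewrite Qmu_0, Q_0. unfold Qe, mu. field. auto.
Qed.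
Lemma rate_0 : rate 0 = 1.
Proof. unfold rate. rewrite K0_0. unfold Rpower. now rewrite ln_1, Rmult_0_r, exp_0. Qed.

Lemma label_0 x : label x 0 = x.
Proof.
  apply label_unique.
  - apply timeJ_nonneg. pose proof ts_pos. lra.
  - rewrite eta_0. unfold flow. rewrite cumQ_0, K0_0. field.
Qed.

Lemma refU_init x : refU x 0 = RInt A 0 x / lam.
Proof.
  unfold refU, eulerian, vel, flow_e, dlogK0, K1. rewrite label_0, eta_0, rate_0, K0_0, !cumQ_e_0, A_mean. field. auto.
Qed.
Lemma refRho_init x : refRho x 0 = c * B x.
Proof. unfold refRho, eulerian, dens. rewrite label_0, eta_0, rate_0, Q_0. field. Qed.

Lemma flow_solution :
  gHS_solution lam kap (fun x => RInt A 0 x / lam) (fun x => c * B x) ts refU refRho.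
Proof.
  split.
  - apply (smooth_on_strip_of timeJ); auto with smooth. apply timeJ_nonneg.
  - apply (smooth_on_strip_of timeJ); auto with smooth. apply timeJ_nonneg.
  - intros x t _ Ht. assert (Jt : timeJ t) by (apply timeJ_nonneg; lra).
    rewrite <- forcing_eq_I by auto. now apply refU_law.
  - intros x t _ Ht. apply refRho_law, timeJ_nonneg. lra.
  - intros x _. split; [apply refU_init | apply refRho_init].
  - intros t Ht. apply timeJ_nonneg in Ht.
    rewrite <- (Rplus_0_l 1), refU_per, dx_refU_per, refRho_per by auto. auto.
Qed.

(** * L^p norms as integrals over labels *)
Definition Lp_mass (p e : R) : R := RInt (fun a => powR (Rabs (strain a e)) p * jac a e) 0 1.

Lemma strain_cont e x : unitI e -> continuous (fun x => strain x e) x.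
Proof. intros He. apply cont_2d_slice_l, (smooth_continuity unitI); auto with smooth. Qed.
Lemma jac_cont e x : unitI e -> continuous (fun x => jac x e) x.
Proof. intros He. apply cont_2d_slice_l, (smooth_continuity unitI); auto with smooth. Qed.

Lemma dx_refU_powR_cont p t x : 0 < p -> timeJ t -> continuous (fun x => powR (Rabs (dx refU x t)) p) x.
Proof.
  intros Hp Jt. apply (continuous_comp (fun x => dx refU x t) (fun y => powR (Rabs y) p)).
  - apply cont_x; auto with smooth.
  - now apply powR_continuous.
Qed.

(** Change of variables x = flow a e. *)
Lemma dx_refU_Lp_mass p t : 0 < p -> timeJ t ->
  RInt (fun x => powR (Rabs (dx refU x t)) p) 0 1 = Lp_mass p (eta t) :> R.
Proof.
  intros Hp Jt. assert (He := eta_unit t Jt).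
  assert (E := RInt_comp (V := R_CompleteNormedModule)
    (fun x => powR (Rabs (dx refU x t)) p) (fun a => flow a (eta t)) (fun a => jac a (eta t)) 0 1).
  assert (G1 : flow 1 (eta t) = 1).
  { rewrite <- (Rplus_0_l 1) at 1. rewrite flow_per, flow_0 by auto. ring. }
  cbv beta in E. rewrite flow_0, G1 in E. rewrite <- E.
  - apply RInt_ext. intros a _. unfold scal; simpl; unfold mult; simpl.
    rewrite Rmult_comm. f_equal. f_equal. f_equal. rewrite dx_refU by auto. unfold eulerian.
    now rewrite (label_unique (flow a (eta t)) t a).
  - intros a _. now apply dx_refU_powR_cont.
  - intros a _. split; [now apply der_flow_x | now apply jac_cont].
Qed.

Lemma eta_lim : filterlim eta (at_left ts) (at_left 1).
Proof.
  intros P0 [d Hd]. pose proof (cond_pos d) as Hdp.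
  set (e0 := Rmax 0 (1 - d / 2)).
  assert (He0 : 0 <= e0 < 1) by (unfold e0; split; [apply Rmax_l | apply Rmax_lub_lt; lra]).
  assert (He1 : 1 - d / 2 <= e0) by apply Rmax_r.
  apply (at_left_intro _ ts (ts - clock e0)); [pose proof (clock_lt e0 He0); lra|].
  intros t Ht.
  assert (J0 : timeJ (clock e0)) by (apply clock_in_timeJ; lra).
  assert (Jt : timeJ t) by (unfold timeJ in *; lra).
  assert (L : eta (clock e0) < eta t) by (apply eta_incr; auto; lra).
  rewrite eta_clock in L by lra. destruct (eta_spec t Jt) as [B1 _].
  apply Hd; [|lra]. change (Rabs (eta t - 1) < d). apply Rabs_def1; lra.
Qed.

Lemma any_solution_dx u rho :
  gHS_solution lam kap (fun x => RInt A 0 x / lam) (fun x => c * B x) ts u rho ->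
  exists s : R -> R, forall x t, 0 <= t < ts -> 0 < x < 1 -> dx u x t = dx refU (x - s t) t.
Proof.
  intros Hs. exists (drift u refU). intros x t Ht Hx.
  apply (unique_up_to_shift lam kap ts (fun x => RInt A 0 x / lam) (fun x => c * B x)
    u rho refU refRho timeJ); auto with smooth.
  - apply ts_pos.
  - apply timeJ_nonneg.
  - intros; now apply refU_per.
  - intros; now apply refRho_per.
  - intros y s Hs'. assert (Js : timeJ s) by (apply timeJ_nonneg; lra).
    rewrite <- forcing_eq_I by auto. now apply refU_law.
  - intros y s Hs'. apply refRho_law, timeJ_nonneg. lra.
  - intros y. split; [apply refU_init | apply refRho_init].
Qed.

(** The moving frame only translates a periodic function, which leaves its
    integral over a period unchanged. *)
Lemma any_solution_Lp u rho p t :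
  gHS_solution lam kap (fun x => RInt A 0 x / lam) (fun x => c * B x) ts u rho ->
  0 < p -> 0 <= t < ts -> Lp_norm p (fun x => dx u x t) = powR (Lp_mass p (eta t)) (/ p).
Proof.
  intros Hs Hp Ht. assert (Jt := timeJ_nonneg t Ht). unfold Lp_norm. f_equal.
  destruct (any_solution_dx u rho Hs) as [s Es].
  rewrite (ri_ext _ (fun x => powR (Rabs (dx refU (x - s t) t)) p)); [|lra|].
  - rewrite (periodic_ri (fun x => powR (Rabs (dx refU x t)) p)).
    + now apply dx_refU_Lp_mass.
    + intros; now apply dx_refU_powR_cont.
    + intros; now rewrite dx_refU_per.
  - intros x Hx. now rewrite Es.
Qed.

End Flow.

(** * The trigonometric data *)
(** The factor 1/4 is far from the optimal 2 / PI, which makes it enough to use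
    monotonicity: cos is at least 1/2 up to PI / 3, and sin at least 1/2
    beyond. *)
Lemma sin_ge_linear y : 0 <= y <= PI / 2 -> y / 4 <= sin y.
Proof.
  intros Hy. pose proof PI_4 as P4. pose proof PI_RGT_0 as P0.
  destruct (Rle_lt_dec y (PI / 3)) as [H|H].
  - destruct (Req_dec y 0) as [->|Hn]; [rewrite sin_0; lra|].
    destruct (MVT_gen sin 0 y cos) as [z [Hz E]].
    + intros; apply is_derive_Reals, derivable_pt_lim_sin.
    + intros. apply continuity_sin.
    + rewrite Rmin_left, Rmax_right in Hz by lra. rewrite sin_0, !Rminus_0_r in E.
      assert (Hc : cos (PI / 3) <= cos z) by (apply cos_decr_1; lra).
      rewrite cos_PI3 in Hc.
      assert (1 / 2 * y <= cos z * y) by (apply Rmult_le_compat_r; lra). lra.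
  - assert (Hs : sin (PI / 6) <= sin y) by (apply sin_incr_1; lra).
    rewrite sin_PI6 in Hs. lra.
Qed.

Definition Sn (x : R) : R := sin (2 * PI * x).
(** The choice of lam u0'.  It has zero mean, and its maxima are the zeros of
    [Sn]. *)
Definition cosA (x : R) : R := cos (4 * PI * x).
(** The choice of sqrt (- lam kap) rho0; its zeros are the maxima of [cosA]. *)
Definition sinB (k : nat) (x : R) : R := Sn x ^ k.

Lemma cosA_eq x : cosA x = 1 - 2 * Sn x ^ 2.
Proof.
  unfold cosA, Sn. replace (4 * PI * x) with (2 * (2 * PI * x)) by ring.
  rewrite cos_2a_sin. ring.
Qed.

Lemma Sn_sq_le_1 x : 0 <= Sn x ^ 2 <= 1.
Proof.
  split; [apply pow2_ge_0|]. pose proof (SIN_bound (2 * PI * x)) as H. fold (Sn x) in H.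
  replace 1 with (1 ^ 2) by ring. apply pow_maj_Rabs. apply Rabs_le. lra.
Qed.

Lemma cosA_bound x : -1 <= cosA x <= 1.
Proof. apply COS_bound. Qed.

Lemma sinB_sq k x : sinB k x ^ 2 = (Sn x ^ 2) ^ k.
Proof. unfold sinB. rewrite <- !pow_mult. f_equal. lia. Qed.

Lemma sinB_sq_le_1 k x : 0 <= sinB k x ^ 2 <= 1.
Proof.
  rewrite sinB_sq. pose proof (Sn_sq_le_1 x). split; [apply pow_le; lra|].
  rewrite <- (pow1 k). apply pow_incr. lra.
Qed.

Lemma Sn_half x : Sn (x + 1 / 2) = - Sn x.
Proof.
  unfold Sn. replace (2 * PI * (x + 1 / 2)) with (2 * PI * x + PI) by field. apply neg_sin.
Qed.
Lemma Sn_opp x : Sn (- x) = - Sn x.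
Proof. unfold Sn. replace (2 * PI * - x) with (- (2 * PI * x)) by ring. apply sin_neg. Qed.
Lemma Sn_per x : Sn (x + 1) = Sn x.
Proof. replace (x + 1) with (x + 1 / 2 + 1 / 2) by lra. rewrite !Sn_half. ring. Qed.

Lemma cosA_half x : cosA (x + 1 / 2) = cosA x.
Proof. rewrite !cosA_eq, Sn_half. ring. Qed.
Lemma cosA_opp x : cosA (- x) = cosA x.
Proof. rewrite !cosA_eq, Sn_opp. ring. Qed.
Lemma cosA_per x : cosA (x + 1) = cosA x.
Proof. now rewrite !cosA_eq, Sn_per. Qed.
Lemma sinB_per k x : sinB k (x + 1) = sinB k x.
Proof. unfold sinB. now rewrite Sn_per. Qed.
Lemma sinB_sq_half k x : sinB k (x + 1 / 2) ^ 2 = sinB k x ^ 2.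
Proof. rewrite !sinB_sq, Sn_half. f_equal. ring. Qed.
Lemma sinB_sq_opp k x : sinB k (- x) ^ 2 = sinB k x ^ 2.
Proof. rewrite !sinB_sq, Sn_opp. f_equal. ring. Qed.

Lemma smooth_linear a : strip_smooth (fun _ => True) (fun x _ => a * x).
Proof. apply smooth_mult; [apply smooth_const | apply smooth_fst]. Qed.
Lemma cosA_smooth : strip_smooth (fun _ => True) (fun x _ => cosA x).
Proof. apply (smooth_sin_cos _ (fun x _ => 4 * PI * x)), smooth_linear. Qed.
Lemma sinB_smooth k : strip_smooth (fun _ => True) (fun x _ => sinB k x).
Proof.
  apply smooth_pow. apply (smooth_sin_cos _ (fun x _ => 2 * PI * x)), smooth_linear.
Qed.

Lemma cosA_primitive x : @eq R (RInt cosA 0 x) (sin (4 * PI * x) / (4 * PI)).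
Proof.
  pose proof PI_RGT_0.
  assert (D : forall y, is_derive (fun y => sin (4 * PI * y) / (4 * PI)) y (cosA y)).
  { intros y. unfold cosA. auto_derive; auto. field. lra. }
  assert (H0 : is_RInt cosA 0 x (minus (sin (4 * PI * x) / (4 * PI)) (sin (4 * PI * 0) / (4 * PI)))).
  { apply (is_RInt_derive (V := R_CompleteNormedModule) (fun y => sin (4 * PI * y) / (4 * PI))).
    - intros; apply D.
    - intros y _. apply (cont_2d_slice_l (fun x _ => cosA x) y 0).
      apply (smooth_continuity (fun _ => True)); auto. apply cosA_smooth. }
  apply (is_RInt_unique (V := R_CompleteNormedModule)) in H0. rewrite H0. unfold minus, plus, opp; simpl.
  rewrite Rmult_0_r, sin_0. field. lra.
Qed.

Lemma cosA_mean : @eq R (RInt cosA 0 1) 0.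
Proof.
  rewrite cosA_primitive. replace (4 * PI * 1) with (0 + 2 * INR 2 * PI) by (simpl; ring).
  rewrite sin_period, sin_0. unfold Rdiv; ring.
Qed.

Lemma Sn_lower x : 0 <= x <= 1 / 4 -> x <= Sn x.
Proof.
  intros Hx. pose proof PI2_3_2. pose proof PI_RGT_0.
  assert (B1 : 2 * PI * x <= PI / 2) by (replace (PI / 2) with (2 * PI * (1 / 4)) by field;
    apply Rmult_le_compat_l; lra).
  assert (B0 : 0 <= 2 * PI * x) by (apply Rmult_le_pos; lra).
  assert (2 * 2 * x <= 2 * PI * x) by (apply Rmult_le_compat_r; lra).
  apply Rle_trans with (2 * PI * x / 4); [lra|]. apply sin_ge_linear. lra.
Qed.

Lemma Sn_upper x : 0 <= x -> Rabs (Sn x) <= 8 * x.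
Proof.
  intros [Hx|<-].
  - unfold Sn. pose proof PI_4. pose proof PI_RGT_0.
    assert (0 < 2 * PI * x) by (apply Rmult_lt_0_compat; lra).
    assert (2 * PI * x <= 8 * x) by (apply Rmult_le_compat_r; lra).
    pose proof (sin_lt_x (2 * PI * x) ltac:(lra)).
    pose proof (sin_lt_x (2 * PI * x) ltac:(lra)).
    apply Rabs_le. split; [|lra].
    destruct (Rle_lt_dec 0 (sin (2 * PI * x))); [lra|].
    (* beyond the half period the bound 1 <= 8 x holds *)
    assert (PI < 2 * PI * x).
    { apply Rnot_le_lt. intros N. pose proof (sin_ge_0 (2 * PI * x) ltac:(lra) N). lra. }
    assert (1 / 2 < x) by (apply Rmult_lt_reg_l with (2 * PI); lra).
    pose proof (SIN_bound (2 * PI * x)). lra.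
  - unfold Sn. rewrite !Rmult_0_r, sin_0, Rabs_R0. lra.
Qed.

Lemma cosA_nonpos x : 1 / 8 <= x <= 1 / 4 -> cosA x <= 0.
Proof.
  intros Hx. pose proof PI_RGT_0. unfold cosA. apply cos_le_0.
  - replace (PI / 2) with (4 * PI * (1 / 8)) by field. apply Rmult_le_compat_l; lra.
  - apply Rle_trans with (4 * PI * (1 / 4)); [apply Rmult_le_compat_l|]; lra.
Qed.

(** Extends f past e = 1 by its left limit l, so that the joint continuity at
    e = 1 required by [dominated_limit] makes sense for f. *)
Definition left_ext (f : R -> R) (l e : R) : R := if Rlt_dec e 1 then f e else l.

Lemma left_ext_lt f l e : e < 1 -> left_ext f l e = f e.
Proof. intros He. unfold left_ext. destruct (Rlt_dec e 1); [reflexivity | lra]. Qed.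

Lemma left_ext_cont f l : filterlim f (at_left 1) (locally l) -> continuous (left_ext f l) 1.
Proof.
  intros H. apply filterlim_locally. intros eps.
  destruct (proj1 (filterlim_locally f l) H eps) as [d Hd].
  assert (E1 : left_ext f l 1 = l) by (unfold left_ext; destruct (Rlt_dec 1 1); lra).
  exists d. intros e He. rewrite E1.
  unfold left_ext. destruct (Rlt_dec e 1); [now apply Hd | apply ball_center].
Qed.

Lemma left_lim_bounded (f : R -> R) l : filterlim f (at_left 1) (locally l) ->
  exists d, 0 < d /\ forall e, 1 - d < e < 1 -> Rabs (f e) <= Rabs l + 1.
Proof.
  intros H. destruct (proj1 (filterlim_locally f l) H (mkposreal 1 Rlt_0_1)) as [d Hd].
  exists d. split; [apply d|]. intros e He.
  assert (Hb : Rabs (f e - l) < 1).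
  { apply Hd; [|lra]. change (Rabs (e - 1) < d). apply Rabs_def1; lra. }
  pose proof (Rabs_triang (f e - l) l). replace (f e - l + l) with (f e) in H0 by ring. lra.
Qed.

(** * Bounds on the Jacobian and the blow-up time *)
Section Asymptotics.
Variables (lam : R) (k : nat).
Hypothesis regime : (lam < 0 /\ k = 2%nat) \/ (1 < lam /\ k = 1%nat).

Notation Qk := (Q cosA (sinB k)).
Notation Qek := (Qe cosA (sinB k)).
Notation Wk := (Qmu lam cosA (sinB k)).
Notation Wek := (Qmu_e lam cosA (sinB k)).
Notation K0k := (K0 lam cosA (sinB k)).
Notation K1k := (K1 lam cosA (sinB k)).
Notation mk := (dlogK0 lam cosA (sinB k)).
Notation hk := (rate lam cosA (sinB k)).
Notation Fk := (strain lam cosA (sinB k)).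
Notation gk := (jac lam cosA (sinB k)).
Notation Tk := (clock lam cosA (sinB k)).
Notation Nk := (Lp_mass lam cosA (sinB k)).
Notation muk := (mu lam).

Lemma one_minus_Ae_pos x e : -1 < e < 1 -> 0 < 1 - cosA x * e.
Proof.
  intros He. pose proof (cosA_bound x).
  assert (Rabs (cosA x * e) < 1).
  { rewrite Rabs_mult. apply Rle_lt_trans with (1 * Rabs e).
    - apply Rmult_le_compat_r; [apply Rabs_pos | apply Rabs_le; lra].
    - rewrite Rmult_1_l. apply Rabs_def1; lra. }
  apply Rabs_def2 in H0. lra.
Qed.

Lemma Qk_pos x e : unitI e -> 0 < Qk x e.
Proof.
  intros He. unfold Q. pose proof (pow_lt _ 2 (one_minus_Ae_pos x e He)).
  pose proof (pow2_ge_0 (sinB k x * e)). lra.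
Qed.

Lemma Qk_lower x e : 1 / 2 <= e -> sinB k x ^ 2 / 4 <= Qk x e.
Proof.
  intros He. unfold Q. pose proof (pow2_ge_0 (1 - cosA x * e)).
  rewrite Rpow_mult_distr. pose proof (sinB_sq_le_1 k x).
  assert (1 / 4 <= e ^ 2) by (replace (1 / 4) with ((1 / 2) ^ 2) by field; apply pow_incr; lra).
  assert (sinB k x ^ 2 * (1 / 4) <= sinB k x ^ 2 * e ^ 2) by (apply Rmult_le_compat_l; lra).
  lra.
Qed.

Lemma Qk_upper x e : 0 <= e <= 1 -> Qk x e <= 5.
Proof.
  intros He. unfold Q. pose proof (cosA_bound x). pose proof (sinB_sq_le_1 k x).
  rewrite Rpow_mult_distr.
  assert (e ^ 2 <= 1) by (replace 1 with (1 ^ 2) by ring; apply pow_incr; lra).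
  assert (sinB k x ^ 2 * e ^ 2 <= 1 * 1) by (apply Rmult_le_compat; try lra; apply pow2_ge_0).
  assert (-1 <= cosA x * e <= 1).
  { apply Rabs_le_between. rewrite Rabs_mult. replace 1 with (1 * 1) by ring.
    apply Rmult_le_compat; try apply Rabs_pos; apply Rabs_le; lra. }
  assert ((1 - cosA x * e) ^ 2 <= 2 ^ 2) by (apply pow_incr; lra). lra.
Qed.

(** Cauchy-Schwarz for the vectors (A, B) and (1 - A e, B e), up to signs. *)
Lemma Qek_sq x e : Qek x e ^ 2 <= 8 * Qk x e.
Proof.
  unfold Qe, Q. set (a := 1 - cosA x * e). set (b := sinB k x * e).
  replace (-2 * cosA x * a + 2 * sinB k x ^ 2 * e) with (-2 * cosA x * a + 2 * sinB k x * b)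
    by (unfold b; ring).
  pose proof (sinB_sq_le_1 k x).
  assert (HA : cosA x ^ 2 <= 1).
  { replace 1 with (1 ^ 2) by ring. apply pow_maj_Rabs, Rabs_le, cosA_bound. }
  assert (cosA x ^ 2 * a ^ 2 <= 1 * a ^ 2) by (apply Rmult_le_compat_r; [apply pow2_ge_0 | auto]).
  assert (sinB k x ^ 2 * b ^ 2 <= 1 * b ^ 2) by (apply Rmult_le_compat_r; [apply pow2_ge_0 | lra]).
  pose proof (pow2_ge_0 (-2 * cosA x * a - 2 * sinB k x * b)). lra.
Qed.

Lemma k_pos : (0 < INR k)%R.
Proof. destruct regime as [[_ ->]|[_ ->]]; simpl; lra. Qed.

(** Integrability of Q^mu up to e = 1; for k = 1 this is where lam > 1 is
    used. *)
Lemma mu_gt : -1 < 2 * INR k * muk.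
Proof.
  unfold mu. destruct regime as [[H ->]|[H ->]]; simpl.
  - assert (0 < / - lam) by (apply Rinv_0_lt_compat; lra).
    replace (2 * (1 + 1) * (-1 / (2 * lam))) with (2 * / - lam) by (field; lra). lra.
  - assert (/ lam < / 1) by (apply Rinv_lt_contravar; lra). rewrite Rinv_1 in H0.
    replace (2 * 1 * (-1 / (2 * lam))) with (- / lam) by (field; lra). lra.
Qed.

Lemma lam_neq0 : lam <> 0.
Proof. destruct regime as [[H _]|[H _]]; lra. Qed.

(** Since sin (2 PI x) >= x on [0, 1/4], a lower bound for Q uniform in e is
    x^(2k) / 4. *)
Lemma Qk_pow_dom s : -1 < 2 * INR k * s -> exists C r, 0 <= C /\ 0 < r < 1 /\
  forall e x, 1 / 2 <= e <= 1 -> 0 < x <= 1 / 4 -> Rpower (Qk x e) s <= C * Rpower x (- r).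
Proof.
  intros Hs. pose proof k_pos as Hk.
  (* the value 1/2 keeps r positive when the power of Q is not singular *)
  set (r := Rmax (1 / 2) (- (2 * INR k * s))).
  assert (Hr : 0 < r < 1).
  { unfold r. split; [apply Rlt_le_trans with (1/2); [lra | apply Rmax_l] | apply Rmax_lub_lt; lra]. }
  assert (Hr2 : - (2 * INR k * s) <= r) by apply Rmax_r.
  set (q := r / (2 * INR k)).
  assert (Hq : 0 < q) by (apply Rdiv_lt_0_compat; lra).
  assert (Hsq : 0 <= s + q).
  { unfold q. apply Rmult_le_reg_l with (2 * INR k); [lra|].
    replace (2 * INR k * (s + r / (2 * INR k))) with (2 * INR k * s + r) by (field; lra). lra. }
  exists (Rpower 5 (s + q) * Rpower 4 q), r. split; [|split; [exact Hr|]].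
  - left. apply Rmult_lt_0_compat; apply Rpower_pos.
  - intros e x He Hx.
    assert (HS : x <= Sn x) by (apply Sn_lower; lra).
    assert (HB : x ^ (2 * k) <= sinB k x ^ 2).
    { unfold sinB. rewrite <- pow_mult, Nat.mul_comm. apply pow_incr. lra. }
    assert (Hx2 : 0 < x ^ (2 * k)) by (apply pow_lt; lra).
    pose proof (Qk_lower x e ltac:(lra)). pose proof (Qk_upper x e ltac:(lra)).
    replace s with ((s + q) + - q) at 1 by ring. rewrite Rpower_plus.
    rewrite Rmult_assoc. apply Rmult_le_compat; try (left; apply Rpower_pos).
    + apply Rle_Rpower_l; lra.
    + apply Rle_trans with (Rpower (x ^ (2 * k) / 4) (- q)).
      * apply Rpower_anti; lra.
      * right. unfold Rdiv. rewrite <- Rpower_mult_distr by lra.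
        rewrite <- Rpower_pow, Rpower_mult by lra. rewrite Rmult_comm. f_equal.
        -- unfold Rpower. f_equal. rewrite ln_Rinv by lra. ring.
        -- f_equal. rewrite mult_INR. unfold q. simpl (INR 2). field. lra.
Qed.

Lemma Qk_mid x e : 1 / 8 <= x <= 1 / 4 -> 0 <= e -> 1 <= Qk x e.
Proof.
  intros Hx He. unfold Q. pose proof (cosA_nonpos x Hx).
  assert (0 <= - cosA x * e) by (apply Rmult_le_pos; lra).
  assert (1 ^ 2 <= (1 - cosA x * e) ^ 2) by (apply pow_incr; lra).
  pose proof (pow2_ge_0 (sinB k x * e)). lra.
Qed.

Lemma Qk_half x e : Qk (x + 1 / 2) e = Qk x e.
Proof. unfold Q. now rewrite !Rpow_mult_distr, cosA_half, sinB_sq_half. Qed.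
Lemma Qk_opp x e : Qk (- x) e = Qk x e.
Proof. unfold Q. now rewrite !Rpow_mult_distr, cosA_opp, sinB_sq_opp. Qed.
Lemma Qek_half x e : Qek (x + 1 / 2) e = Qek x e.
Proof. unfold Qe. now rewrite cosA_half, sinB_sq_half. Qed.
Lemma Qek_opp x e : Qek (- x) e = Qek x e.
Proof. unfold Qe. now rewrite cosA_opp, sinB_sq_opp. Qed.
Lemma Wk_half x e : Wk (x + 1 / 2) e = Wk x e.
Proof. unfold Qmu. now rewrite Qk_half. Qed.
Lemma Wk_opp x e : Wk (- x) e = Wk x e.
Proof. unfold Qmu. now rewrite Qk_opp. Qed.

Lemma Wk_cont e x : unitI e -> continuous (fun x => Wk x e) x.
Proof. apply Qmu_cont; auto using cosA_smooth, sinB_smooth, Qk_pos. Qed.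

(** Q depends on x through sin^2 (2 PI x) only.  On [0, 1/4] the only zero of Q
    at e = 1 is x = 0, so the estimates have a single singular point. *)
Lemma K0k_quarter e : unitI e -> K0k e = 4 * RInt (fun x => Wk x e) 0 (1 / 4).
Proof.
  intros He. apply (quarter_period (fun x => Wk x e)).
  - intros; now apply Wk_cont.
  - intros; apply Wk_half.
  - intros; apply Wk_opp.
Qed.

Lemma ri_lower (f : R -> R) a b y : 0 <= a -> a <= b -> b <= 1 ->
  (forall x, continuous f x) -> (forall x, 0 <= f x) ->
  (forall x, a < x < b -> y <= f x) -> (b - a) * y <= RInt f 0 1.
Proof.
  intros Ha Hab Hb Hc H0 Hy.
  apply Rle_trans with (RInt f a b).
  - replace ((b - a) * y) with (RInt (fun _ => y) a b : R) by (rewrite ri_const; ring).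
    apply RInt_le; auto; [apply ex_RInt_const | now apply ri_cont_all].
  - apply ri_sub; auto. now apply ri_cont_all.
Qed.

(** Lower bound for Q^mu on [1/8, 1/4], where 1 <= Q <= 5 whatever the sign of
    mu. *)
Definition wmid : R := Rmin (Rpower 1 muk) (Rpower 5 muk).

Lemma wmid_pos : 0 < wmid.
Proof. apply Rmin_pos; apply Rpower_pos. Qed.

Lemma Wk_mid x e : 1 / 8 <= x <= 1 / 4 -> 0 <= e <= 1 -> wmid <= Wk x e.
Proof.
  intros Hx He. apply Rpower_ge_min; [lra|]. split.
  - apply Qk_mid; lra.
  - now apply Qk_upper.
Qed.

(** Below by the contribution of [1/8, 1/4], above by domination. *)
Lemma K0k_bounds : exists lo hi, 0 < lo /\ 0 < hi /\
  forall e, 1 / 2 <= e < 1 -> lo <= K0k e <= hi.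
Proof.
  destruct (Qk_pow_dom muk mu_gt) as (C & r & HC & Hr & HD).
  set (hi := 4 * (C / (1 - r) * Rpower (1 / 4) (1 - r))).
  assert (Hb : forall e, 1 / 2 <= e < 1 -> wmid / 8 <= K0k e <= hi).
  { intros e He. assert (Hu : unitI e) by (unfold unitI; lra). split.
    - replace (wmid / 8) with ((1 / 4 - 1 / 8) * wmid) by field.
      apply (ri_lower (fun x => Wk x e)); try lra.
      + intros; now apply Wk_cont.
      + intros; left; apply Qmu_pos.
      + intros; apply Wk_mid; lra.
    - rewrite K0k_quarter by auto. apply Rmult_le_compat_l; [lra|].
      eapply Rle_trans; [apply Rle_abs|].
      apply (integrable_tail (fun x => Wk x e)); auto; try lra.
      + intros; now apply Wk_cont.
      + intros x Hx. rewrite Rabs_right by (left; apply Qmu_pos).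
        apply HD; lra. }
  exists (wmid / 8), hi. pose proof wmid_pos. split; [lra|]. split; auto.
  pose proof (Hb (1 / 2) ltac:(lra)). lra.
Qed.

Lemma hk_bounds : exists lo, 0 < lo /\ forall e, 1 / 2 <= e < 1 -> lo <= hk e.
Proof.
  destruct K0k_bounds as (lo & hi & Hlo & Hhi & HK).
  exists (Rmin (Rpower lo (-2 * lam)) (Rpower hi (-2 * lam))). split.
  - apply Rmin_pos; apply Rpower_pos.
  - intros e He. apply Rpower_ge_min; auto.
Qed.

Lemma Tk_bounded : exists M, forall e, 0 <= e < 1 -> Tk e <= M.
Proof.
  destruct hk_bounds as (lo & Hlo & Hh).
  assert (Hinc : forall e1 e2, -1 < e1 -> e1 < e2 -> e2 < 1 -> Tk e1 < Tk e2).
  { apply clock_incr; auto using cosA_smooth, sinB_smooth, Qk_pos. }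
  exists (Tk (1 / 2) + / lo). intros e He.
  assert (Hi : 0 < / lo) by now apply Rinv_0_lt_compat.
  destruct (Rle_lt_dec e (1 / 2)) as [H|H].
  - destruct (Req_dec e (1 / 2)) as [->|Hn]; [lra|].
    pose proof (Hinc e (1 / 2) ltac:(lra) ltac:(lra) ltac:(lra)). lra.
  - assert (DT : forall z, unitI z -> is_derive Tk z (/ hk z)).
    { apply der_clock; auto using cosA_smooth, sinB_smooth, Qk_pos. }
    destruct (MVT_gen Tk (1 / 2) e (fun z => / hk z)) as [z [Hz E]].
    + rewrite Rmin_left, Rmax_right by lra. intros z Hz. apply DT. unfold unitI; lra.
    + rewrite Rmin_left, Rmax_right by lra. intros z Hz.
      apply continuity_pt_filterlim, (der_continuous _ _ (/ hk z)), DT. unfold unitI; lra.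
    + rewrite Rmin_left, Rmax_right in Hz by lra.
      assert (/ hk z <= / lo) by (apply Rinv_le_contravar; [auto | apply Hh; lra]).
      assert (0 < / hk z) by (apply Rinv_0_lt_compat, exp_pos).
      assert (/ hk z * (e - 1 / 2) <= / lo * 1) by (apply Rmult_le_compat; lra). lra.
Qed.

(** The clock is increasing on [0, 1) and bounded, because its derivative
    1 / rate is a power of K0. *)
Lemma blowup_time : exists ts, (forall e, 0 <= e < 1 -> Tk e < ts) /\
  (forall t, t < ts -> exists e, 0 <= e < 1 /\ t < Tk e).
Proof.
  destruct Tk_bounded as [M HM].
  destruct (completeness (fun t => exists e, 0 <= e < 1 /\ t = Tk e)) as [ts [Hub Hl]].
  - exists M. intros t (e & He & ->). now apply HM.
  - exists (Tk 0), 0. split; [lra | reflexivity].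
  - exists ts. split.
    + intros e He. apply Rlt_le_trans with (Tk ((e + 1) / 2)).
      * apply (clock_incr lam cosA (sinB k) cosA_smooth (sinB_smooth k) Qk_pos); lra.
      * apply Hub. exists ((e + 1) / 2). split; [lra | reflexivity].
    + intros t Ht. apply NNPP. intros N.
      apply (Rlt_not_le _ _ Ht), Hl. intros s (e & He & ->).
      apply Rnot_lt_le. intros L. apply N. now exists e.
Qed.

(** * Lower bound for the L^p norms *)
(** In the neighbourhood of the zeros of rho0 described by the hypotheses, Q is
    comparable with (1 - e)^2 and Qe / Q with - 1 / (1 - e). *)
Lemma near_zero x e : 1 / 2 <= e < 1 -> Sn x ^ 2 <= (1 - e) / 16 ->
  sinB k x ^ 2 <= (1 - e) ^ 2 / 16 ->
  (1 - e) ^ 2 <= Qk x e <= 2 * (1 - e) ^ 2 /\ 1 - e <= - Qek x e.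
Proof.
  intros He HS HB. unfold Q, Qe. rewrite cosA_eq.
  set (y := Sn x ^ 2) in *. set (b := sinB k x ^ 2) in *. set (d := 1 - e) in *.
  assert (Hy : 0 <= y) by apply Sn_sq_le_1. assert (Hb : 0 <= b) by apply sinB_sq_le_1.
  assert (Hd : 0 < d <= 1 / 2) by (unfold d; lra).
  replace e with (1 - d) in * by (unfold d; ring). clearbody d.
  rewrite Rpow_mult_distr. fold b.
  set (z := 1 - (1 - 2 * y) * (1 - d)).
  assert (Hz : d <= z <= d + d / 8).
  { unfold z. assert (0 <= y * (1 - d)) by (apply Rmult_le_pos; lra).
    assert (y * (1 - d) <= d / 16 * 1) by (apply Rmult_le_compat; lra). lra. }
  assert (Hz2 : d ^ 2 <= z ^ 2 <= (d + d / 8) ^ 2) by (split; apply pow_incr; lra).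
  assert (He2 : 0 <= (1 - d) ^ 2 <= 1).
  { split; [apply pow2_ge_0|]. replace 1 with (1 ^ 2) at 2 by ring. apply pow_incr; lra. }
  assert (Hbe : 0 <= b * (1 - d) ^ 2 <= d ^ 2 / 16 * 1).
  { split; [apply Rmult_le_pos; lra | apply Rmult_le_compat; lra]. }
  split; [split|].
  - lra.
  - pose proof (pow2_ge_0 d). replace ((d + d / 8) ^ 2) with (81 / 64 * d ^ 2) in Hz2 by field. lra.
  - assert (H1 : (7 / 8) * d <= (1 - 2 * y) * z) by (apply Rmult_le_compat; lra).
    assert (H2 : b * (1 - d) <= d ^ 2 / 16 * 1).
    { apply Rmult_le_compat; lra. }
    assert (H3 : d ^ 2 <= d * (1 / 2)) by (simpl; rewrite Rmult_1_r; apply Rmult_le_compat_l; lra).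
    lra.
Qed.

(** The scale on which B^2 = sin (2 PI x)^(2k) is comparable with (1 - e)^2; the
    divisor 32 provides the small constants of [near_zero]. *)
Definition width (d : R) : R := Rpower d (/ INR k) / 32.

Lemma near_zero_width x e : 1 / 2 <= e < 1 -> 0 <= x <= width (1 - e) ->
  Sn x ^ 2 <= (1 - e) / 16 /\ sinB k x ^ 2 <= (1 - e) ^ 2 / 16.
Proof.
  intros He Hx. set (d := 1 - e) in *. assert (Hd : 0 < d <= 1 / 2) by (unfold d; lra).
  unfold width in Hx. set (z := Rpower d (/ INR k)) in *.
  assert (Hz0 : 0 < z) by apply Rpower_pos.
  assert (Hzk : z ^ k = d).
  { unfold z. rewrite <- Rpower_pow by apply Rpower_pos. rewrite Rpower_mult, Rinv_l, Rpower_1; try lra.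
    pose proof k_pos; lra. }
  assert (HS : Sn x ^ 2 <= z ^ 2 / 16).
  { replace (z ^ 2 / 16) with ((z / 4) ^ 2) by field. apply pow_maj_Rabs.
    eapply Rle_trans; [apply Sn_upper; lra|]. lra. }
  rewrite sinB_sq. pose proof (Sn_sq_le_1 x) as H01.
  destruct regime as [[_ Hk]|[_ Hk]]; rewrite Hk in Hzk |- *.
  - rewrite Hzk in HS. split; [exact HS|].
    apply Rle_trans with ((d / 16) ^ 2); [apply pow_incr; lra|].
    pose proof (pow2_ge_0 d). replace ((d / 16) ^ 2) with (d ^ 2 / 256) by field. lra.
  - rewrite pow_1 in Hzk. rewrite Hzk in HS. rewrite pow_1. split; [|exact HS].
    assert (d ^ 2 <= d * 1) by (simpl; apply Rmult_le_compat_l; lra). lra.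
Qed.

Lemma Rpower_sq d s : 0 < d -> Rpower (d ^ 2) s = Rpower d (2 * s).
Proof. intros Hd. rewrite <- Rpower_pow by auto. rewrite Rpower_mult. f_equal. Qed.

(** Lower bound for the power mu of Q / (1 - e)^2, which lies between 1 and 2. *)
Definition wnear : R := Rmin 1 (Rpower 2 muk).

Lemma Wk_near x e : 1 / 2 <= e < 1 -> 0 <= x <= width (1 - e) ->
  Rpower (1 - e) (2 * muk) * wnear <= Wk x e.
Proof.
  intros He Hx. destruct (near_zero_width x e He Hx) as [H1 H2].
  destruct (near_zero x e He H1 H2) as [HQ _].
  assert (Hd : 0 < 1 - e) by lra. assert (Hd2 : 0 < (1 - e) ^ 2) by now apply pow_lt.
  eapply Rle_trans; [|apply (Rpower_ge_min (Qk x e) ((1 - e) ^ 2) (2 * (1 - e) ^ 2)); auto].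
  rewrite <- Rpower_mult_distr by lra. rewrite !Rpower_sq by auto.
  pose proof (Rpower_pos (1 - e) (2 * muk)).
  apply Rmin_glb.
  - rewrite <- (Rmult_1_r (Rpower (1 - e) (2 * muk))) at 2.
    apply Rmult_le_compat_l; [lra | apply Rmin_l].
  - rewrite Rmult_comm. apply Rmult_le_compat_r; [lra | apply Rmin_r].
Qed.

Lemma mu_neq0 : muk <> 0.
Proof.
  unfold mu. pose proof lam_neq0. apply Rmult_integral_contrapositive_currified; [lra|].
  apply Rinv_neq_0_compat. lra.
Qed.

(** In strain = rate (mu Qe/Q - dlogK0) the first term is of order 1 / (1 - e)
    near x = 0 and bounded on [1/8, 1/4].  As dlogK0 does not depend on x, it
    can compensate neither a large value by being small, nor a bounded one by
    being large; the two alternatives are these two cases. *)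
Lemma strain_large lo e : 0 < lo -> 23 / 24 <= e < 1 -> lo <= hk e ->
  (forall x, 0 <= x <= width (1 - e) -> lo * Rabs muk / 8 / (1 - e) <= Rabs (Fk x e)) \/
  (forall x, 1 / 8 <= x <= 1 / 4 -> lo * Rabs muk / 8 / (1 - e) <= Rabs (Fk x e)).
Proof.
  intros Hlo He Hh. set (d := 1 - e) in *. assert (Hd : 0 < d <= 1 / 24) by (unfold d; lra).
  assert (Hmu : 0 < Rabs muk) by apply Rabs_pos_lt, mu_neq0.
  assert (Hi : 24 <= / d).
  { replace 24 with (/ (1 / 24)) by field. apply Rinv_le_contravar; lra. }
  assert (Red : forall x, Rabs muk / (8 * d) <= Rabs (muk * (Qek x e / Qk x e) - mk e) ->
    lo * Rabs muk / 8 / d <= Rabs (Fk x e)).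
  { intros x Hx. unfold strain. rewrite Rabs_mult, (Rabs_right (hk e)) by (left; apply exp_pos).
    replace (lo * Rabs muk / 8 / d) with (lo * (Rabs muk / (8 * d))) by (field; lra).
    apply Rmult_le_compat; auto; try lra. left. apply Rdiv_lt_0_compat; lra. }
  assert (Hu : unitI e) by (unfold unitI, d in *; lra).
  destruct (Rle_lt_dec (Rabs (mk e)) (Rabs muk / (4 * d))) as [Hm|Hm].
  - left. intros x Hx. apply Red.
    assert (He2 : 1 / 2 <= e < 1) by lra.
    destruct (near_zero_width x e He2 Hx) as [H1 H2].
    destruct (near_zero x e He2 H1 H2) as [HQ HQe]. fold d in HQ, HQe.
    pose proof (Qk_pos x e Hu) as Qp.
    assert (Hq : / (2 * d) <= Rabs (Qek x e / Qk x e)).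
    { unfold Rdiv. rewrite Rabs_mult, (Rabs_right (/ Qk x e))
        by (left; now apply Rinv_0_lt_compat).
      replace (/ (2 * d)) with (d * / (2 * d ^ 2)) by (field; lra).
      apply Rmult_le_compat; try lra.
      - left. apply Rinv_0_lt_compat. assert (0 < d ^ 2) by (apply pow_lt; lra). lra.
      - rewrite <- Rabs_Ropp. eapply Rle_trans; [exact HQe | apply Rle_abs].
      - apply Rinv_le_contravar; [auto | apply HQ]. }
    assert (Rabs muk * / (2 * d) <= Rabs (muk * (Qek x e / Qk x e))).
    { rewrite Rabs_mult. apply Rmult_le_compat_l; lra. }
    pose proof (Rabs_triang_inv (muk * (Qek x e / Qk x e)) (mk e)).
    replace (Rabs muk * / (2 * d)) with (4 * (Rabs muk / (8 * d))) in H by (field; lra).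
    replace (Rabs muk / (4 * d)) with (2 * (Rabs muk / (8 * d))) in Hm by (field; lra).
    assert (0 < Rabs muk / (8 * d)) by (apply Rdiv_lt_0_compat; lra). lra.
  - right. intros x Hx. apply Red.
    pose proof (Qk_mid x e Hx ltac:(lra)) as Q1.
    assert (Hq : Rabs (Qek x e / Qk x e) <= 3).
    { apply Rsqr_incr_0_var; [|lra]. rewrite <- Rsqr_abs. unfold Rsqr.
      replace (Qek x e / Qk x e * (Qek x e / Qk x e)) with (Qek x e ^ 2 / Qk x e / Qk x e)
        by (field; lra).
      pose proof (Qek_sq x e).
      assert (B1 : Qek x e ^ 2 / Qk x e <= 8).
      { apply Rmult_le_reg_r with (Qk x e); [lra|].
        replace (Qek x e ^ 2 / Qk x e * Qk x e) with (Qek x e ^ 2) by (field; lra). lra. }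
      apply Rmult_le_reg_r with (Qk x e); [lra|].
      replace (Qek x e ^ 2 / Qk x e / Qk x e * Qk x e) with (Qek x e ^ 2 / Qk x e) by (field; lra).
      lra. }
    assert (Rabs (muk * (Qek x e / Qk x e)) <= Rabs muk * 3).
    { rewrite Rabs_mult. apply Rmult_le_compat_l; lra. }
    pose proof (Rabs_triang_inv (mk e) (muk * (Qek x e / Qk x e))).
    rewrite (Rabs_minus_sym (mk e)) in H0.
    replace (Rabs muk / (4 * d)) with (2 * (Rabs muk / (8 * d))) in Hm by (field; lra).
    assert (Rabs muk * 3 <= Rabs muk / (8 * d)).
    { replace (Rabs muk / (8 * d)) with (Rabs muk * (/ d / 8)) by (field; lra).
      apply Rmult_le_compat_l; lra. }
    lra.
Qed.

Lemma Lp_mass_integrand_cont p e x : 0 < p -> unitI e ->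
  continuous (fun x => powR (Rabs (Fk x e)) p * gk x e) x.
Proof.
  intros Hp He. apply (continuous_mult (K := R_AbsRing) (fun x => powR (Rabs (Fk x e)) p)).
  - apply (continuous_comp (fun x => Fk x e) (fun y => powR (Rabs y) p)).
    + apply strain_cont; auto using cosA_smooth, sinB_smooth, Qk_pos.
    + now apply powR_continuous.
  - apply jac_cont; auto using cosA_smooth, sinB_smooth, Qk_pos.
Qed.

Lemma Lp_mass_nonneg p e : 0 < p -> unitI e -> 0 <= Nk p e.
Proof.
  intros Hp He. apply RInt_ge_0; [lra | |].
  - apply ri_cont_all. intros; now apply Lp_mass_integrand_cont.
  - intros x _. apply Rmult_le_pos; [apply powR_ge_0|].
    left. apply jac_pos; auto using cosA_smooth, sinB_smooth, Qk_pos.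
Qed.

Lemma width_bound d : 0 < d <= 1 -> 0 < width d <= 1.
Proof.
  intros Hd. unfold width. pose proof (Rpower_pos d (/ INR k)).
  assert (Rpower d (/ INR k) <= Rpower 1 (/ INR k)).
  { apply Rle_Rpower_l; [|lra]. left; apply Rinv_0_lt_compat, k_pos. }
  assert (E1 : Rpower 1 (/ INR k) = 1) by (unfold Rpower; now rewrite ln_1, Rmult_0_r, exp_0).
  lra.
Qed.

(** The two powers come from the two alternatives of [strain_large]: the integrand
    is at least of order (1 - e)^(-p) on [1/8, 1/4], or of order
    (1 - e)^(-p + 2 mu) on an interval of length [width]. *)
Lemma Lp_mass_lower p : 0 < p -> exists C, 0 < C /\ forall e, 23 / 24 <= e < 1 ->
  C * Rmin (Rpower (1 - e) (- p)) (Rpower (1 - e) (- p + 2 * muk + / INR k)) <= Nk p e.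
Proof.
  intros Hp. destruct hk_bounds as (lo & Hlo & Hh).
  destruct K0k_bounds as (klo & khi & Hklo & Hkhi & HK).
  assert (Hmu : 0 < Rabs muk) by apply Rabs_pos_lt, mu_neq0.
  set (R0 := lo * Rabs muk / 8).
  assert (HR0 : 0 < R0) by (unfold R0; apply Rdiv_lt_0_compat; [now apply Rmult_lt_0_compat | lra]).
  assert (Hwn : 0 < wnear) by (apply Rmin_pos; [lra | apply Rpower_pos]).
  pose proof wmid_pos as Hwm.
  set (C1 := Rpower R0 p * (wmid / khi) / 8).
  set (C2 := Rpower R0 p * (wnear / khi) / 32).
  assert (P0 : 0 < Rpower R0 p) by apply Rpower_pos.
  assert (HC1 : 0 < C1).
  { unfold C1. apply Rdiv_lt_0_compat; [|lra]. apply Rmult_lt_0_compat; auto. now apply Rdiv_lt_0_compat. }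
  assert (HC2 : 0 < C2).
  { unfold C2. apply Rdiv_lt_0_compat; [|lra]. apply Rmult_lt_0_compat; auto. now apply Rdiv_lt_0_compat. }
  exists (Rmin C1 C2). split; [now apply Rmin_pos|].
  intros e He. set (d := 1 - e) in *. assert (Hd : 0 < d <= 1) by (unfold d; lra).
  assert (Hu : unitI e) by (unfold unitI, d in *; lra).
  assert (HKe := HK e ltac:(lra)).
  assert (HW : forall x y, 0 < y -> y <= Wk x e -> y / khi <= gk x e).
  { intros x y Hy HW. unfold jac. apply Rmult_le_compat; try lra.
    - left; now apply Rinv_0_lt_compat.
    - apply Rinv_le_contravar; lra. }
  assert (HF : forall x, R0 / d <= Rabs (Fk x e) ->
     Rpower R0 p * Rpower d (- p) <= powR (Rabs (Fk x e)) p).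
  { intros x Hx. assert (Hrd : 0 < R0 / d) by (apply Rdiv_lt_0_compat; lra).
    replace (Rpower R0 p * Rpower d (- p)) with (Rpower (R0 / d) p).
    - rewrite <- (powR_pos (R0 / d)) by auto. apply powR_le; lra.
    - unfold Rdiv. rewrite <- Rpower_mult_distr by (auto; apply Rinv_0_lt_compat; lra).
      f_equal. unfold Rpower. f_equal. rewrite ln_Rinv by lra. ring. }
  assert (Hpos : forall x, 0 <= powR (Rabs (Fk x e)) p * gk x e).
  { intros x. apply Rmult_le_pos; [apply powR_ge_0|]. left. apply Rdiv_lt_0_compat; [apply Qmu_pos | lra]. }
  assert (Pd : 0 < Rpower d (- p)) by apply Rpower_pos.
  pose proof (Rmin_l C1 C2). pose proof (Rmin_r C1 C2).
  set (X1 := Rpower d (- p)) in *. set (X2 := Rpower d (- p + 2 * muk + / INR k)).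
  assert (PX2 : 0 < X2) by apply Rpower_pos.
  assert (Pmin : 0 < Rmin X1 X2) by now apply Rmin_pos.
  destruct (strain_large lo e Hlo He (Hh e ltac:(lra))) as [HN|HM].
  - apply Rle_trans with (C2 * X2).
    { apply Rmult_le_compat; try lra; [|apply Rmin_r]. left; now apply Rmin_pos. }
    destruct (width_bound d Hd) as [Hw0 Hw1].
    replace (C2 * X2) with ((width d - 0) *
      (Rpower R0 p * X1 * (Rpower d (2 * muk) * wnear / khi))).
    + apply (ri_lower (fun x => powR (Rabs (Fk x e)) p * gk x e)); try lra; auto.
      * intros; now apply Lp_mass_integrand_cont.
      * intros x Hx. apply Rmult_le_compat.
        -- apply Rmult_le_pos; lra.
        -- left. apply Rdiv_lt_0_compat; auto. apply Rmult_lt_0_compat; auto. apply Rpower_pos.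
        -- apply HF, HN. fold d; lra.
        -- apply HW; [apply Rmult_lt_0_compat; auto; apply Rpower_pos|].
           apply Wk_near; [lra|]. fold d; lra.
    + unfold C2, X2, X1, width. rewrite !Rpower_plus. field. lra.
  - apply Rle_trans with (C1 * X1).
    { apply Rmult_le_compat; try lra; [|apply Rmin_l]. left; now apply Rmin_pos. }
    replace (C1 * X1) with ((1 / 4 - 1 / 8) * (Rpower R0 p * X1 * (wmid / khi))).
    + apply (ri_lower (fun x => powR (Rabs (Fk x e)) p * gk x e)); try lra; auto.
      * intros; now apply Lp_mass_integrand_cont.
      * intros x Hx. apply Rmult_le_compat.
        -- apply Rmult_le_pos; lra.
        -- left. now apply Rdiv_lt_0_compat.
        -- apply HF, HM. lra.
        -- apply HW; auto. apply Wk_mid; lra.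
    + unfold C1. field. lra.
Qed.

Lemma Lp_mass_blowup p : 1 < p -> (lam <= - 2 / p \/ 1 < lam) ->
  filterlim (Nk p) (at_left 1) (Rbar_locally p_infty).
Proof.
  intros Hp Hcase.
  assert (Hs : - p + 2 * muk + / INR k < 0).
  { unfold mu. destruct regime as [[H ->]|[H ->]]; simpl.
    - destruct Hcase as [Hc|Hc]; [|lra].
      (* in terms of 1 / |lam| the hypothesis reads 1 / |lam| <= p / 2 *)
      assert (H1 : / - lam <= p / 2).
      { replace (p / 2) with (/ (2 / p)) by (field; lra). apply Rinv_le_contravar.
        - apply Rdiv_lt_0_compat; lra.
        - replace (- 2 / p) with (- (2 / p)) in Hc by (field; lra). lra. }
      replace (2 * (-1 / (2 * lam))) with (/ - lam) by (field; lra). lra.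
    - assert (0 < / lam) by (apply Rinv_0_lt_compat; lra).
      replace (2 * (-1 / (2 * lam))) with (- / lam) by (field; lra). rewrite Rinv_1. lra. }
  set (s := - p + 2 * muk + / INR k) in *.
  set (q := Rmin p (- s)). assert (Hq : 0 < q) by (apply Rmin_pos; lra).
  destruct (Lp_mass_lower p ltac:(lra)) as (C & HC & HN). fold s in HN.
  intros P0 [M HM].
  (* C d^-q > M as soon as d^q < C / (|M| + 1) *)
  assert (HM1 : 0 < Rabs M + 1) by (pose proof (Rabs_pos M); lra).
  destruct (Rpower_small q (C / (Rabs M + 1)) Hq ltac:(now apply Rdiv_lt_0_compat)) as (d0 & Hd0 & Hsm).
  apply (at_left_intro _ 1 (Rmin d0 (1 / 24))); [apply Rmin_pos; lra|].
  intros e He. pose proof (Rmin_l d0 (1/24)). pose proof (Rmin_r d0 (1/24)).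
  apply HM. eapply Rlt_le_trans; [|apply HN; lra].
  set (d := 1 - e). assert (Hd : 0 < d <= 1 / 24) by (unfold d; lra).
  assert (Hdq : Rpower d q < C / (Rabs M + 1)) by (apply Hsm; unfold d; lra).
  assert (Hmin : Rpower d (- q) <= Rmin (Rpower d (- p)) (Rpower d s)).
  { assert (K : forall a, a <= - q -> Rpower d (- q) <= Rpower d a).
    { intros a Ha. unfold Rpower.
      assert (ln d <= 0) by (rewrite <- ln_1; apply ln_le; lra).
      assert (0 <= (- q - a) * - ln d) by (apply Rmult_le_pos; lra).
      destruct (Req_dec (- q * ln d) (a * ln d)) as [->|Hn]; [lra|].
      left. apply exp_increasing. lra. }
    pose proof (Rmin_l p (- s)). pose proof (Rmin_r p (- s)). fold q in H1, H2.
    apply Rmin_glb; apply K; lra. }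
  assert (Pq : 0 < Rpower d q) by apply Rpower_pos.
  apply Rlt_le_trans with (C * Rpower d (- q)); [|apply Rmult_le_compat_l; lra].
  rewrite Rpower_Ropp.
  apply Rle_lt_trans with (Rabs M); [apply Rle_abs|].
  apply Rmult_lt_reg_r with (Rpower d q); auto.
  rewrite Rmult_assoc, Rinv_l, Rmult_1_r by lra.
  apply Rle_lt_trans with ((Rabs M + 1) * Rpower d q); [apply Rmult_le_compat_r; lra|].
  replace C with ((Rabs M + 1) * (C / (Rabs M + 1))) by (field; lra).
  apply Rmult_lt_compat_l; auto.
Qed.

(** * Convergence of the L^p norms *)
Lemma Qk_cont_2d x e : continuity_2d_pt Qk x e.
Proof.
  apply (smooth_continuity (fun _ => True)); auto. unfold Q.
  pose proof cosA_smooth. pose proof (sinB_smooth k).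
  apply smooth_plus; apply smooth_pow; [apply smooth_minus|]; try apply smooth_mult;
    auto using smooth_const, smooth_snd.
Qed.

Lemma Qek_cont_2d x e : continuity_2d_pt Qek x e.
Proof.
  apply (smooth_continuity (fun _ => True)); auto. unfold Qe.
  pose proof cosA_smooth. pose proof (sinB_smooth k).
  apply smooth_plus.
  - apply smooth_mult; [|apply smooth_minus; [apply smooth_const|]]; apply smooth_mult;
      auto using smooth_const, smooth_snd.
  - apply smooth_mult; [apply smooth_mult|]; auto using smooth_const, smooth_snd, smooth_pow.
Qed.

Lemma Qk_pos_1 x : 0 < x <= 1 / 4 -> 0 < Qk x 1.
Proof.
  intros Hx. pose proof (Qk_lower x 1 ltac:(lra)).
  assert (0 < sinB k x ^ 2).
  { unfold sinB. apply pow_lt, pow_lt. pose proof (Sn_lower x ltac:(lra)). lra. }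
  lra.
Qed.

Lemma ratio_cont_2d x : 0 < x <= 1 / 4 -> continuity_2d_pt (fun x e => Qek x e / Qk x e) x 1.
Proof.
  intros Hx. apply continuity_2d_pt_mult; [apply Qek_cont_2d|].
  apply continuity_2d_pt_inv; [apply Qk_cont_2d|]. pose proof (Qk_pos_1 x Hx). lra.
Qed.

Lemma Wk_cont_2d x : 0 < x <= 1 / 4 -> continuity_2d_pt Wk x 1.
Proof.
  intros Hx. apply (continuity_1d_2d_pt_comp (fun y => Rpower y muk) Qk).
  - apply continuity_pt_filterlim.
    apply (der_continuous _ _ _ (der_Rpower (Qk x 1) muk (Qk_pos_1 x Hx))).
  - apply Qk_cont_2d.
Qed.

(** From [Qek_sq]; the constant 3 is a rounding of sqrt 8. *)
Lemma ratio_bound x e : unitI e -> Rabs (Qek x e / Qk x e) <= 3 * Rpower (Qk x e) (- / 2).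
Proof.
  intros He. pose proof (Qk_pos x e He) as HQ.
  pose proof (Rpower_pos (Qk x e) (- / 2)) as Hp.
  apply Rsqr_incr_0_var; [|lra]. rewrite <- Rsqr_abs. unfold Rsqr.
  replace (3 * Rpower (Qk x e) (- / 2) * (3 * Rpower (Qk x e) (- / 2))) with (9 * / Qk x e).
  - replace (Qek x e / Qk x e * (Qek x e / Qk x e)) with (Qek x e ^ 2 / Qk x e * / Qk x e)
      by (field; lra).
    apply Rmult_le_compat_r; [left; now apply Rinv_0_lt_compat|].
    apply Rmult_le_reg_r with (Qk x e); [lra|].
    replace (Qek x e ^ 2 / Qk x e * Qk x e) with (Qek x e ^ 2) by (field; lra).
    pose proof (Qek_sq x e). lra.
  - replace (3 * Rpower (Qk x e) (- / 2) * (3 * Rpower (Qk x e) (- / 2))) with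
      (9 * (Rpower (Qk x e) (- / 2) * Rpower (Qk x e) (- / 2))) by ring.
    rewrite <- Rpower_plus. replace (- / 2 + - / 2) with (- (1)) by lra.
    rewrite Rpower_Ropp, Rpower_1; auto.
Qed.

Section Convergence.
Variable p : R.
Hypothesis p_ge_1 : 1 <= p.
(** Integrability of Q^(mu - p/2), which behaves as a power of x^(2k) at
    e = 1. *)
Hypothesis integrable : -1 < 2 * INR k * (muk - p / 2).

Lemma K0k_lim : exists l, 0 < l /\ filterlim K0k (at_left 1) (locally l).
Proof.
  destruct (Qk_pow_dom muk mu_gt) as (C & r & HC & Hr & HD).
  destruct (dominated_limit Wk (1 / 4) r C (1 / 2)) as [l Hl]; try lra.
  - apply Wk_cont_2d.
  - intros e x He _. apply Wk_cont. unfold unitI; lra.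
  - intros e x He Hx. rewrite Rabs_right by (left; apply Qmu_pos). apply HD; lra.
  - assert (L : filterlim K0k (at_left 1) (locally (4 * l))).
    { apply filterlim_ext_loc with (fun e => 4 * RInt (fun x => Wk x e) 0 (1 / 4)).
      - apply (at_left_intro _ 1 1); [lra|]. intros e He. symmetry. apply K0k_quarter.
        unfold unitI; lra.
      - eapply filterlim_comp; [exact Hl|]. apply (der_continuous (fun y => 4 * y) l 4).
        auto_derive; auto. ring. }
    exists (4 * l). split; auto.
    destruct K0k_bounds as (lo & hi & Hlo & Hhi & HK).
    apply Rlt_le_trans with lo; auto.
    apply (filterlim_le (F := at_left 1) (fun _ => lo) K0k lo (4 * l)); auto.
    + apply (at_left_intro _ 1 (1 / 2)); [lra|]. intros; apply HK; lra.
    + apply filterlim_const.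
Qed.

(** The integrand is bounded by a multiple of Q^(mu - 1/2), which is integrable
    because p >= 1. *)
Lemma K1k_lim : exists l : R, filterlim K1k (at_left 1) (locally l).
Proof.
  assert (Hs : -1 < 2 * INR k * (muk - / 2)).
  { pose proof k_pos. assert (0 <= INR k * (p - 1)) by (apply Rmult_le_pos; lra). lra. }
  destruct (Qk_pow_dom _ Hs) as (C & r & HC & Hr & HD).
  destruct (dominated_limit Wek (1 / 4) r (Rabs muk * 3 * C) (1 / 2)) as [l Hl]; try lra.
  - pose proof (Rabs_pos muk). apply Rmult_le_pos; lra.
  - intros x Hx. unfold Qmu_e. apply continuity_2d_pt_mult; [|now apply Wk_cont_2d].
    apply continuity_2d_pt_mult; [apply continuity_2d_pt_const | now apply ratio_cont_2d].
  - intros e x He _. apply Qmu_e_cont; auto using cosA_smooth, sinB_smooth, Qk_pos.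
    unfold unitI; lra.
  - intros e x He Hx. assert (Hu : unitI e) by (unfold unitI; lra).
    unfold Qmu_e. rewrite !Rabs_mult, (Rabs_right (Wk x e)) by (left; apply Qmu_pos).
    pose proof (ratio_bound x e Hu) as Hb. rewrite <- Rabs_mult in *.
    pose proof (HD e x ltac:(lra) Hx) as HD'. unfold Rminus in HD'. rewrite Rpower_plus in HD'.
    fold (Wk x e) in HD'. rewrite Rabs_mult.
    pose proof (Rabs_pos muk). pose proof (Qmu_pos lam cosA (sinB k) x e) as HW.
    apply Rle_trans with (Rabs muk * (3 * Rpower (Qk x e) (- / 2)) * Wk x e).
    + apply Rmult_le_compat_r; [lra|]. now apply Rmult_le_compat_l.
    + apply Rle_trans with (Rabs muk * 3 * (Wk x e * Rpower (Qk x e) (- / 2))).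
      * right. ring.
      * rewrite (Rmult_assoc (Rabs muk * 3)). apply Rmult_le_compat_l; [lra | exact HD'].
  - exists (4 * l).
    apply filterlim_ext_loc with (fun e => 4 * RInt (fun x => Wek x e) 0 (1 / 4)).
    + apply (at_left_intro _ 1 1); [lra|]. intros e He. symmetry.
      apply (quarter_period (fun x => Wek x e)).
      * intros; apply Qmu_e_cont; auto using cosA_smooth, sinB_smooth, Qk_pos. unfold unitI; lra.
      * intros x. unfold Qmu_e. now rewrite Qek_half, Qk_half, Wk_half.
      * intros x. unfold Qmu_e. now rewrite Qek_opp, Qk_opp, Wk_opp.
    + eapply filterlim_comp; [exact Hl|]. apply (der_continuous (fun y => 4 * y) l 4).
      auto_derive; auto. ring.
Qed.

Lemma hk_mk_lim : exists lh lm : R,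
  filterlim hk (at_left 1) (locally lh) /\ filterlim mk (at_left 1) (locally lm).
Proof.
  destruct K0k_lim as (l0 & Hl0 & HK0). destruct K1k_lim as (l1 & HK1).
  exists (Rpower l0 (-2 * lam)), (l1 * / l0). split.
  - apply (filterlim_comp _ _ _ K0k (fun y => Rpower y (-2 * lam)) (at_left 1) (locally l0));
      [exact HK0|].
    apply (der_continuous _ _ _ (der_Rpower l0 (-2 * lam) Hl0)).
  - unfold dlogK0, Rdiv.
    eapply (filterlim_comp_2 (F := at_left 1) K1k (fun e => / K0k e) Rmult).
    + exact HK1.
    + apply (filterlim_comp _ _ _ K0k (fun y => / y) (at_left 1) (locally l0)); [exact HK0|].
      apply (der_continuous _ _ _ (der_inv (fun y => y) l0 1 (Rgt_not_eq _ _ Hl0) (der_id l0))).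
    + apply (filterlim_mult (K := R_AbsRing)).
Qed.

(** Since rate and dlogK0 have limits, |strain| is at most a multiple of
    Q^(-1/2), and the integrand at most a multiple of Q^(mu - p/2). *)
Lemma Lp_mass_converges : exists l : R, 0 <= l /\ filterlim (Nk p) (at_left 1) (locally l).
Proof.
  destruct K0k_lim as (l0 & Hl0 & HK0). destruct hk_mk_lim as (lh & lm & Hh & Hm).
  destruct (left_lim_bounded _ _ Hh) as (d1 & Hd1 & Bh).
  destruct (left_lim_bounded _ _ Hm) as (d2 & Hd2 & Bm).
  destruct K0k_bounds as (klo & khi & Hklo & _ & HK).
  destruct (Qk_pow_dom _ integrable) as (C & r & HC & Hr & HD).
  set (K := left_ext K0k l0). set (H := left_ext hk lh). set (M := left_ext mk lm).
  set (f := fun x e => powR (Rabs (H e * (muk * (Qek x e / Qk x e) - M e))) p * (Wk x e / K e)).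
  assert (Ef : forall x e, e < 1 -> f x e = powR (Rabs (Fk x e)) p * gk x e).
  { intros x e He. unfold f, strain, jac, H, M, K. now rewrite !left_ext_lt. }
  set (c3 := Rpower 5 (/ 2)).
  assert (Hc3 : 0 < c3) by apply Rpower_pos.
  (* |strain| <= D Q^(-1/2) *)
  set (D := (Rabs lh + 1) * (Rabs muk * 3 + (Rabs lm + 1) * c3)).
  assert (HD0 : 0 < D).
  { unfold D. pose proof (Rabs_pos lh); pose proof (Rabs_pos lm); pose proof (Rabs_pos muk).
    apply Rmult_lt_0_compat; [lra|].
    assert (0 < (Rabs lm + 1) * c3) by (apply Rmult_lt_0_compat; lra). lra. }
  set (d0 := Rmin (1 / 2) (Rmin d1 d2)).
  assert (Hd0 : 0 < d0) by (unfold d0; repeat apply Rmin_pos; lra).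
  assert (L : d0 <= 1 / 2 /\ d0 <= d1 /\ d0 <= d2).
  { unfold d0, Rmin. repeat destruct Rle_dec; lra. }
  destruct (dominated_limit f (1 / 4) r (Rpower D p * / klo * C) d0) as [l Hl]; try lra.
  - apply Rmult_le_pos; auto. apply Rmult_le_pos; left; [apply Rpower_pos | now apply Rinv_0_lt_compat].
  - intros x Hx. apply continuity_2d_pt_mult.
    + apply (continuity_1d_2d_pt_comp (fun y => powR (Rabs y) p)).
      * apply continuity_pt_filterlim, powR_continuous. lra.
      * apply continuity_2d_pt_mult; [apply cont_1d_2d_snd, left_ext_cont, Hh|].
        apply continuity_2d_pt_minus; [|apply cont_1d_2d_snd, left_ext_cont, Hm].
        apply continuity_2d_pt_mult; [apply continuity_2d_pt_const | now apply ratio_cont_2d].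
    + apply continuity_2d_pt_mult; [now apply Wk_cont_2d|].
      apply continuity_2d_pt_inv; [apply cont_1d_2d_snd, left_ext_cont, HK0|].
      unfold K, left_ext. destruct (Rlt_dec 1 1); lra.
  - intros e x He _. apply continuous_ext with (fun x => powR (Rabs (Fk x e)) p * gk x e).
    + intros y. symmetry. apply Ef. lra.
    + apply Lp_mass_integrand_cont; [lra|]. unfold unitI; lra.
  - intros e x He Hx. assert (Hu : unitI e) by (unfold unitI; lra).
    rewrite Ef by lra. pose proof (Qk_pos x e Hu) as HQ.
    pose proof (Qk_upper x e ltac:(lra)) as HQ5.
    assert (Hg : 0 < gk x e) by (apply jac_pos; auto using cosA_smooth, sinB_smooth, Qk_pos).
    rewrite Rabs_right by (apply Rle_ge, Rmult_le_pos; [apply powR_ge_0 | lra]).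
    set (z := Rpower (Qk x e) (- / 2)).
    assert (Hz : 0 < z) by apply Rpower_pos.
    assert (Hcz : 1 <= c3 * z).
    { unfold c3, z. rewrite Rpower_Ropp.
      assert (Rpower (Qk x e) (/ 2) <= Rpower 5 (/ 2)) by (apply Rle_Rpower_l; lra).
      pose proof (Rpower_pos (Qk x e) (/ 2)).
      apply Rmult_le_reg_r with (Rpower (Qk x e) (/ 2)); auto.
      rewrite Rmult_assoc, Rinv_l; lra. }
    assert (HF : Rabs (Fk x e) <= D * z).
    { unfold strain. rewrite Rabs_mult. unfold D. rewrite Rmult_assoc.
      apply Rmult_le_compat; try apply Rabs_pos; [apply Bh; lra|].
      unfold Rminus. eapply Rle_trans; [apply Rabs_triang|]. rewrite Rabs_Ropp, Rabs_mult.
      rewrite Rmult_plus_distr_r. apply Rplus_le_compat.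
      - rewrite Rmult_assoc. apply Rmult_le_compat_l; [apply Rabs_pos | now apply ratio_bound].
      - apply Rle_trans with ((Rabs lm + 1) * 1); [rewrite Rmult_1_r; apply Bm; lra|].
        rewrite Rmult_assoc. apply Rmult_le_compat_l; auto. pose proof (Rabs_pos lm); lra. }
    assert (HP : powR (Rabs (Fk x e)) p <= Rpower D p * Rpower (Qk x e) (- (p / 2))).
    { replace (Rpower D p * Rpower (Qk x e) (- (p / 2))) with (powR (D * z) p).
      - apply powR_le; [lra|]. split; [apply Rabs_pos | auto].
      - rewrite powR_pos by now apply Rmult_lt_0_compat.
        rewrite <- Rpower_mult_distr by auto. f_equal. unfold z. rewrite Rpower_mult.
        f_equal. field. }
    assert (HG : gk x e <= Wk x e * / klo).
    { unfold jac. apply Rmult_le_compat_l; [left; apply Qmu_pos|].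
      apply Rinv_le_contravar; [auto | apply HK; lra]. }
    assert (HQp := HD e x ltac:(lra) Hx). unfold Rminus in HQp. rewrite Rpower_plus in HQp.
    fold (Wk x e) in HQp.
    apply Rle_trans with (Rpower D p * Rpower (Qk x e) (- (p / 2)) * (Wk x e * / klo)).
    + apply Rmult_le_compat; auto; [apply powR_ge_0 | lra].
    + replace (Rpower D p * Rpower (Qk x e) (- (p / 2)) * (Wk x e * / klo)) with
        (Rpower D p * / klo * (Wk x e * Rpower (Qk x e) (- (p / 2)))) by ring.
      rewrite (Rmult_assoc _ C). apply Rmult_le_compat_l; auto.
      apply Rmult_le_pos; left; [apply Rpower_pos | now apply Rinv_0_lt_compat].
  - assert (EN : forall e, 1 / 2 < e < 1 -> 4 * RInt (fun x => f x e) 0 (1 / 4) = Nk p e).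
    { intros e He. assert (Hu : unitI e) by (unfold unitI; lra). symmetry. unfold Lp_mass.
      rewrite (quarter_period (fun a => powR (Rabs (Fk a e)) p * gk a e)).
      - f_equal. apply ri_ext_all. intros x. symmetry. apply Ef. lra.
      - intros; apply Lp_mass_integrand_cont; auto; lra.
      - intros x. unfold strain, jac. now rewrite Qek_half, Qk_half, Wk_half.
      - intros x. unfold strain, jac. now rewrite Qek_opp, Qk_opp, Wk_opp. }
    assert (LN : filterlim (Nk p) (at_left 1) (locally (4 * l))).
    { apply filterlim_ext_loc with (fun e => 4 * RInt (fun x => f x e) 0 (1 / 4)).
      - apply (at_left_intro _ 1 (1 / 2)); [lra|]. intros e He. apply EN. lra.
      - eapply filterlim_comp; [exact Hl|]. apply (der_continuous (fun y => 4 * y) l 4).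
        auto_derive; auto. ring. }
    exists (4 * l). split; auto.
    apply (filterlim_le (F := at_left 1) (fun _ => 0) (Nk p) 0 (4 * l)); auto.
    + apply (at_left_intro _ 1 (1 / 2)); [lra|]. intros e He.
      apply Lp_mass_nonneg; [lra|]. unfold unitI; lra.
    + apply filterlim_const.
Qed.

End Convergence.

End Asymptotics.

(** * The data and the conclusion *)
Lemma smooth_on_unit_of (f : R -> R) :
  strip_smooth (fun _ => True) (fun x _ => f x) -> smooth_on_unit f.
Proof.
  intros Hf x _. apply filter_forall. intros y n. destruct n as [|n]; [exact I|].
  assert (H : forall n, strip_smooth (fun _ => True) (fun x _ => Derive_n f n x)).
  { induction n0 as [|j IH]; [exact Hf|].
    exact (smooth_dx_of _ _ open_all IH). }
  exists (dx (fun x _ => Derive_n f n x) y 0).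
  exact (smooth_der_x (fun _ => True) _ y 0 open_all (H n) I).
Qed.

Lemma powR_infty p : 0 < p ->
  filterlim (fun y => powR y p) (Rbar_locally p_infty) (Rbar_locally p_infty).
Proof.
  intros Hp P0 [M HM]. exists (Rpower (Rabs M + 1) (/ p)). intros y Hy. apply HM.
  assert (H0 : 0 < Rabs M + 1) by (pose proof (Rabs_pos M); lra).
  pose proof (Rpower_pos (Rabs M + 1) (/ p)).
  rewrite powR_pos by lra.
  apply Rlt_trans with (Rabs M + 1); [pose proof (Rle_abs M); lra|].
  replace (Rabs M + 1) with (Rpower (Rpower (Rabs M + 1) (/ p)) p) at 1.
  - apply Rlt_Rpower_l; lra.
  - rewrite Rpower_mult, Rinv_l, Rpower_1; lra.
Qed.

Lemma powR_norm_continuous p x : 0 < p -> 0 <= x ->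
  filterlim (fun y => powR (Rabs y) p) (locally x) (locally (powR x p)).
Proof.
  intros Hp Hx. rewrite <- (Rabs_right x) at 2 by lra. now apply powR_continuous.
Qed.

Lemma Derive_primitive_cosA (lam x : R) : lam <> 0 ->
  Derive (fun x => RInt cosA 0 x / lam) x = cosA x / lam.
Proof.
  intros Hl. apply is_derive_unique. der_by.
  - apply (der_mult (fun x => RInt cosA 0 x) (fun _ => / lam)); [|apply der_const].
    apply ri_primitive. intros y. apply (cont_2d_slice_l (fun x _ => cosA x) y 0).
    apply (smooth_continuity (fun _ => True)); auto. apply cosA_smooth.
  - cbv beta. unfold Rdiv. ring.
Qed.

Lemma Sn_zeros x : 0 <= x <= 1 -> Sn x = 0 -> x = 0 \/ x = 1 / 2 \/ x = 1.
Proof.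
  intros Hx HS. pose proof PI_RGT_0.
  assert (0 <= 2 * PI * x) by (apply Rmult_le_pos; lra).
  assert (2 * PI * x <= 2 * PI * 1) by (apply Rmult_le_compat_l; lra).
  assert (K : forall a, 2 * PI * x = 2 * PI * a -> x = a).
  { intros a E. apply Rmult_eq_reg_l with (2 * PI); lra. }
  destruct (sin_eq_O_2PI_0 (2 * PI * x)) as [E|[E|E]]; auto; try lra.
  - left. apply K. lra.
  - right; left. apply K. lra.
  - right; right. apply K. lra.
Qed.

Lemma Sn_0 : Sn 0 = 0.
Proof. unfold Sn. rewrite Rmult_0_r. apply sin_0. Qed.

(* The data determine (u, rho) only up to a moving frame: if (u, rho) is a
   solution and c is smooth with c(0) = c'(0) = 0, so is the (spatially periodic)
   pair u(x - c(t), t) + c'(t), rho(x - c(t), t).  "The corresponding solution"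
   is therefore rendered as: a solution on [0, tstar) exists, and every solution
   on [0, tstar) with these data has the stated properties. *)
Theorem theorem1p4 :
  forall (lambda kappa : R),
    lambda <> 0 -> kappa <> 0 -> lambda * kappa < 0 ->
    (lambda < 0 \/ 1 < lambda) ->
    exists u0 rho0 : R -> R,
      smooth_on_unit u0 /\ smooth_on_unit rho0 /\ periodic_data u0 rho0 /\
      (exists xs : list R,
         xs <> nil /\
         (forall x, In x xs <-> (0 <= x <= 1 /\ rho0 x = 0)) /\
         (forall x, In x xs -> 0 < lambda * Derive u0 x)) /\
      exists tstar : R,
        0 < tstar /\
        (exists u rho : R -> R -> R,
           gHS_solution lambda kappa u0 rho0 tstar u rho) /\
        (forall u rho : R -> R -> R,
           gHS_solution lambda kappa u0 rho0 tstar u rho ->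
           Linf_blowup u tstar /\
           (forall p : R,
              1 < p -> (lambda <= - 2 / p \/ 1 < lambda) ->
              filterlim (fun t => Lp_norm p (fun x => dx u x t))
                (at_left tstar) (Rbar_locally p_infty)) /\
           (forall p : R,
              1 <= p -> - 2 / (2 * p - 1) < lambda < 0 ->
              exists l : R,
                filterlim (fun t => Lp_norm p (fun x => dx u x t))
                  (at_left tstar) (locally l))).
Proof.
  intros lambda kappa Hl Hk Hlk Hreg.
  assert (Hkk : exists k : nat, (lambda < 0 /\ k = 2%nat) \/ (1 < lambda /\ k = 1%nat)).
  { destruct Hreg as [H|H]; [exists 2%nat | exists 1%nat]; auto. }
  destruct Hkk as [k regime].
  assert (Hk0 : (0 < k)%nat) by lia.
  set (c := / sqrt (- (lambda * kappa))).
  assert (Hsq : 0 < sqrt (- (lambda * kappa))) by (apply sqrt_lt_R0; lra).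
  assert (Hc0 : 0 < c) by now apply Rinv_0_lt_compat.
  assert (Hc : - lambda * kappa * c ^ 2 = 1).
  { unfold c. rewrite pow_inv, pow2_sqrt by lra. field. split; auto. }
  destruct (blowup_time lambda k regime) as (ts & HT1 & HT2).
  assert (HQ := Qk_pos k).
  exists (fun x => RInt cosA 0 x / lambda), (fun x => c * sinB k x).
  assert (HD : forall x, Derive (fun x => RInt cosA 0 x / lambda) x = cosA x / lambda).
  { intros; now apply Derive_primitive_cosA. }
  split; [|split; [|split; [|split]]].
  - apply smooth_on_unit_of. apply smooth_mult; [|apply smooth_const].
    apply (smooth_primitive (fun _ => True) (fun x _ => cosA x)); [apply open_all | apply cosA_smooth].
  - apply smooth_on_unit_of. apply smooth_mult; [apply smooth_const | apply sinB_smooth].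
  - split; [|split].
    + rewrite cosA_mean, (RInt_point (V := R_CompleteNormedModule)). reflexivity.
    + rewrite !HD, <- (Rplus_0_l 1), cosA_per. reflexivity.
    + rewrite <- (Rplus_0_l 1), sinB_per. reflexivity.
  - exists (0 :: 1 / 2 :: 1 :: nil).
    assert (HS : forall x, In x (0 :: 1 / 2 :: 1 :: nil) -> 0 <= x <= 1 /\ Sn x = 0).
    { intros x [<-|[<-|[<-|[]]]]; (split; [lra|]).
      - apply Sn_0.
      - rewrite <- (Rplus_0_l (1 / 2)), Sn_half, Sn_0. ring.
      - rewrite <- (Rplus_0_l 1), Sn_per. apply Sn_0. }
    split; [discriminate|]. split.
    + intros x. split.
      * intros Hx. destruct (HS x Hx) as [H1 H2]. split; auto.
        unfold sinB. rewrite H2, pow_i by auto. ring.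
      * intros [Hx E]. assert (E' : Sn x = 0).
        { apply Rmult_integral in E. destruct E as [E|E]; [lra|].
          apply NNPP. intros N. now apply (pow_nonzero _ k) in N. }
        simpl. destruct (Sn_zeros x Hx E') as [-> | [-> | ->]]; auto.
    + intros x Hx. rewrite HD, cosA_eq. destruct (HS x Hx) as [_ ->].
      replace (lambda * ((1 - 2 * 0 ^ 2) / lambda)) with 1 by (field; auto). lra.
  - exists ts.
    assert (Hts : 0 < ts) by (apply (ts_pos lambda ts cosA (sinB k)); auto).
    split; [exact Hts|]. split.
    + exists (refU lambda cosA (sinB k)), (refRho lambda c cosA (sinB k)).
      apply flow_solution; auto using cosA_smooth, sinB_smooth, cosA_per, sinB_per, cosA_mean.
    + intros u rho Hs.
      set (et := eta lambda cosA (sinB k)). set (N := Lp_mass lambda cosA (sinB k)).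
      assert (HL : filterlim et (at_left ts) (at_left 1)).
      { apply (eta_lim lambda ts); auto using cosA_smooth, sinB_smooth. }
      assert (HE : forall p t, 0 < p -> 0 <= t < ts ->
         Lp_norm p (fun x => dx u x t) = powR (N p (et t)) (/ p)).
      { intros p t Hp Ht. apply (any_solution_Lp lambda kappa c ts) with (rho := rho);
          auto using cosA_smooth, sinB_smooth, cosA_per, sinB_per, cosA_mean. }
      assert (Blow : forall p, 1 < p -> (lambda <= - 2 / p \/ 1 < lambda) ->
              filterlim (fun t => Lp_norm p (fun x => dx u x t))
                (at_left ts) (Rbar_locally p_infty)).
      { intros p Hp Hcase. apply filterlim_ext_loc with (fun t => powR (N p (et t)) (/ p)).
        { apply (at_left_intro _ ts ts Hts). intros t Ht. symmetry. apply HE; lra. }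
        apply (filterlim_comp _ _ _ (fun t => N p (et t)) (fun y => powR y (/ p))
                 (at_left ts) (Rbar_locally p_infty));
          [|apply powR_infty, Rinv_0_lt_compat; lra].
        apply (filterlim_comp _ _ _ et (N p) (at_left ts) (at_left 1)); [exact HL|].
        now apply Lp_mass_blowup. }
      split; [|split; [exact Blow|]].
      * (* the sup norm dominates every L^p norm; take p large *)
        assert (Hp : exists p, 1 < p /\ (lambda <= - 2 / p \/ 1 < lambda)).
        { destruct Hreg as [H|H]; [|exists 2; split; [lra | now right]].
          assert (Hi : 0 < / - lambda) by (apply Rinv_0_lt_compat; lra).
          exists (2 * / - lambda + 2). split; [lra|]. left.
          assert (/ (2 * / - lambda + 2) <= / (2 * / - lambda)) by (apply Rinv_le_contravar; lra).
          replace (/ (2 * / - lambda)) with (- lambda / 2) in H0 by (field; lra).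
          unfold Rdiv. lra. }
        destruct Hp as (p & Hp & Hcase).
        apply filterlim_ge_p_infty with (fun t => Lp_norm p (fun x => dx u x t)); auto.
        apply (at_left_intro _ ts ts Hts). intros t Ht.
        apply Lp_le_Linf; [lra|]. intros x Hx.
        apply cont_2d_slice_l, smooth_near_cont, smooth_near_dx, (gHS_smooth_u _ _ _ _ _ _ _ Hs x t Hx). lra.
      * intros p Hp Hlam.
        assert (Hint : -1 < 2 * INR k * (mu lambda - p / 2)).
        { destruct regime as [[_ ->]|[H _]]; [|lra]. unfold mu. simpl.
          replace (2 * (1 + 1) * (-1 / (2 * lambda) - p / 2)) with (2 * / - lambda - 2 * p)
            by (field; lra).
          assert (H1 : / (2 / (2 * p - 1)) < / - lambda).
          { apply Rinv_lt_contravar.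
            - apply Rmult_lt_0_compat; [lra | apply Rdiv_lt_0_compat; lra].
            - replace (- 2 / (2 * p - 1)) with (- (2 / (2 * p - 1))) in Hlam by (field; lra). lra. }
          replace (/ (2 / (2 * p - 1))) with ((2 * p - 1) / 2) in H1 by (field; lra). lra. }
        destruct (Lp_mass_converges lambda k regime p Hp Hint) as (l & Hl0 & Hlim).
        exists (powR l (/ p)).
        assert (Np0 : at_left ts (fun t =>
          powR (Rabs (N p (et t))) (/ p) = Lp_norm p (fun x => dx u x t))).
        { apply (at_left_intro _ ts ts Hts). intros t Ht.
          rewrite Rabs_right.
          - symmetry. apply HE; lra.
          - apply Rle_ge, Lp_mass_nonneg; [lra|].
            apply (eta_unit lambda ts cosA (sinB k)); auto using cosA_smooth, sinB_smooth.
            apply timeJ_nonneg; auto using cosA_smooth, sinB_smooth; lra. }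
        eapply filterlim_ext_loc; [exact Np0|].
        apply (filterlim_comp _ _ _ (fun t => N p (et t)) (fun y => powR (Rabs y) (/ p))
                 (at_left ts) (locally l)).
        -- apply (filterlim_comp _ _ _ et (N p) (at_left ts) (at_left 1)); [exact HL | exact Hlim].
        -- apply powR_norm_continuous; auto. apply Rinv_0_lt_compat; lra.
Qed.
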